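(* Let $K$ be a finite extension of $\mathbb{Q}_p$, let $\Gamma\subset\mathrm{PGL}(2,K)$ be a Schottky group of rank $g\ge2$, let $\mathcal{W}=\mathcal{W}(\Delta_\Gamma/\Gamma)$ be the space of doubly infinite walks on the finite graph $\Delta_\Gamma/\Gamma$ with shift $T$, and let $\mathcal{W}_T$ be the mapping torus of $T$. The map $f\mapsto[\exp(2\pi i\,t f(x))]$, which associates to an element $f\in C(\mathcal{W},\mathbb{Z})$ a homotopy class of maps from $\mathcal{W}_T$ to the circle, gives an isomorphism $$C(\mathcal{W},\mathbb{Z})_T\simeq H^1(\mathcal{W}_T,\mathbb{Z}).$$ Moreover, there is a filtration of $C(\mathcal{W},\mathbb{Z})_T$ by free $\mathbb{Z}$-modules $F_0\subset F_1\subset\cdots\subset F_n\subset\cdots$, where $F_n$ has rank $\theta_n-\theta_{n-1}+1$, with $\theta_n$ the number of admissible words of length $n+1$ in the alphabet, so that $$H^1(\mathcal{W}_T,\mathbb{Z})=\varinjlim_nF_n.$$ The quotients $F_{n+1}/F_n$ are also torsion free.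
   Context: A Schottky group of rank $g$ in $\mathrm{PGL}(2,K)$ is a discrete, purely loxodromic (hyperbolic) subgroup isomorphic to a free group of rank $g$. Let $\Delta_K$ be the Bruhat--Tits tree of $\mathrm{PGL}(2,K)$ and let $\Delta'_\Gamma\subset\Delta_K$ be the smallest subtree containing the axes of all elements of $\Gamma$. $\Delta_\Gamma$ is the smallest tree on which $\Gamma$ acts such that $\Delta_\Gamma/\Gamma$ is the (finite) dual graph of the special fibre of the stable $k$-split degenerate curve uniformized by $\Gamma$ (the Mumford curve), where $k$ is the residue field of $K$; it is obtained from $\Delta'_\Gamma$ by forgetting the vertices of valence $2$. The quotient $\Delta_\Gamma/\Gamma$ may have loops and multiple edges. An oriented edge of a graph is a pair $w=\{e,\epsilon\}$ with $e$ an edge and $\epsilon=\pm1$ an orientation; it has a source $s(w)$, a range $r(w)$ and a reverse $\iota(w)=\{e,-\epsilon\}$. A juxtaposition $w_1w_2$ is admissible if $w_2\ne\iota(w_1)$ and $r(w_1)=s(w_2)$. The alphabet is the finite set of oriented edges (with both orientations) of $\Delta_\Gamma/\Gamma$, and a word is admissible if all consecutive pairs are admissible (the empty word, of length $0$, counts as one word, so $\theta_{-1}=1$). $\mathcal{W}(\Delta_\Gamma/\Gamma)$ is the set of doubly infinite admissible sequences $(\omega_k)_{k\in\mathbb{Z}}$ of oriented edges, with the topology induced by the product topology; it is a totally disconnected compact Hausdorff space. The invertible shift is $(T\omega)_k=\omega_{k+1}$. The mapping torus is $\mathcal{W}_T=\mathcal{W}\times[0,1]/\big((Tx,0)\sim(x,1)\big)$,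 with $t$ the coordinate in $[0,1]$. $H^1(\mathcal{W}_T,\mathbb{Z})$ is the group of homotopy classes of continuous maps $\mathcal{W}_T\to S^1$. $C(\mathcal{W},\mathbb{Z})$ is the $\mathbb{Z}$-module of continuous integer-valued functions on $\mathcal{W}$ and $C(\mathcal{W},\mathbb{Z})_T:=\operatorname{Coker}(\delta)$, where $\delta(f)=f-f\circ T$. *)

(* Defs.v *)
From HB Require Import structures.
From mathcomp Require Import all_boot all_order all_algebra all_field.
From mathcomp Require Import ring_quotient generic_quotient finmap.
From mathcomp Require Import all_classical all_reals all_analysis.
From mathcomp Require Import ring.
From Stdlib Require Import Relation_Operators.

Set Implicit Arguments.
Unset Strict Implicit.
Unset Printing Implicit Defensive.

Import Order.TTheory GRing.Theory Num.Theory.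
Import numFieldNormedType.Exports.
Local Open Scope classical_set_scope.
Local Open Scope ring_scope.
Local Open Scope quotient_scope.
Local Open Scope card_scope.

Record nonarch_abs (R : realType) (F : fieldType) (nu : F -> R) : Prop :=
  NonarchAbs {
    nonarch_ge0 : forall x, 0 <= nu x;
    nonarch_eq0 : forall x, nu x = 0 <-> x = 0;
    nonarchM : forall x y, nu (x * y) = nu x * nu y;
    nonarchD : forall x y, nu (x + y) <= Num.max (nu x) (nu y) }.

(* (F, nu) is a completion of the rationals for the p-adic absolute value;
   this determines (F, nu) up to a unique isometric isomorphism.  By
   multiplicativity it is enough to prescribe nu on the positive integers. *)
Record is_Qp (R : realType) (p : nat) (F : fieldType) (nu : F -> R) : Prop :=
  IsQp {
    Qp_nonarch : nonarch_abs nu;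
    Qp_padic : forall n : nat, (0 < n)%N -> nu n%:R = p%:R ^- logn p n;
    Qp_dense : forall (x : F) (e : R), 0 < e ->
      exists q : rat, nu (x - ratr q) < e;
    Qp_complete : forall u : nat -> F,
      (forall e : R, 0 < e -> exists N : nat, forall m n : nat,
         (N <= m)%N -> (N <= n)%N -> nu (u m - u n) < e) ->
      exists l : F, forall e : R, 0 < e -> exists N : nat, forall n : nat,
         (N <= n)%N -> nu (u n - l) < e }.

Section PGL2.
Variable K : fieldType.

Definition GL2 := {M : 'M[K]_2 | M \in unitmx}.
HB.instance Definition _ := Choice.on GL2.

Definition GL2_mul (M N : GL2) : GL2 :=
  exist _ (val M *m val N)
    (etrans (unitmx_mul (val M) (val N)) (introT andP (conj (valP M) (valP N)))).
Definition GL2_inv (M : GL2) : GL2 :=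
  exist _ (invmx (val M)) (etrans (unitmx_inv (val M)) (valP M)).
Definition GL2_one : GL2 := exist _ 1%:M (unitmx1 K 2).

Definition proportional (M N : GL2) : bool :=
  `[< exists2 c : K, c != 0 & val M = c *: val N >].

Lemma proportional_equiv : equiv_class_of proportional.
Proof.
split=> [M|M N|N M P].
- by apply/asboolP; exists 1; rewrite ?oner_eq0 ?scale1r.
- by apply/asboolP/asboolP => -[c c0 e]; exists c^-1;
    rewrite ?invr_eq0// e scalerA mulVf ?scale1r.
- move=> /asboolP[c c0 e] /asboolP[d d0 e']; apply/asboolP; exists (c * d).
    by rewrite mulf_neq0.
  by rewrite e e' scalerA.
Qed.

Canonical proportional_equivRel := EquivRelPack proportional_equiv.
Canonical proportional_encModRel := defaultEncModRel proportional.

Definition PGL2 := {eq_quot proportional}.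
HB.instance Definition _ := EqQuotient.on PGL2.
HB.instance Definition _ := Choice.on PGL2.

Definition PGL2_mul (x y : PGL2) : PGL2 :=
  \pi_PGL2 (GL2_mul (repr x) (repr y)).
Definition PGL2_inv (x : PGL2) : PGL2 := \pi_PGL2 (GL2_inv (repr x)).
Definition PGL2_one : PGL2 := \pi_PGL2 GL2_one.

Lemma PGL2_eqP (M N : GL2) : reflect
  (exists2 c : K, c != 0 & val M = c *: val N) (\pi_PGL2 M == \pi_PGL2 N).
Proof. by rewrite piE; apply: asboolP. Qed.

Lemma PGL2_reprP (M : GL2) :
  exists2 c : K, c != 0 & val (repr (\pi_PGL2 M)) = c *: val M.
Proof. by apply/PGL2_eqP; rewrite reprK. Qed.

Lemma PGL2_mul_pi (M N : GL2) :
  PGL2_mul (\pi_PGL2 M) (\pi_PGL2 N) = \pi_PGL2 (GL2_mul M N).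
Proof.
apply/eqP/PGL2_eqP; have [c c0 e] := PGL2_reprP M.
have [d d0 e'] := PGL2_reprP N; exists (c * d); first by rewrite mulf_neq0.
by rewrite /= e e' -scalemxAl -scalemxAr scalerA.
Qed.

Lemma PGL2_inv_pi (M : GL2) : PGL2_inv (\pi_PGL2 M) = \pi_PGL2 (GL2_inv M).
Proof.
apply/eqP/PGL2_eqP; have [c c0 e] := PGL2_reprP M.
exists c^-1; first by rewrite invr_eq0.
have uM : c *: val M \in unitmx by rewrite unitmxZ ?unitfE//; exact: valP M.
by rewrite /= e invmxZ.
Qed.

Lemma PGL2_mulA : associative PGL2_mul.
Proof.
elim/quotW=> x; elim/quotW=> y; elim/quotW=> z.
rewrite (PGL2_mul_pi y z) (PGL2_mul_pi x y) (PGL2_mul_pi x) (PGL2_mul_pi _ z).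
by apply: (congr1 \pi_PGL2); apply: val_inj; rewrite /= mulmxA.
Qed.
Lemma PGL2_mul1 : left_id PGL2_one PGL2_mul.
Proof.
elim/quotW=> x; rewrite PGL2_mul_pi.
by apply: (congr1 \pi_PGL2); apply: val_inj; rewrite /= mul1mx.
Qed.
Lemma PGL2_1mul : right_id PGL2_one PGL2_mul.
Proof.
elim/quotW=> x; rewrite PGL2_mul_pi.
by apply: (congr1 \pi_PGL2); apply: val_inj; rewrite /= mulmx1.
Qed.
Lemma PGL2_mulV : left_inverse PGL2_one PGL2_inv PGL2_mul.
Proof.
elim/quotW=> x; rewrite (PGL2_inv_pi x) PGL2_mul_pi.
by apply: (congr1 \pi_PGL2); apply: val_inj; rewrite /= mulVmx//; exact: (valP x).
Qed.
Lemma PGL2_Vmul : right_inverse PGL2_one PGL2_inv PGL2_mul.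
Proof.
elim/quotW=> x; rewrite (PGL2_inv_pi x) PGL2_mul_pi.
by apply: (congr1 \pi_PGL2); apply: val_inj; rewrite /= mulmxV//; exact: (valP x).
Qed.

HB.instance Definition _ :=
  isGroup.Build PGL2 PGL2_mulA PGL2_mul1 PGL2_1mul PGL2_mulV PGL2_Vmul.

End PGL2.

Definition subgroup (G : groupType) (H : set G) : Prop :=
  H 1%g /\ forall x y, H x -> H y -> H (x * y^-1)%g.

(* A letter (i, true) stands for the i-th generator, (i, false) for its
   inverse. *)
Definition eval_word (G : groupType) (g : nat) (a : 'I_g -> G)
    (s : seq ('I_g * bool)) : G :=
  foldr (fun l x => ((if l.2 then a l.1 else (a l.1)^-1) * x)%g) 1%g s.

Definition reduced (g : nat) (s : seq ('I_g * bool)) : bool :=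
  sorted (fun l l' => l' != (l.1, ~~ l.2)) s.

Definition free_of_rank (G : groupType) (g : nat) (H : set G) : Prop :=
  exists a : 'I_g -> G, set_bij [set s | reduced s] H (eval_word a).

Section Schottky.
Variables (R : realType) (K : fieldType) (nu : K -> R).

(* Open sets of the quotient topology on PGL(2, K) = GL(2, K) / K^*. *)
Definition PGL2_open (U : set (PGL2 K)) : Prop :=
  forall M : GL2 K, U (\pi M) -> exists2 e : R, 0 < e &
    forall N : GL2 K, (forall i j, nu (val N i j - val M i j) < e) -> U (\pi N).

Definition discrete_subset (Gam : set (PGL2 K)) : Prop :=
  forall x, Gam x -> exists2 U, PGL2_open U & U `&` Gam = [set x].

(* The eigenvalues lie in K and have different absolute values; the condition
   does not depend on the matrix chosen to represent x. *)
Definition hyperbolic (x : PGL2 K) : Prop :=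
  exists a b : K,
    char_poly (val (repr x)) = ('X - a%:P) * ('X - b%:P) /\ nu a != nu b.

Record schottky (g : nat) (Gam : set (PGL2 K)) : Prop := Schottky {
  schottky_group : subgroup Gam;
  schottky_discrete : discrete_subset Gam;
  schottky_hyperbolic : forall x, Gam x -> x != 1%g -> hyperbolic x;
  schottky_free : free_of_rank g Gam }.

End Schottky.

Section BruhatTits.
Variables (R : realType) (K : fieldType) (nu : K -> R).

(* The columns of M form a basis of the lattice over {x | nu x <= 1}. *)
Definition lattice_of (M : 'M[K]_2) : set 'cV[K]_2 :=
  [set M *m x | x in [set x : 'cV[K]_2 | forall i, nu (x i 0) <= 1]].

Definition is_lattice (L : set 'cV[K]_2) : Prop :=
  exists2 M, M \in unitmx & L = lattice_of M.

Definition scale_lattice (c : K) (L : set 'cV[K]_2) : set 'cV[K]_2 :=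
  [set c *: x | x in L].

(* A vertex is a homothety class of lattices, viewed as a set of lattices. *)
Definition homothety_class (L : set 'cV[K]_2) : set (set 'cV[K]_2) :=
  [set scale_lattice c L | c in [set c | c != 0]].

Definition BT_vertex : set (set (set 'cV[K]_2)) :=
  [set homothety_class L | L in is_lattice].

Definition uniformizer (a : K) : Prop :=
  [/\ a != 0, nu a < 1 & forall x, nu x < 1 -> nu x <= nu a].

Definition BT_adj : rel (set (set 'cV[K]_2)) := fun v w =>
  `[< [/\ BT_vertex v, BT_vertex w & exists a L L',
        [/\ uniformizer a, v L, w L', scale_lattice a L `<` L' & L' `<` L]] >].

Definition BT_act (x : PGL2 K) (v : set (set 'cV[K]_2)) : set (set 'cV[K]_2) :=
  [set [set val (repr x) *m u | u in L] | L in v].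

End BruhatTits.

Section CoreGraph.
Variables (X : choiceType) (V : set X) (adj : rel X).
Variables (G : groupType) (act : G -> X -> X) (Gam : set G).

Definition subtree (S : set X) : Prop :=
  S `<=` V /\ forall x y, S x -> S y ->
    exists s : seq X, [/\ path adj x s, last x s = y & [set` s] `<=` S].

(* In a tree, a doubly infinite path without backtracking is a line; the axis
   of f is the line on which f acts as a translation, by l <> 0 steps. *)
Definition is_axis (f : X -> X) (A : set X) : Prop :=
  exists (v : int -> X) (l : int),
    [/\ l != 0,
        forall k, V (v k) /\ adj (v k) (v (k + 1)),
        forall k, v (k + 2) <> v k,
        forall k, f (v k) = v (k + l)
      & A = range v].

(* The smallest subtree containing the axes: a subtree is determined by its
   vertices, and intersections of subtrees of a tree are subtrees. *)
Definition axes_hull : set X :=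
  \bigcap_(S in [set S | subtree S /\
    forall g A, Gam g -> is_axis (act g) A -> A `<=` S]) S.

Definition bivalent (x : X) : Prop :=
  [set y | axes_hull y /\ adj x y] #= `I_2.

(* Oriented edges of Delta_Gamma: the vertices of valence 2 of Delta'_Gamma
   being forgotten, such an edge is a simple path of Delta'_Gamma of positive
   length whose interior vertices, and only these, have valence 2. *)
Definition is_arc (s : seq X) : Prop :=
  exists (x : X) (m : seq X) (y : X),
    [/\ s = x :: rcons m y,
        path adj x (rcons m y) /\ uniq s,
        [set` s] `<=` axes_hull,
        ~ bivalent x /\ ~ bivalent y
      & forall z, z \in m -> bivalent z].

(* Edges and vertices of Delta_Gamma / Gamma are handled as orbits, i.e. sets.
   As Gamma acts without inversion, [reverse w] and w are the two distinct
   orientations {e, 1} and {e, -1} of one and the same edge e. *)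
Definition arc_orbit (s : seq X) : set (seq X) :=
  [set map (act g) s | g in Gam].

Definition quotient_edge : set (set (seq X)) :=
  [set arc_orbit s | s in is_arc].

Definition reverse (w : set (seq X)) : set (seq X) := [set rev s | s in w].

Definition source (w : set (seq X)) : set X :=
  [set x | exists2 s, w s & ohead s = Some x].

Definition target (w : set (seq X)) : set X := source (reverse w).

Definition admissible : rel (set_type quotient_edge) := fun w1 w2 =>
  `[< val w2 <> reverse (val w1) /\ target (val w1) = source (val w2) >].

End CoreGraph.

Lemma continuous_to_ptws (X Z : topologicalType) (I : Type)
    (f : X -> {ptws I -> Z}) :
  (forall i, continuous (fun x => f x i)) -> continuous f.
Proof.
move=> cf x; apply/cvg_sup => i.
have : continuous (f : X -> initial_topology (fun u : I -> Z => u i)).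
  exact: continuous_comp_initial (cf i).
exact.
Qed.

Section Walks.
Variables (E : choiceType) (adm : rel E).

Definition words (l : nat) : set (seq E) :=
  [set s | size s = l /\ sorted adm s].

(* theta_n is nwords n.+1; in particular theta_(-1) is nwords 0 = 1.  The
   cardinal is a junk value when words l is infinite. *)
Definition nwords (l : nat) : nat := #|` fset_set (words l)|.

Definition walk_set : set {ptws int -> discrete_topology E} :=
  [set w | forall k : int, adm (w k) (w (k + 1))].

Definition walks := set_type walk_set.
HB.instance Definition _ := Topological.on walks.

Lemma shift_subproof (w : walks) :
  ((fun k => val w (k + 1)) : {ptws int -> discrete_topology E}) \in walk_set.
Proof. by apply/mem_set => k; have /set_mem := valP w; apply. Qed.

Definition shift (w : walks) : walks :=
  exist (fun u => u \in walk_set) _ (shift_subproof w).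

Lemma shift_continuous : continuous shift.
Proof.
apply: continuous_comp_initial; apply: continuous_to_ptws => k w.
have pc : continuous
    (fun u : {ptws int -> discrete_topology E} => u (k + 1)).
  exact: (@proj_continuous int (fun=> discrete_topology E) (k + 1)).
exact: (continuous_comp (@initial_continuous _ _ set_val w) (pc _)).
Qed.

Definition walk_shift : continuousType walks walks := mkcts shift_continuous.

End Walks.

Section ContinuousZmod.
Variables (X : topologicalType) (M : topologicalZmodType).
Implicit Types f g h : continuousType X M.

Lemma cts_add_subproof f g : continuous (fun x => f x + g x).
Proof.
move=> x.
have fgx : (f y, g y) @[y --> x] --> (f x, g x).
  by apply: cvg_pair; apply: cts_fun.
exact: (cvg_comp _ (fun z => z.1 + z.2) fgx (@add_continuous M (f x, g x))).
Qed.
Lemma cts_opp_subproof f : continuous (fun x => - f x).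
Proof.
move=> x; apply: (@continuous_comp _ _ _ f -%R); first exact: cts_fun.
exact: opp_continuous.
Qed.

Definition cts_add f g : continuousType X M := mkcts (@cts_add_subproof f g).
Definition cts_opp f : continuousType X M := mkcts (@cts_opp_subproof f).
Definition cts_zero : continuousType X M := mkcts (@cst_continuous X M 0).

Lemma cts_addA : associative cts_add.
Proof. by move=> f g h; apply/continuousEP => x; apply: addrA. Qed.
Lemma cts_addC : commutative cts_add.
Proof. by move=> f g; apply/continuousEP => x; apply: addrC. Qed.
Lemma cts_add0 : left_id cts_zero cts_add.
Proof. by move=> f; apply/continuousEP => x; apply: add0r. Qed.
Lemma cts_addN : left_inverse cts_zero cts_opp cts_add.
Proof. by move=> f; apply/continuousEP => x; apply: addNr. Qed.

HB.instance Definition _ := GRing.isZmodule.Build (continuousType X M)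
  cts_addA cts_addC cts_add0 cts_addN.

End ContinuousZmod.

Definition intd : Type := discrete_topology int.
HB.instance Definition _ := Topological.on intd.
HB.instance Definition _ := GRing.Zmodule.copy intd int.

Lemma intd_sub_continuous : continuous (fun x : intd * intd => x.1 - x.2).
Proof.
move=> x A /nbhs_singleton Ax; exists ([set x.1], [set x.2]) => /=.
  by split; apply: (@discrete_set1 (discrete_topology int)).
by case=> a b [/= -> ->].
Qed.
HB.instance Definition _ :=
  PreTopologicalNmodule_isTopologicalZmodule.Build intd intd_sub_continuous.

Section Circle.
Variable R : realType.

(* The unit circle of the complex plane R * R; its group law, the complex
   multiplication, is written additively. *)
Definition circle_set : set (R * R) := [set z | z.1 ^+ 2 + z.2 ^+ 2 = 1].
Definition circle := set_type circle_set.
HB.instance Definition _ := Topological.on circle.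

Lemma circleP (z : circle) : (val z).1 ^+ 2 + (val z).2 ^+ 2 = 1.
Proof. exact: (set_mem (valP z)). Qed.

Definition circle_of (z : R * R) (hz : circle_set z) : circle :=
  exist (fun z => z \in circle_set) z (mem_set hz).

Lemma circle_mul_subproof (z w : circle) : circle_set
  ((val z).1 * (val w).1 - (val z).2 * (val w).2,
   (val z).1 * (val w).2 + (val z).2 * (val w).1).
Proof.
have := circleP z; have := circleP w; rewrite /circle_set /=.
case: (sval z) (sval w) => a b [c d] /= hw hz.
by transitivity ((a ^+ 2 + b ^+ 2) * (c ^+ 2 + d ^+ 2));
  [ring | rewrite hz hw mulr1].
Qed.
Lemma circle_inv_subproof (z : circle) : circle_set ((val z).1, - (val z).2).
Proof. by rewrite /circle_set /= sqrrN; apply: circleP. Qed.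
Lemma circle_one_subproof : circle_set (1, 0).
Proof. by rewrite /circle_set /= expr1n expr0n addr0. Qed.
Lemma circle_exp_subproof (s : R) :
  circle_set (cos (2 * pi * s), sin (2 * pi * s)).
Proof. exact: cos2Dsin2. Qed.

Definition circle_mul (z w : circle) := circle_of (circle_mul_subproof z w).
Definition circle_inv (z : circle) := circle_of (circle_inv_subproof z).
Definition circle_one := circle_of circle_one_subproof.

(* s |-> exp (2 pi i s) *)
Definition circle_exp (s : R) : circle := circle_of (circle_exp_subproof s).

Lemma circle_mulA : associative circle_mul.
Proof. by move=> x y z; apply: val_inj; congr pair => /=; ring. Qed.
Lemma circle_mulC : commutative circle_mul.
Proof. by move=> x y; apply: val_inj; congr pair => /=; ring. Qed.
Lemma circle_mul1 : left_id circle_one circle_mul.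
Proof.
move=> x; apply: val_inj; rewrite [RHS]surjective_pairing.
by congr pair => /=; ring.
Qed.
Lemma circle_mulV : left_inverse circle_one circle_inv circle_mul.
Proof.
move=> x; apply: val_inj; have := circleP x; rewrite /=.
by case: (sval x) => a b /= hx; congr pair; [rewrite -hx; ring | ring].
Qed.
HB.instance Definition _ := GRing.isZmodule.Build circle
  circle_mulA circle_mulC circle_mul1 circle_mulV.

Lemma circle_continuous (X : topologicalType) (f : X -> circle) :
  continuous (fun x => (val (f x)).1) -> continuous (fun x => (val (f x)).2) ->
  continuous f.
Proof.
move=> f1 f2; apply: continuous_comp_initial => x.
rewrite /continuous_at /=.
have -> : set_val \o f = fun x => ((val (f x)).1, (val (f x)).2).
  by apply/funext => y /=; rewrite -surjective_pairing.
exact: (cvg_pair (f1 x) (f2 x)).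
Qed.

Lemma circle_fst_continuous : continuous (fun z : circle => (val z).1).
Proof.
by move=> z; apply: (continuous_comp (@initial_continuous _ _ set_val z));
  apply: cvg_fst.
Qed.
Lemma circle_snd_continuous : continuous (fun z : circle => (val z).2).
Proof.
by move=> z; apply: (continuous_comp (@initial_continuous _ _ set_val z));
  apply: cvg_snd.
Qed.

Lemma circle_sub_continuous :
  continuous (fun x : circle * circle => x.1 - x.2).
Proof.
have c1 (h : circle * circle -> circle) : continuous h ->
    continuous (fun x => (val (h x)).1).
  by move=> ch x; exact: (cvg_comp _ _ (ch x) (@circle_fst_continuous (h x))).
have c2 (h : circle * circle -> circle) : continuous h ->
    continuous (fun x => (val (h x)).2).
  by move=> ch x; exact: (cvg_comp _ _ (ch x) (@circle_snd_continuous (h x))).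
have p1 : continuous (@fst circle circle) by move=> x; apply: cvg_fst.
have p2 : continuous (@snd circle circle) by move=> x; apply: cvg_snd.
have [a1 a2] := (c1 _ p1, c2 _ p1); have [b1 b2] := (c1 _ p2, c2 _ p2).
apply: circle_continuous => x.
- exact: (cvgB (cvgM (a1 x) (b1 x)) (cvgM (a2 x) (cvgN (b2 x)))).
- exact: (cvgD (cvgM (a1 x) (cvgN (b2 x))) (cvgM (a2 x) (b1 x))).
Qed.
HB.instance Definition _ :=
  PreTopologicalNmodule_isTopologicalZmodule.Build circle circle_sub_continuous.

Lemma circle_exp_continuous : continuous circle_exp.
Proof.
have l : continuous (fun s : R => 2 * pi * s) by move=> s; apply: mulrl_continuous.
apply: circle_continuous => s.
  exact: (cvg_comp _ _ (l s) (@continuous_cos R _)).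
exact: (cvg_comp _ _ (l s) (@continuous_sin R _)).
Qed.

Lemma circle_exp0 : circle_exp 0 = 0.
Proof. by apply: val_inj; rewrite /= mulr0 cos0 sin0. Qed.

Lemma circle_expD s t : circle_exp (s + t) = circle_exp s + circle_exp t.
Proof.
apply: val_inj; rewrite /= mulrDr cosD sinD; congr pair.
by rewrite addrC.
Qed.

Lemma circle_exp_int (m : int) : circle_exp m%:~R = 0.
Proof.
have e1 : circle_exp 1 = 0.
  apply: val_inj; rewrite /= mulr1; congr pair.
    by rewrite mulr_natl cos2pi.
  by rewrite mulr_natl sin2pi.
have en (n : nat) : circle_exp n%:R = 0.
  elim: n => [|n IHn]; first exact: circle_exp0.
  by rewrite -addn1 natrD circle_expD IHn e1 addr0.
case: m => n; first exact: en.
have := circle_expD (Negz n)%:~R n.+1%:R.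
by rewrite en addr0 NegzE mulrNz addNr circle_exp0 => <-.
Qed.

End Circle.

Section Cohomology.
Variables (R : realType) (Y : topologicalType).
Local Notation S1 := (circle R).

Definition unit_interval := set_type (`[0, 1]%classic : set R).
HB.instance Definition _ := Topological.on unit_interval.

Definition homotopic : rel (continuousType Y S1) := fun f g =>
  `[< exists H : continuousType (Y * unit_interval)%type S1,
      forall (y : Y) (t : unit_interval),
        (val t = 0 -> H (y, t) = f y) /\ (val t = 1 -> H (y, t) = g y) >].

Lemma cst_homotopy_subproof (f : continuousType Y S1) :
  continuous (fun z : Y * unit_interval => f z.1).
Proof.
move=> z; apply: (@continuous_comp _ _ _ fst f); first exact: cvg_fst.
exact: cts_fun.
Qed.
Definition cst_homotopy f : continuousType (Y * unit_interval)%type S1 :=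
  mkcts (@cst_homotopy_subproof f).

Lemma homotopicxx f : homotopic f f.
Proof. by apply/asboolP; exists (cst_homotopy f). Qed.

Lemma homotopicD f f' g g' :
  homotopic f f' -> homotopic g g' -> homotopic (f + g) (f' + g').
Proof.
move=> /asboolP[H hH] /asboolP[H' hH']; apply/asboolP; exists (H + H') => y t.
split=> ht.
  by congr (_ + _); [apply: (hH y t).1 | apply: (hH' y t).1].
by congr (_ + _); [apply: (hH y t).2 | apply: (hH' y t).2].
Qed.

Lemma homotopicN f f' : homotopic f f' -> homotopic (- f) (- f').
Proof.
move=> /asboolP[H hH]; apply/asboolP; exists (- H) => y t.
by split=> ht; congr (- _); [apply: (hH y t).1 | apply: (hH y t).2].
Qed.

Lemma homotopic_equiv : equiv_class_of homotopic.
Proof.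
have sym f g : homotopic f g -> homotopic g f.
  move=> /homotopicN fg; have := homotopicD (homotopicxx (f + g)) fg.
  by rewrite addrK addrAC subrr add0r.
split=> [f|f g|g f h]; first exact: homotopicxx.
  by apply/idP/idP; apply: sym.
move=> fg gh; have := homotopicD (homotopicD fg gh) (homotopicxx (- g)).
by rewrite addrK addrAC subrr add0r.
Qed.

Canonical homotopic_equivRel := EquivRelPack homotopic_equiv.
Canonical homotopic_encModRel := defaultEncModRel homotopic.

Definition H1 := {eq_quot homotopic}.
HB.instance Definition _ := EqQuotient.on H1.
HB.instance Definition _ := Choice.on H1.

Definition H1_zero : H1 := \pi_H1 0.
Definition H1_add (a b : H1) : H1 := \pi_H1 (repr a + repr b).
Definition H1_opp (a : H1) : H1 := \pi_H1 (- repr a).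

Lemma homotopic_repr f : homotopic (repr (\pi_H1 f)) f.
Proof. by have /eqP := reprK (\pi_H1 f); rewrite piE. Qed.

Lemma H1_add_pi f g : H1_add (\pi_H1 f) (\pi_H1 g) = \pi_H1 (f + g).
Proof. by apply/eqP; rewrite piE; apply: homotopicD; apply: homotopic_repr. Qed.

Lemma H1_opp_pi f : H1_opp (\pi_H1 f) = \pi_H1 (- f).
Proof. by apply/eqP; rewrite piE; apply: homotopicN; apply: homotopic_repr. Qed.

Lemma H1_addA : associative H1_add.
Proof.
elim/quotW=> f; elim/quotW=> g; elim/quotW=> h.
by rewrite (H1_add_pi g h) (H1_add_pi f g) (H1_add_pi f) (H1_add_pi _ h) addrA.
Qed.
Lemma H1_addC : commutative H1_add.
Proof. by move=> a b; rewrite /H1_add addrC. Qed.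
Lemma H1_add0 : left_id H1_zero H1_add.
Proof. by elim/quotW=> f; rewrite H1_add_pi add0r. Qed.
Lemma H1_addN : left_inverse H1_zero H1_opp H1_add.
Proof. by elim/quotW=> f; rewrite (H1_opp_pi f) H1_add_pi addNr. Qed.

HB.instance Definition _ := GRing.isZmodule.Build H1
  H1_addA H1_addC H1_add0 H1_addN.

End Cohomology.

Section MappingTorus.
Variables (R : realType) (X : topologicalType) (T : continuousType X X).
Local Notation I := (unit_interval R).

Definition torus_step (a b : X * I) : Prop :=
  [/\ a.1 = T b.1, val a.2 = 0 & val b.2 = 1].

Definition torus_rel : rel (X * I) :=
  fun a b => `[< clos_refl_sym_trans _ torus_step a b >].

Lemma torus_equiv : equiv_class_of torus_rel.
Proof.
split=> [a|a b|b a c].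
- by apply/asboolP; apply: rst_refl.
- by apply/asboolP/asboolP; apply: rst_sym.
- by move=> /asboolP ab /asboolP bc; apply/asboolP; apply: rst_trans ab bc.
Qed.

Canonical torus_equivRel := EquivRelPack torus_equiv.
Canonical torus_encModRel := defaultEncModRel torus_rel.

Definition mapping_torus := quotient_topology {eq_quot torus_rel}.
HB.instance Definition _ := Topological.on mapping_torus.

Local Notation CZ := (continuousType X intd).

Definition delta (f : CZ) : CZ := f - (f \o T : CZ).

Definition coboundary : {pred CZ} := fun f => `[< exists h, f = delta h >].

Lemma coboundary_zmod_closed : zmod_closed coboundary.
Proof.
split=> [|f g /asboolP[h ->] /asboolP[k ->]]; apply/asboolP.
  by exists 0; apply/continuousEP => x; apply/esym/subrr.
exists (h - k); apply/continuousEP => x.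
rewrite -[LHS]/((h x - h (T x)) - (k x - k (T x))).
rewrite -[RHS]/((h x - k x) - (h (T x) - k (T x))).
by rewrite !opprB addrACA [RHS]addrACA [- k x - _]addrC.
Qed.
HB.instance Definition _ :=
  GRing.isZmodClosed.Build _ coboundary coboundary_zmod_closed.

Definition coinvariants := Quotient.quot coboundary.
HB.instance Definition _ := Quotient.on coinvariants.

Lemma torus_exp_subproof (f : CZ) :
  continuous (fun a : X * I => circle_exp (val a.2 * (f a.1 : int)%:~R)).
Proof.
have cz : continuous (fun m : intd => (m : int)%:~R : R).
  move=> m A /nbhs_singleton Am.
  have := @discrete_set1 (discrete_topology int) m.
  by apply: (@filterS intd (nbhs m)) => _ ->.
have cv : continuous (fun t : I => val t : R).
  exact: (@initial_continuous _ _ set_val).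
have c1 : continuous (@fst X I) by move=> a; apply: cvg_fst.
have c2 : continuous (@snd X I) by move=> a; apply: cvg_snd.
move=> a; have ct : (val b.2 : R) @[b --> a] --> (val a.2 : R).
  exact: (cvg_comp snd _ (c2 a) (cv a.2)).
have cf : f b.1 @[b --> a] --> f a.1.
  exact: (cvg_comp fst _ (c1 a) (@cts_fun _ _ f a.1)).
have cr : ((f b.1 : int)%:~R : R) @[b --> a] --> ((f a.1 : int)%:~R : R).
  exact: (cvg_comp (fun b => f b.1) _ cf (@cz (f a.1))).
have cm := cvgM ct cr.
exact: (cvg_comp _ (@circle_exp R) (cm _) (@circle_exp_continuous R _)).
Qed.

Definition cylinder_exp (f : CZ) : continuousType (X * I)%type (circle R) :=
  mkcts (@torus_exp_subproof f).

Lemma cylinder_exp_step (f : CZ) (a b : X * I) :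
  torus_rel a b -> cylinder_exp f a = cylinder_exp f b.
Proof.
move=> /asboolP; elim=> {a b} [a b [_ a0 b1]|//|a b _ -> //|a b c _ -> _ -> //].
rewrite /cylinder_exp /= /mkcts a0 b1 mul0r mul1r circle_exp0.
by rewrite circle_exp_int.
Qed.

Lemma torus_exp_continuous (f : CZ) :
  continuous (cylinder_exp f \o repr : mapping_torus -> circle R).
Proof.
apply: repr_comp_continuous; first exact: cts_fun.
move=> a b /eqP e; have /eqmodP : a = b %[mod {eq_quot torus_rel}] by exact: e.
by move=> /(cylinder_exp_step f) ->.
Qed.

(* See torus_exp_pi: (x, t) is sent to exp (2 pi i t f(x)). *)
Definition torus_exp (f : CZ) : continuousType mapping_torus (circle R) :=
  mkcts (@torus_exp_continuous f).

Lemma torus_exp_pi (f : CZ) (x : X) (t : I) :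
  torus_exp f (\pi_mapping_torus (x, t)) =
  circle_exp (val t * (f x : int)%:~R).
Proof.
rewrite -[RHS]/(cylinder_exp f (x, t)).
apply: (@cylinder_exp_step f (repr (\pi_mapping_torus (x, t)))).
have /eqmodP : repr (\pi_mapping_torus (x, t)) = (x, t)
  %[mod {eq_quot torus_rel}] by exact: (reprK (\pi_mapping_torus (x, t))).
exact.
Qed.

End MappingTorus.
Section Filtrations.
Variable V : zmodType.

Definition free_submodule (r : nat) (F : set V) : Prop :=
  exists b : 'I_r -> V,
    (forall x, F x <-> exists c : 'I_r -> int, x = \sum_i b i *~ c i) /\
    (forall c : 'I_r -> int, \sum_i b i *~ c i = 0 -> forall i, c i = 0).

Definition torsion_free_quotient (F' F : set V) : Prop :=
  forall (x : V) (m : int), F' x -> m != 0 -> F (x *~ m) -> F x.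

(* For subgroups F 0, F 1, ... with F n contained in F n.+1: the universal
   property of L, with the restrictions of j, as the direct limit. *)
Definition is_direct_limit (F : nat -> set V) (L : zmodType) (j : V -> L) :
    Prop :=
  forall (A : zmodType) (h : nat -> V -> A),
    (forall n x y, F n x -> F n y -> h n (x + y) = h n x + h n y) ->
    (forall n x, F n x -> h n.+1 x = h n x) ->
    exists u : {additive L -> A},
      (forall n x, F n x -> u (j x) = h n x) /\
      (forall u' : {additive L -> A},
         (forall n x, F n x -> u' (j x) = h n x) -> u' =1 u).

End Filtrations.

Section SchottkyWalks.
Variables (R : realType) (K : fieldType) (nu : K -> R) (Gam : set (PGL2 K)).

Definition schottky_edge : choiceType :=
  set_type (quotient_edge (BT_vertex nu) (BT_adj nu) (@BT_act K) Gam).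

Definition schottky_adm : rel schottky_edge :=
  @admissible _ (BT_vertex nu) (BT_adj nu) _ (@BT_act K) Gam.

Definition schottky_walks : topologicalType := walks schottky_adm.

Definition schottky_shift : continuousType schottky_walks schottky_walks :=
  walk_shift schottky_adm.

End SchottkyWalks.

(* Main.v *)
Require Import Defs.
From HB Require Import structures.
From mathcomp Require Import all_boot all_order all_algebra all_field.
From mathcomp Require Import generic_quotient finmap.
From mathcomp Require Import all_classical all_reals all_analysis.
From mathcomp Require Import zify ring lra.
From Stdlib Require Import Relation_Operators.

Set Implicit Arguments.
Unset Strict Implicit.
Unset Printing Implicit Defensive.

Import Order.TTheory GRing.Theory Num.Theory.
Import numFieldNormedType.Exports.
Local Open Scope classical_set_scope.
Local Open Scope ring_scope.
Local Open Scope quotient_scope.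

(** A Schottky group [Gam] acts on the Bruhat-Tits tree; the proof first extracts
    from this action what is needed on admissible words ([tree_action] and its
    consequences), then treats the walks on any finite alphabet with these
    properties.

    The tree.  The absolute value of a finite extension of the p-adic numbers is
    discrete ([abs_power_value], [uniformizer_exists]), so that homothety classes
    of lattices form a graph; it is connected because two lattices have a common
    basis up to multiples ([elementary_divisors]), and has no cycle because
    lattices decrease along a walk without backtracking ([between_sum],
    [BT_acyclic]).  A hyperbolic element translates the line given by its
    eigenvectors ([hyperbolic_axis]).  An invariant subtree contains the axes
    ([axis_subtree]); hence [Gam] acts freely ([fixed_trivial]), and the hull of
    the axes is covered by the translates of a finite connected set
    ([hull_edges_finite]).  The hull has no leaf ([hull_neighbour]), and is not a
    line as [Gam] is not commutative ([edge_exists]).  From a vertex that is not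
    bivalent exactly one arc leaves in each direction ([arc_exists],
    [arc_unique]), so the alphabet is finite ([edges_finite]), each letter has
    two successors and a predecessor ([edge_two_successors],
    [edge_predecessor]), and a function that takes the same value on successive
    letters is constant ([edge_connected]).

    The isomorphism.  On a compact space two homotopic maps to the circle differ
    by the exponential of a real function ([homotopy_exp], through a
    logarithm near 1 and the connectedness of the interval).  If all maps from a
    compact space [X] to the circle have logarithms, a map on the mapping torus
    has a logarithm [th] on the cylinder, and [th (x, 1) - th (T x, 0)] is the
    integer [f x] from which the map comes up to homotopy ([torus_exp_surj]); and
    the exponential of [t f x] is trivial exactly when [f] is a coboundary
    ([torus_exp_coboundary], [torus_exp_inj]).  The space of walks has this
    property, as a map to the circle varies little on the walks that agree on a
    large window ([uniform_window], [walks_exp_lift]).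

    The filtration.  Every continuous function depends on a finite window, and
    up to a coboundary on the letters 0, ..., n for some n; for n > 0 the n-th
    term is formed by the classes of the functions of these letters.  If the
    coboundary of [h] depends only on them, modulo some integer m or exactly, then
    [h] depends on the letters 0, ..., n - 1 ([depends_coboundary]).  Used
    modulo m, and replacing [h] by its remainder ([coboundary_reduce]), this shows
    that the coinvariants and the quotients of the filtration have no torsion
    ([coinvariants_torsion_free], [letters_class_pure]).  Used exactly, it
    presents the n-th term as the cokernel of the coboundary from functions of
    n letters to functions of n + 1 letters, whose kernel is formed by the
    constants ([invariant_constant], by connectedness); the Smith normal form and
    the absence of torsion make it free of the required rank ([free_cokernel],
    [letters_class_free]).  The term of index 0 is spanned by part of a basis of
    the next one ([filtration_exists]). *)

(** * Walks without backtracking in a tree *)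

Section NonBacktracking.
Variables (X : choiceType) (adj : rel X).

Fixpoint nonback (s : seq X) : bool :=
  if s is a :: s' then (ohead (behead s') != Some a) && nonback s' else true.

Lemma nonback_cons a s :
  nonback (a :: s) = (ohead (behead s) != Some a) && nonback s.
Proof. by []. Qed.

Definition acyclic : Prop := forall x s,
  path adj x s -> nonback (x :: s) -> s != [::] -> last x s != x.

Lemma nonback_catl s t : nonback (s ++ t) -> nonback s.
Proof.
elim: s => //= a s IH /andP[+ /IH ->]; rewrite andbT.
by case: s {IH} => [|b [|c s]].
Qed.

Lemma uniq_nonback s : uniq s -> nonback s.
Proof.
elim: s => //= a s IH /andP[aNs /IH ->]; rewrite andbT.
by case: s aNs {IH} => [|b [|c s]]//=; rewrite !inE !negb_or; apply: contraTneq => -[->]; rewrite eqxx andbF.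
Qed.

Lemma nonback_join s a x b t : nonback (rcons (rcons s a) x) ->
  nonback (x :: b :: t) -> a != b -> nonback (rcons (rcons s a) x ++ b :: t).
Proof.
move=> + nbt aNb; elim: s => [|c s IH]; first by move=> _; rewrite nonback_cons nbt andbT; apply: contra aNb => /eqP[->].
rewrite !rcons_cons nonback_cons => /andP[h /IH nbs].
rewrite cat_cons nonback_cons nbs andbT; move: h.
by case: s {IH nbs} => [|d [|e s]].
Qed.

Hypothesis adj_sym : symmetric adj.
Hypothesis adj_acyclic : acyclic.

Lemma nonback_simple x s : path adj x s -> nonback (x :: s) -> uniq (x :: s).
Proof.
elim: s x => [//|y s IH] x pxs nb.
have -> : uniq (x :: y :: s) = (x \notin y :: s) && uniq (y :: s) by [].
apply/andP; split; last first.
  by move: pxs nb; rewrite nonback_cons => /andP[_ ps] /andP[_]; exact: IH.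
apply/negP => xs; case/path.splitP: xs pxs nb => p1 p2.
rewrite cat_path => /andP[pp1 _]; rewrite -cat_cons => /nonback_catl nb.
by have /negP := adj_acyclic pp1 nb ltac:(by rewrite -size_eq0 size_rcons); rewrite last_rcons.
Qed.

Lemma simple_path_unique x p q :
  path adj x p -> uniq (x :: p) -> path adj x q -> uniq (x :: q) ->
  last x p = last x q -> p = q.
Proof.
elim: p x q => [|a p IH] x [|b q] // pp up pq uq /=.
- by move=> e; have := adj_acyclic pq (uniq_nonback uq) isT; rewrite [last _ _]/= ?e -?e eqxx.
- by move=> e; have := adj_acyclic pp (uniq_nonback up) isT; rewrite [last _ _]/= ?e -?e eqxx.
move=> e; have [ab|ab] := eqVneq a b.
  subst b; congr cons; apply: (IH a) => //.
  + by case/andP: pp.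
  + by case/andP: up.
  + by case/andP: pq.
  + by case/andP: uq.
pose y := last x (a :: p); pose r := rev (belast x (a :: p)) ++ b :: q.
have yr : y :: r = rcons (rcons (rev p) a) x ++ b :: q.
  by rewrite /r -cat_cons -rev_rcons -lastI !rev_cons.
have lx : last y (rev (belast x (a :: p))) = x by rewrite [belast _ _]/= rev_cons last_rcons.
have pr : path adj y r.
  rewrite cat_path lx pq andbT rev_path.
  by rewrite (eq_path (e' := adj)) // => u w /=; exact: adj_sym.
have nb : nonback (y :: r).
  rewrite yr; apply: nonback_join => //; last exact: uniq_nonback uq.
  by apply: uniq_nonback; rewrite -!rev_cons rev_uniq.
have := adj_acyclic pr nb; rewrite /r last_cat lx [last x _]/= -e /y eqxx.
by case: (rev _) => [|? ?] /(_ isT).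
Qed.

(** A walk can only shrink to the simple path between its ends, so it passes
    through all the vertices of that path. *)
Lemma walk_through x p q : path adj x p -> uniq (x :: p) ->
  path adj x q -> last x q = last x p -> {subset x :: p <= x :: q}.
Proof.
move=> pp up pq; case/shortenP: (pq) => q' pq' uq' sq e z.
rewrite (simple_path_unique pp up pq' uq' (esym e)) !inE => /orP[->//|/sq ->].
by rewrite orbT.
Qed.

End NonBacktracking.

Section Line.
Variables (X : choiceType) (adj : rel X).
Hypothesis adj_sym : symmetric adj.
Hypothesis adj_acyclic : acyclic adj.
Variable v : int -> X.
Hypothesis v_adj : forall k, adj (v k) (v (k + 1)).
Hypothesis v_nonback : forall k, v (k + 2) <> v k.

Fixpoint segment (a : int) (n : nat) : seq X :=
  if n is n'.+1 then v (a + 1) :: segment (a + 1) n' else [::].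

Lemma segment_path a n : path adj (v a) (segment a n).
Proof. by elim: n a => //= n IH a; rewrite v_adj IH. Qed.

Lemma segment_last a n : last (v a) (segment a n) = v (a + n%:Z).
Proof. by elim: n a => [|n IH] a /=; rewrite ?addr0// IH; congr v; lia. Qed.

Lemma segment_nonback a n : nonback (v a :: segment a n).
Proof.
elim: n a => // n IH a; rewrite [segment _ _]/=.
rewrite nonback_cons IH andbT; case: n {IH} => //= n; apply/eqP => -[].
by rewrite -addrA; exact: v_nonback.
Qed.

Lemma segment_simple a n : uniq (v a :: segment a n).
Proof.
by apply: (nonback_simple adj_acyclic); [exact: segment_path|exact: segment_nonback].
Qed.

Lemma mem_segment a n j : (j <= n)%N -> v (a + j%:Z) \in v a :: segment a n.
Proof.
elim: n a j => [|n IH] a [|j]//=; rewrite ?addr0 ?mem_head// => jn.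
rewrite inE; apply/orP; right.
by have -> : a + j.+1%:Z = a + 1 + j%:Z by [lia]; exact: IH.
Qed.

Lemma line_inj : injective v.
Proof.
have wlg a n : v (a + n.+1%:Z) <> v a.
  move=> /eqP; rewrite -segment_last; apply/negP.
  by apply: adj_acyclic => //; [exact: segment_path|exact: segment_nonback].
move=> a b e; case: (ltgtP a b) => // ab; exfalso.
- by apply: (wlg a (absz (b - a)).-1); rewrite e; congr v; lia.
- by apply: (wlg b (absz (a - b)).-1); rewrite -e; congr v; lia.
Qed.

Lemma walk_through_line a n j p : (j <= n)%N -> path adj (v a) p ->
  last (v a) p = v (a + n%:Z) -> v (a + j%:Z) \in v a :: p.
Proof.
move=> jn pp e; apply: (walk_through adj_sym adj_acyclic (segment_path a n)) => //.
- exact: segment_simple.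
- by rewrite segment_last.
- exact: mem_segment.
Qed.

Lemma line_bounded (s : seq X) :
  exists B : nat, forall k, v k \in s -> (`|k| <= B)%N.
Proof.
elim: s => [|x s [B hB]]; first by exists 0%N.
have [[k e]|nk] := pselect (exists k, v k = x).
  exists (maxn B `|k|) => j; rewrite inE -e => /orP[/eqP/line_inj ->|/hB jB].
    exact: leq_maxr.
  exact: leq_trans jB (leq_maxl _ _).
exists B => k; rewrite inE => /orP[/eqP e|/hB //].
by case: nk; exists k.
Qed.

End Line.

(** * Groups acting on a tree *)

(** All that the combinatorics of the quotient uses of the action of a Schottky
    group on its tree.  [tree_fin_gen] is induction on the length of words in
    finitely many generators. *)
Record tree_action (X : choiceType) (V : set X) (adj : rel X)
    (G : groupType) (act : G -> X -> X) (Gam : set G) : Prop := TreeAction {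
  tree_sym : symmetric adj;
  tree_vertex : forall x y, adj x y -> V x;
  tree_connected : forall x y, V x -> V y ->
    exists2 s, path adj x s & last x s = y;
  tree_acyclic : acyclic adj;
  tree_act_vertex : forall a x, V x -> V (act a x);
  tree_act_adj : forall a x y, adj x y -> adj (act a x) (act a y);
  tree_act1 : forall x, V x -> act 1%g x = x;
  tree_actM : forall a b x, V x -> act (a * b)%g x = act a (act b x);
  tree_group : subgroup Gam;
  tree_axis : forall a, Gam a -> a <> 1%g -> exists A, is_axis V adj (act a) A;
  tree_fin_gen : exists2 S : seq G, (forall a, a \in S -> Gam a) &
    forall P : G -> Prop, P 1%g ->
      (forall a b, a \in S -> Gam b -> P b -> P (a * b)%g /\ P (a^-1 * b)%g) ->
      forall a, Gam a -> P a;
  tree_noncommuting : exists a b, [/\ Gam a, Gam b & (a * b <> b * a)%g] }.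

Section TreeAction.
Variables (X : choiceType) (V : set X) (adj : rel X).
Variables (G : groupType) (act : G -> X -> X) (Gam : set G).
Hypothesis TA : tree_action V adj act Gam.

Let adj_sym := tree_sym TA.
Let adj_acyclic := tree_acyclic TA.
Let adjV := tree_vertex TA.
Let conn := tree_connected TA.
Let actV := tree_act_vertex TA.
Let act_adj := tree_act_adj TA.
Let act1 := tree_act1 TA.
Let actM := tree_actM TA.
Local Notation hull := (axes_hull V adj act Gam).

Lemma adjV2 x y : adj x y -> V y.
Proof. by rewrite adj_sym; exact: adjV. Qed.

Lemma Gam1 : Gam 1%g. Proof. by case: (tree_group TA). Qed.
Lemma GamV a : Gam a -> Gam (a^-1)%g.
Proof. by move=> Ga; rewrite -[(a^-1)%g]mul1g; case: (tree_group TA) => ? /(_ 1%g a); apply. Qed.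
Lemma GamM a b : Gam a -> Gam b -> Gam (a * b)%g.
Proof.
by move=> Ga Gb; rewrite -[b]invgK; case: (tree_group TA) => _; apply => //; exact: GamV.
Qed.

Lemma actK a x : V x -> act (a^-1)%g (act a x) = x.
Proof. by move=> Vx; rewrite -actM// mulVg act1. Qed.
Lemma actVK a x : V x -> act a (act (a^-1)%g x) = x.
Proof. by move=> Vx; rewrite -actM// mulgV act1. Qed.
Lemma act_inj a x y : V x -> V y -> act a x = act a y -> x = y.
Proof. by move=> Vx Vy /(congr1 (act (a^-1)%g)); rewrite !actK. Qed.

Lemma path_act a x s : path adj x s -> path adj (act a x) (map (act a) s).
Proof. by elim: s x => //= y s IH x /andP[/(act_adj a)-> /IH]. Qed.

Lemma path_vertex x s : V x -> path adj x s -> [set` x :: s] `<=` V.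
Proof.
move=> Vx; elim: s x Vx => [|y s IH] x Vx /=.
  by move=> _ z /=; rewrite inE => /eqP->.
move=> /andP[xy /(IH _ (adjV2 xy))] sV z /=; rewrite inE => /orP[/eqP->//|zs].
exact: sV.
Qed.

Lemma connected_simple x y : V x -> V y ->
  exists p, [/\ path adj x p, uniq (x :: p) & last x p = y].
Proof.
move=> Vx Vy; have [s ps <-] := conn Vx Vy.
by case/shortenP: ps => p pp up _; exists p.
Qed.

Lemma subtree_simple S x p : subtree V adj S -> path adj x p -> uniq (x :: p) ->
  S x -> S (last x p) -> [set` x :: p] `<=` S.
Proof.
move=> [SV Sc] pp up Sx Sl z /= zp.
have [q [pq lq qS]] := Sc _ _ Sx Sl.
have := walk_through adj_sym adj_acyclic pp up pq lq zp.
by rewrite inE => /orP[/eqP->//|/qS].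
Qed.

Lemma subtreeI (F : set (set X)) : F `<=` subtree V adj -> F !=set0 ->
  subtree V adj (\bigcap_(S in F) S).
Proof.
move=> Fs [S0 FS0]; split=> [x /(_ _ FS0)|x y hx hy].
  by case: (Fs _ FS0) => SV _ /SV.
have SV := (Fs _ FS0).1.
have [p [pp up lp]] := connected_simple (SV _ (hx _ FS0)) (SV _ (hy _ FS0)).
exists p; split=> // z zp S FS.
apply: (subtree_simple (Fs _ FS) pp up); rewrite ?lp; [exact: hx|exact: hy|].
by rewrite /= inE; apply/orP; right.
Qed.

(** ** Axes *)

Section Axis.
Variables (a : G) (v : int -> X) (l : int).
Hypotheses (l0 : l != 0) (vV : forall k, V (v k) /\ adj (v k) (v (k + 1))).
Hypotheses (v_nonback : forall k, v (k + 2) <> v k).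
Hypothesis v_act : forall k, act a (v k) = v (k + l).

Lemma axis_actX n k : act (a ^+ n)%g (v k) = v (k + l *+ n).
Proof.
elim: n k => [|n IH] k; first by rewrite expg0 mulr0n addr0 act1//; case: (vV k).
by rewrite expgSr actM ?v_act ?IH ?mulrS ?addrA//; case: (vV k).
Qed.

(** A walk from far behind [v k] to far ahead of it is obtained from a walk
    from [v k] to the subtree, moved by a large power of the translation and
    by its inverse; as it must pass through [v k], which is not on the moved
    pieces, [v k] belongs to the subtree. *)
Lemma axis_subtree S : subtree V adj S -> S !=set0 ->
  (forall x, S x -> S (act a x)) -> (forall x, S x -> S (act (a^-1)%g x)) ->
  range v `<=` S.
Proof.
move=> [SV Sc] [s0 Ss0] Sa SaV _ [k _ <-].
have v_adj j := (vV j).2; have vV1 j := (vV j).1.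
have [q pq lq] := conn (vV1 k) (SV _ Ss0).
pose w j := v (k + j).
have w_adj j : adj (w j) (w (j + 1)) by rewrite /w addrA.
have w_nb j : w (j + 2) <> w j by rewrite /w addrA.
have [B hB] := line_bounded adj_acyclic w_adj w_nb (v k :: q).
have SX n x : S x -> S (act (a ^+ n)%g x).
  move=> Sx; elim: n => [|n IH]; first by rewrite expg0 act1//; exact: SV.
  by rewrite expgS actM; [exact: Sa|exact: SV].
have SXV n x : S x -> S (act (a ^+ n)^-1%g x).
  move=> Sx; elim: n => [|n IH]; first by rewrite expg0 invg1 act1//; exact: SV.
  by rewrite expgSr invgM actM; [exact: SaV|exact: SV].
pose h := (if 0 < l then a ^+ B.+1 else (a ^+ B.+1)^-1)%g.
pose m := (`|l| * B.+1)%N.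
have Bm : (B < m)%N by rewrite /m leq_pmull // absz_gt0.
have lm : l *+ B.+1 = if 0 < l then m%:Z else - m%:Z.
  rewrite -mulr_natr natz /m PoszM abszE; case: ltrP => l1.
    by rewrite gtr0_norm.
  by rewrite ler0_norm// mulNr opprK.
have hw : act h (w 0) = w m%:Z.
  rewrite /h /w; case: ifPn => l1; first by rewrite axis_actX lm l1 addr0.
  apply: (@act_inj (a ^+ B.+1)%g) => //; first exact/actV.
  by rewrite actVK// axis_actX lm (negPf l1) addr0 addrK.
have hVw : act h^-1%g (w 0) = w (- m%:Z).
  rewrite /h /w; case: ifPn => l1; last by rewrite invgK axis_actX lm (negPf l1) addr0.
  apply: (@act_inj (a ^+ B.+1)%g) => //; first exact/actV.
  by rewrite actVK// axis_actX lm l1 addr0 addrNK.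
have Sh x : S x -> S (act h x) by rewrite /h; case: ifP => _; [exact: SX|exact: SXV].
have ShV x : S x -> S (act h^-1%g x).
  by rewrite /h; case: ifP => _; [exact: SXV|rewrite invgK; exact: SX].
have [r [pr lr rS]] := Sc _ _ (ShV _ Ss0) (Sh _ Ss0).
have w0 : w 0 = v k by rewrite /w addr0.
have pq' : path adj (last (v k) q) (rev (belast (v k) q)).
  by rewrite rev_path (eq_path (e' := adj)) // => u u' /=; exact: adj_sym.
have lq' : last (last (v k) q) (rev (belast (v k) q)) = v k.
  by case: (q) => //= y t; rewrite rev_cons last_rcons.
have qV := path_vertex (vV1 k) pq.
pose W := map (act h^-1%g) q ++ r ++ map (act h) (rev (belast (v k) q)).
have pW : path adj (w (- m%:Z)) W.
  rewrite -hVw w0 !cat_path path_act//= last_map lq pr lr -lq.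
  by rewrite path_act.
have lW : last (w (- m%:Z)) W = w (- m%:Z + (m + m)%N%:Z).
  rewrite -hVw w0 !last_cat last_map lq lr -[in LHS]lq last_map lq' -w0 hw.
  by congr w; lia.
have := walk_through_line adj_sym adj_acyclic w_adj w_nb (leq_addr m m) pW lW.
have wnq j : (B < `|j|)%N -> w j \notin v k :: q by apply: contraL => /hB; rewrite -leqNgt.
have hq x : x \in v k :: q -> v k <> act h^-1%g x.
  move=> xq /(congr1 (act h)); rewrite actVK; last exact: qV.
  by rewrite -w0 hw => e; by move: (wnq m%:Z Bm); rewrite e xq.
have hVq x : x \in v k :: q -> v k <> act h x.
  move=> xq /(congr1 (act h^-1%g)); rewrite actK; last exact: qV.
  rewrite -w0 hVw => e.
  by move: (wnq (- m%:Z)); rewrite e abszN xq => /(_ Bm).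
rewrite addNr w0 -hVw w0 /W -cat_cons -map_cons !mem_cat.
move=> /or3P[/mapP[x /hq//]| kr | /mapP[x]].
  by apply: rS.
by rewrite mem_rev => xq /hVq; case; exact: mem_belast.
Qed.

End Axis.

(** A fixed vertex would be an invariant subtree, and so contain an axis. *)
Lemma fixed_trivial a y : Gam a -> V y -> act a y = y -> a = 1%g.
Proof.
move=> Ga Vy ay; apply: contrapT => a1.
have [A [v [l [l0 vV nb va _]]]] := tree_axis TA Ga a1.
have ayV : act (a^-1)%g y = y by rewrite -[in LHS]ay actK.
have sub : range v `<=` [set y].
  apply: (axis_subtree l0 vV nb va); last by move=> x ->.
  - split=> [x ->//|x z -> ->]; by exists [::]; split=> // u.
  - by exists y.
  - by move=> x ->.
have vy j : v j = y by apply: sub; exists j.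
exact: nb 0 (etrans (vy _) (esym (vy _))).
Qed.

Lemma axis_conj a b A : is_axis V adj (act a) A ->
  is_axis V adj (act (b * a * b^-1)%g) (act b @` A).
Proof.
move=> [v [l [l0 vV nb va ->]]]; exists (act b \o v), l; split=> //=.
- by move=> k; have [? ?] := vV k; split; [exact: actV|exact: act_adj].
- by move=> k /act_inj h; apply: (nb k); apply: h; case: (vV k) => //; case: (vV (k + 2)).
- move=> k; have Vk : V (v k) by case: (vV k).
  by rewrite !actM ?actK ?va//; exact: actV.
- by rewrite image_comp.
Qed.

(** ** The hull of the axes *)

Let family := [set S | subtree V adj S /\
    forall g A, Gam g -> is_axis V adj (act g) A -> A `<=` S].

Lemma family_V : family V.
Proof.
split=> [|g A Gg [v [l [_ vV _ _ ->]]] _ [k _ <-]]; last by case: (vV k).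
split=> // x y Vx Vy; have [p [pp _ lp]] := connected_simple Vx Vy.
by exists p; split=> // z zp; apply: (path_vertex Vx pp); rewrite /= inE zp orbT.
Qed.

Lemma hull_subtree : subtree V adj hull.
Proof. by apply: subtreeI => [S [] //|]; exists V; exact: family_V. Qed.

Lemma hullV : hull `<=` V. Proof. by case: hull_subtree. Qed.

Lemma hull_axis a A : Gam a -> is_axis V adj (act a) A -> A `<=` hull.
Proof. by move=> Ga aA x Ax S [_ /(_ a A Ga aA)]; apply. Qed.

Lemma hull_sub S : subtree V adj S ->
  (forall a A, Gam a -> is_axis V adj (act a) A -> A `<=` S) -> hull `<=` S.
Proof. by move=> Ss SA x; apply. Qed.

Lemma hull_act a x : Gam a -> hull x -> hull (act a x).
Proof.
move=> Ga hx S [[SV Sc] SA].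
have : [set y | V y /\ S (act a y)] x.
  apply: hx; split; first split=> [y []//|y z [Vy Sy] [Vz Sz]].
    have [p [pp lp pS]] := Sc _ _ Sy Sz.
    exists (map (act (a^-1)%g) p); split.
    - by rewrite -[y](actK a)//; exact: path_act.
    - by rewrite -[y](actK a)// last_map lp actK.
    move=> u /= /mapP[w wp ->]; have Sw : S w by exact: pS.
    by split; [apply/actV/SV|rewrite actVK//; exact: SV].
  move=> b A Gb bA y Ay; split.
    by case: bA Ay => v [l [_ vV _ _ ->]] [k _ <-]; case: (vV k).
  have Gc : Gam (a * b * a^-1)%g by apply: GamM; [exact: GamM|exact: GamV].
  by apply: (SA _ _ Gc (axis_conj a bA)); exists y.
by case.
Qed.

(** In the hull no vertex is a leaf: a leaf lies on no axis, and the hull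
    would remain a subtree if it were removed. *)
Lemma hull_neighbour y x : hull y -> exists z, [/\ hull z, adj y z & z <> x].
Proof.
move=> hy; apply: contrapT => noz.
have leaf z : hull z -> adj y z -> z = x.
  by move=> hz yz; apply: contrapT => zx; apply: noz; exists z.
have : [set z | hull z /\ z <> y] y; last by case.
apply: (hull_sub _ _ hy); last first.
  move=> a A Ga aA z Az; split; first exact: (hull_axis Ga aA).
  move: aA (hull_axis Ga aA) => [v [l [_ vV nb _ Av]]] Ah zy.
  move: Az; rewrite Av zy => -[k _ vk].
  have hv j : hull (v j) by apply: Ah; rewrite Av; exists j.
  have e1 : v (k + 1) = x by apply: leaf => //; rewrite -vk; case: (vV k).
  have e2 : v (k - 1) = x.
    by apply: leaf => //; rewrite -vk adj_sym -{2}[k](subrK 1); case: (vV (k - 1)).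
  by apply: (nb (k - 1)); rewrite e2 -e1; congr v; lia.
split=> [z [/hullV]//|u w [hu uy] [hw wy]].
have [p [pp up lp]] := connected_simple (hullV hu) (hullV hw).
have ph : [set` u :: p] `<=` hull.
  by apply: (subtree_simple hull_subtree pp up) => //; rewrite lp.
exists p; split=> // z /= zp; split; first by apply: ph; rewrite /= inE zp orbT.
move=> zy; rewrite {z}zy in zp.
have yl : y != last u p by rewrite lp; apply/eqP => /esym.
case/splitPr: zp pp up lp yl ph => p1 [|w' p2].
  by rewrite last_cat /= eqxx.
move=> pp up _ _ ph; move: pp; rewrite cat_path /= => /and4P[_ l1 l2 _].
have h1 : hull (last u p1).
  by apply: ph; have := mem_last u p1; rewrite /= !inE mem_cat => /orP[->|->]; rewrite ?orbT.
have h2 : hull w' by apply: ph; rewrite /= !inE mem_cat !inE eqxx !orbT.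
have e1 := leaf _ h1 ltac:(by rewrite adj_sym).
have e2 := leaf _ h2 l2.
move: up; rewrite -cat_cons cat_uniq => /and3P[_ /hasPn/(_ w') + _].
by rewrite !inE eqxx orbT e2 -e1 => /(_ isT)/negP; case; exact: mem_last.
Qed.

(** The translates of a finite connected set [D0] that contains a vertex and its
    images by the generators cover a connected invariant set.  It contains all
    the axes by [axis_subtree], hence the hull; and by uniqueness of simple
    paths an edge of the tree between two of its vertices is a translate of an
    edge of [D0]. *)
Lemma hull_edges_finite : exists D : seq (X * X), forall y z,
  hull y -> hull z -> adj y z ->
  exists2 a, Gam a & exists2 d, d \in D &
    [/\ V d.1, V d.2, y = act a d.1 & z = act a d.2].
Proof.
have [[x0 hx0]|nh] := pselect (hull !=set0); last first.
  by exists [::] => y z hy; case: nh; exists y.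
have V0 := hullV hx0; have [gs gsG ind] := tree_fin_gen TA.
(* D0 is the union of paths from x0 to its images under the generators. *)
have [D0 [D0V D0x D0c D0g]] : exists D0 : seq X, [/\ [set` D0] `<=` V, x0 \in D0,
    forall d, d \in D0 -> exists p, [/\ path adj x0 p, {subset x0 :: p <= D0} & last x0 p = d] &
    forall a, a \in gs -> act a x0 \in D0].
  have : {subset gs <= gs} by [].
  elim: {-2}gs => [|a l IH] sl.
    exists [:: x0]; split; rewrite ?mem_head//.
      by move=> u /=; rewrite inE => /eqP->.
    by move=> d; rewrite inE => /eqP->; exists [::]; split.
  have [|D0 [DV Dx Dc Dg]] := IH; first by move=> b bl; apply: sl; rewrite inE bl orbT.
  have [p pp lp] := conn V0 (actV a V0).
  exists (D0 ++ p); split.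
  - move=> u /=; rewrite mem_cat => /orP[/DV//|up].
    by apply: (path_vertex V0 pp); rewrite /= inE up orbT.
  - by rewrite mem_cat Dx.
  - move=> d; rewrite mem_cat => /orP[/Dc[q [pq qD lq]]|dp].
      by exists q; split=> // u /qD; rewrite mem_cat => ->.
    case/path.splitP: dp pp {lp} => p1 p2; rewrite cat_path => /andP[pp _].
    exists (rcons p1 d); split; rewrite ?last_rcons// => u.
    rewrite inE mem_cat => /orP[/eqP->|up]; first by rewrite Dx.
    by rewrite mem_cat up orbT.
  - move=> b; rewrite inE mem_cat => /orP[/eqP->|/Dg->//].
    by have := mem_last x0 p; rewrite lp inE => /orP[/eqP->|->]; rewrite ?Dx ?orbT.
pose e : rel X := fun y z => `[< adj y z /\ exists2 a, Gam a &
  exists d d', [/\ d \in D0, d' \in D0, y = act a d & z = act a d'] >].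
have e_adj : subrel e adj by move=> y z /asboolP[].
have e_sym : symmetric e.
  suff h y z : e y z -> e z y by move=> y z; apply/idP/idP; exact: h.
  move=> /asboolP[yz [a Ga [d [d' [? ? ? ?]]]]]; apply/asboolP.
  by rewrite adj_sym; split=> //; exists a => //; exists d', d.
have e_act a y z : Gam a -> e y z -> e (act a y) (act a z).
  move=> Ga /asboolP[yz [b Gb [d [d' [dD dD' ydb zdb]]]]]; apply/asboolP.
  split; first exact: act_adj.
  exists (a * b)%g; first exact: GamM.
  by exists d, d'; split; rewrite ?ydb ?zdb ?actM//; exact: D0V.
(* Invariance of the set of vertices c-related to x0 follows by induction on
   the group element, as c is an equivalence relation kept by the action. *)
pose c y z := exists2 p, path e y p & last y p = z.
have c_refl y : c y y by exists [::].
have c_trans y z t : c y z -> c z t -> c y t.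
  move=> [p pp lp] [q pq lq]; exists (p ++ q); first by rewrite cat_path pp lp.
  by rewrite last_cat lp.
have c_sym y z : c y z -> c z y.
  move=> [p pp <-]; exists (rev (belast y p)).
    by rewrite rev_path (eq_path (e' := e)) // => u u' /=; exact: e_sym.
  by case: (p) => //= w t; rewrite rev_cons last_rcons.
have c_act a y z : Gam a -> c y z -> c (act a y) (act a z).
  move=> Ga [p pp <-]; exists (map (act a) p); last by rewrite last_map.
  by elim: p y pp => //= w p IH y /andP[/(e_act _ _ _ Ga)-> /IH].
have cD d : d \in D0 -> c x0 d.
  move=> /D0c[p [pp pD lp]]; exists p => //.
  have {lp} : {subset x0 :: p <= D0} by [].
  elim: p (x0) pp {pD} => //= w p IH y /andP[yw pp] pD.
  apply/andP; split; last by apply: IH => // u up; apply: pD; rewrite inE up orbT.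
  apply/asboolP; split=> //; exists 1%g; first exact: Gam1.
  have yD : y \in D0 by apply: pD; rewrite mem_head.
  have wD : w \in D0 by apply: pD; rewrite !inE eqxx orbT.
  by exists y, w; rewrite !act1//; exact: D0V.
have cG a : Gam a -> c x0 (act a x0).
  apply: (ind (fun a => c x0 (act a x0))); first by rewrite act1.
  move=> {}a b ags Gb cb; have Ga := gsG _ ags; rewrite !actM//; split.
    by apply: (c_trans _ (act a x0)); [exact/cD/D0g|exact: c_act].
  apply: (c_trans _ (act (a^-1)%g x0)); last by apply: c_act => //; exact: GamV.
  apply: c_sym; rewrite -[x in c _ x](actK a)//; apply: c_act; first exact: GamV.
  exact/cD/D0g.
pose S := [set y | c x0 y].
have cV y : c x0 y -> V y.
  move=> [p pp <-]; apply: (path_vertex V0 (sub_path e_adj pp)).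
  by rewrite /= mem_last.
have S_act a y : Gam a -> S y -> S (act a y).
  by move=> Ga Sy; apply: c_trans (cG a Ga) _; exact: c_act.
have Ssub : subtree V adj S.
  split=> [y /cV//|y z Sy Sz].
  have [p pp lp] : c y z by apply: c_trans Sz; exact: c_sym.
  exists p; split=> //; first exact: sub_path pp.
  move=> u /= up; apply: c_trans (Sy) _.
  case/path.splitP: up pp => p1 p2; rewrite cat_path => /andP[pp _].
  by exists (rcons p1 u); rewrite ?last_rcons.
have hullS : hull `<=` S.
  apply: hull_sub => // a A Ga [v [l [l0 vV nb va ->]]].
  apply: (axis_subtree l0 vV nb va) => //; first by exists x0; exact: c_refl.
  - by move=> x; exact: S_act.
  - by move=> x; apply: S_act; exact: GamV.
exists [seq (d, d') | d <- D0, d' <- D0] => y z hy hz yz.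
have [p pp lp] : c y z by apply: c_trans (hullS _ hz); exact/c_sym/hullS.
case/shortenP: pp lp => q pq uq _ lq.
have yz1 : y != z by apply/eqP => yz1; have := adj_acyclic (x := y) (s := [:: z]); rewrite /= yz yz1 eqxx => /(_ isT isT isT).
have : q = [:: z].
  apply: (simple_path_unique adj_sym adj_acyclic (x := y)) => //=.
  - exact: sub_path pq.
  - by rewrite yz.
  - by rewrite inE yz1.
move=> qz; move: pq; rewrite qz /= andbT => /asboolP[_ [a Ga [d [d' [dD dD' -> ->]]]]].
exists a => //; exists (d, d'); first by apply/allpairsP; exists (d, d').
by split=> //; exact: D0V.
Qed.

End TreeAction.

(** * The quotient graph *)

Section Arcs.
Variables (X : choiceType) (V : set X) (adj : rel X).
Variables (G : groupType) (act : G -> X -> X) (Gam : set G).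
Hypothesis TA : tree_action V adj act Gam.

Let adj_sym := tree_sym TA.
Let actV := tree_act_vertex TA.
Let act_adj := tree_act_adj TA.
Local Notation hull := (axes_hull V adj act Gam).
Local Notation bival := (bivalent V adj act Gam).
Local Notation arc := (is_arc V adj act Gam).
Let hV := hullV TA.

Let nbr x := [set y | hull y /\ adj x y].

Lemma bivalent_third x a b c : bival x -> nbr x a -> nbr x b -> nbr x c ->
  a <> b -> a <> c -> b = c.
Proof.
move=> x2 xa xb xc /eqP ab /eqP ac; apply/eqP; apply: contraT => bc.
have fN : finite_set (nbr x) by exists 2%N.
have : ([fset a; b; c] `<=` fset_set (nbr x))%fset.
  apply/fsubsetP => z; rewrite !inE in_fset_set// inE => h.
  by case/orP: h => [/orP[]|] /eqP->.
move=> /fsubset_leq_card; rewrite (card_fset_set x2).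
by rewrite fsetUC cardfsU1 !inE negb_or eq_sym ac eq_sym bc cardfs2 ab.
Qed.

(** By [hull_neighbour] a vertex of the hull has at least two neighbours in it,
    hence at least three if it is not bivalent. *)
Lemma bivalentPn x a b : hull x -> ~ bival x ->
  exists c, [/\ nbr x c, c <> a & c <> b].
Proof.
move=> hx nb; apply: contrapT => h.
have sub c : nbr x c -> c = a \/ c = b.
  move=> xc; have [->|ca] := pselect (c = a); first by left.
  by right; apply: contrapT => cb; apply: h; exists c.
have [u [hu xu ua]] := hull_neighbour TA a hx.
have [w [hw xw wb]] := hull_neighbour TA b hx.
have ub : u = b by case: (sub u).
have wa : w = a by case: (sub w).
apply: nb; rewrite /bivalent.
have -> : [set y | hull y /\ adj x y] = [set a; b].
  apply/seteqP; split=> y /=; first exact: sub.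
  by case=> ->; [rewrite -wa|rewrite -ub].
have ab : a != b by apply/eqP => ab; apply: ua; rewrite ub.
have -> : [set a; b] = [set` [fset a; b]%fset] by rewrite set_fsetU !set_fset1.
by apply/card_eq_fsetP; rewrite cardfs2 ab.
Qed.

Lemma bivalent_act a x : Gam a -> V x -> bival x -> bival (act a x).
Proof.
move=> Ga Vx; rewrite /bivalent; suff -> : [set y | hull y /\ adj (act a x) y] =
  act a @` [set y | hull y /\ adj x y].
  move=> h; apply: card_eq_trans h; apply: inj_card_eq => y z.
  by rewrite !inE => -[/hV ? _] [/hV ? _]; exact: (act_inj TA).
apply/seteqP; split=> [y [hy xy]|_ [y [hy xy] <-]]; last first.
  by split; [exact: hull_act|exact: act_adj].
exists (act (a^-1)%g y); last by apply: (actVK TA); exact: hV.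
split; first by apply: (hull_act TA) => //; exact: (GamV TA).
by rewrite -[x](actK TA a)//; exact: act_adj.
Qed.

Lemma bivalent_actE a x : Gam a -> V x -> bival (act a x) -> bival x.
Proof.
move=> Ga Vx /(bivalent_act (GamV TA Ga) (actV a Vx)).
by rewrite (actK TA).
Qed.

(** Past its first edge an arc has no choice, as its inner vertices are
    bivalent. *)
Lemma arc_unique x m y m' y' :
  path adj x (rcons m y) -> uniq (x :: rcons m y) ->
  path adj x (rcons m' y') -> uniq (x :: rcons m' y') ->
  [set` x :: rcons m y] `<=` hull -> [set` x :: rcons m' y'] `<=` hull ->
  (forall z, z \in m -> bival z) -> (forall z, z \in m' -> bival z) ->
  ~ bival y -> ~ bival y' ->
  ohead (rcons m y) = ohead (rcons m' y') -> rcons m y = rcons m' y'.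
Proof.
move=> + + + + + + + + ny ny'.
elim: m m' x => [|b m IH] [|b' m'] x.
- by move=> _ _ _ _ _ _ _ _ /= [->].
- move=> _ _ _ _ _ _ _ bm' /= [e]; case: ny; rewrite e; apply: bm'.
  exact: mem_head.
- move=> _ _ _ _ _ _ bm _ /= [e]; case: ny'; rewrite -e; apply: bm.
  exact: mem_head.
rewrite !rcons_cons.
move=> /= /andP[xb p] u /andP[xb' p'] u' h h' bm bm' [e]; subst b'.
congr cons; case/andP: u => xN u; case/andP: u' => xN' u'.
have hull_b z : z \in b :: rcons m y -> hull z.
  by move=> zm; apply: h; apply/orP; right.
have hull_b' z : z \in b :: rcons m' y' -> hull z.
  by move=> zm; apply: h'; apply/orP; right.
apply: (IH m' b) => //.
- by move=> z zm; apply: bm; rewrite inE zm orbT.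
- by move=> z zm; apply: bm'; rewrite inE zm orbT.
have hx : hull x by apply: h; rewrite /= inE eqxx.
have bb : bival b by apply: bm; exact: mem_head.
have first t w : path adj b (rcons t w) -> x \notin b :: rcons t w ->
    (forall z, z \in b :: rcons t w -> hull z) ->
    exists c, [/\ ohead (rcons t w) = Some c, nbr b c & x <> c].
  case: t => [|c t] /= /andP[bc _] xNt ht.
    exists w; split=> //; first by split=> //; apply: ht; rewrite !inE eqxx orbT.
    by move=> xw; move: xNt; rewrite xw !inE eqxx orbT.
  exists c; split=> //; first by split=> //; apply: ht; rewrite !inE eqxx orbT.
  by move=> xw; move: xNt; rewrite xw !inE eqxx orbT.
have [c [-> nc xc]] := first _ _ p xN hull_b.
have [c' [-> nc' xc']] := first _ _ p' xN' hull_b'.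
congr Some; apply: (bivalent_third bb (a := x)) => //.
by split=> //; rewrite adj_sym.
Qed.

Lemma arc_rev s : arc s -> arc (rev s).
Proof.
move=> [x [m [y [-> [p u] h [nx ny] bm]]]].
have er : rev (x :: rcons m y) = y :: rcons (rev m) x.
  by rewrite rev_cons rev_rcons.
exists y, (rev m), x; rewrite -er; split=> //.
- split; last by rewrite rev_uniq.
  have := rev_path adj x (rcons m y); rewrite last_rcons => e.
  rewrite -rev_cons -[x :: m](belast_rcons x m y) e.
  by rewrite (eq_path (e' := adj)) // => u' w /=; exact: adj_sym.
- by move=> z /=; rewrite mem_rev => zs; apply: h.
- by move=> z; rewrite mem_rev; exact: bm.
Qed.

Lemma arc_act a s : Gam a -> arc s -> arc (map (act a) s).
Proof.
move=> Ga [x [m [y [-> [p u] h [nx ny] bm]]]].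
have Vs z : z \in x :: rcons m y -> V z by move=> zs; apply/hV; apply: h.
have em : map (act a) (x :: rcons m y) = act a x :: rcons (map (act a) m) (act a y).
  by rewrite map_cons map_rcons.
exists (act a x), (map (act a) m), (act a y); split=> //.
- split; first by rewrite -map_rcons; exact: (path_act TA).
  by rewrite map_inj_in_uniq // => z w /Vs Vz /Vs Vw; exact: (act_inj TA).
- move=> z0 /mapP[z zs e]; rewrite e.
  by apply: (hull_act TA) => //; apply: h.
- split=> /bivalent_actE => [/(_ Ga)|/(_ Ga)].
    by move=> h'; apply: nx; apply: h'; apply: Vs; rewrite mem_head.
  by move=> h'; apply: ny; apply: h'; apply: Vs; rewrite inE mem_rcons mem_head orbT.
- move=> _ /mapP[z zm ->]; apply: bivalent_act => //; last exact: bm.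
  by apply: Vs; rewrite inE mem_rcons inE zm !orbT.
Qed.

End Arcs.

Section Quotient.
Variables (X : choiceType) (V : set X) (adj : rel X).
Variables (G : groupType) (act : G -> X -> X) (Gam : set G).
Hypothesis TA : tree_action V adj act Gam.

Let adj_sym := tree_sym TA.
Let adj_acyclic := tree_acyclic TA.
Let actV := tree_act_vertex TA.
Let act_adj := tree_act_adj TA.
Let act1 := tree_act1 TA.
Let actM := tree_actM TA.
Local Notation hull := (axes_hull V adj act Gam).
Local Notation bival := (bivalent V adj act Gam).
Local Notation arc := (is_arc V adj act Gam).
Local Notation orbit := (arc_orbit act Gam).
Local Notation edge := (set_type (quotient_edge V adj act Gam)).
Local Notation adm := (@admissible X V adj G act Gam).
Let hV := hullV TA.

(** Follow the hull from a first edge as long as the vertices are bivalent.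
    Were it to go on for ever, two of its edges would be exchanged by an
    element of the group, as there are finitely many edges modulo the group;
    being forced backwards as well as forwards, this element would map the
    start, which is not bivalent, to a bivalent vertex. *)
Lemma arc_exists y z : hull y -> ~ bival y -> hull z -> adj y z ->
  exists m w, arc (y :: rcons m w) /\ ohead (rcons m w) = Some z.
Proof.
move=> hy ny hz yz.
have next (e : X * X) : exists u, hull e.2 -> [/\ hull u, adj e.2 u & u <> e.1].
  have [he|nh] := pselect (hull e.2); last by exists y.
  by have [u hu] := hull_neighbour TA e.1 he; exists u.
have [nx nxP] := choice next.
pose st k := iter k (fun e => (e.2, nx e)) (y, z).
pose r k := (st k).1.
have r2 k : (st k).2 = r k.+1 by [].
have st_h k : [/\ hull (r k), hull (r k.+1) & adj (r k) (r k.+1)].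
  elim: k => [|k [h1 h2 a]]; first by [].
  by have [] := nxP (st k) h2; rewrite r2 /r /=.
have rh k : hull (r k) by case: (st_h k).
have radj k : adj (r k) (r k.+1) by case: (st_h k).
have rnb k : r k.+2 <> r k by case: (nxP (st k) (rh k.+1)).
pose tr i n := mkseq (fun j => r (i + j.+1)%N) n.
have trS i n : tr i n.+1 = r i.+1 :: tr i.+1 n.
  rewrite /tr /mkseq /= addn1; congr cons; rewrite -[1%N]addn0 iotaDl -map_comp.
  by apply: eq_map => j /=; congr r; lia.
have tr_path n i : path adj (r i) (tr i n).
  by elim: n i => // n IH i; rewrite trS /= radj IH.
have tr_nb n i : nonback (r i :: tr i n).
  elim: n i => // n IH i; rewrite trS nonback_cons IH andbT.
  case: n {IH} => // n; rewrite trS /=; apply/eqP => -[]; exact: rnb.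
have [[k nk]|allb] := pselect (exists k, ~ bival (r k.+1)).
  have ex : exists k, ~~ `[< bival (r k.+1) >] by exists k; apply/asboolPn.
  case: (ex_minnP ex) => {nk} {}k /asboolPn nk min.
  exists (tr 0 k), (r k.+1).
  have e : rcons (tr 0 k) (r k.+1) = tr 0 k.+1 by rewrite /tr /mkseq -addn1 iotaD map_cat /= cats1 add0n addn1.
  split; last by rewrite e trS.
  exists y, (tr 0 k), (r k.+1); rewrite e; split=> //.
  - split; first exact: (tr_path k.+1 0%N).
    exact: (nonback_simple adj_acyclic (tr_path k.+1 0%N) (tr_nb k.+1 0%N)).
  - move=> u; rewrite /= inE => /orP[/eqP->//|/mapP[j _ ->]]; exact: rh.
  - move=> u /mapP[j]; rewrite mem_iota add0n => /andP[_ jk] ->.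
    apply: contrapT => nb; have /min : ~~ `[< bival (r j.+1) >] by apply/asboolPn.
    by rewrite leqNgt jk.
have rb k : bival (r k.+1) by apply: contrapT => nb; apply: allb; exists k.
have [D hD] := hull_edges_finite TA.
have cl k : exists i, (i < size D)%N /\ exists2 a, Gam a &
    [/\ V (nth (y, z) D i).1, V (nth (y, z) D i).2,
        r k = act a (nth (y, z) D i).1 & r k.+1 = act a (nth (y, z) D i).2].
  have [a Ga [d dD e]] := hD _ _ (rh k) (rh k.+1) (radj k).
  by exists (index d D); rewrite index_mem dD nth_index//; split=> //; exists a.
have [f fP] := choice cl.
have [i [j [ij fij]]] : exists i j, (i < j)%N /\ f i = f j.
  apply: contrapT => no.
  suff : (size D < size D)%N by rewrite ltnn.
  apply: (@pigeonhole (size D).+1 (size D) f).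
    move=> i j _ _ fij; apply/eqP; case: (ltngtP i j) => // ij; exfalso; apply: no.
      by exists i, j.
    by exists j, i.
  by move=> _ [i _ <-]; have [] := fP i.
have [[_ [a Ga [V1 V2 e1 e2]]] [_ [b Gb [_ _ e1' e2']]]] := (fP i, fP j).
rewrite -fij in e1' e2'.
(* g maps the i-th edge of the ray to the j-th one. *)
pose g := (b * a^-1)%g; have Gg : Gam g by apply: (GamM TA) => //; exact: (GamV TA).
have gE u : V u -> act g (act a u) = act b u.
  by move=> Vu; rewrite /g actM ?(actK TA)//; exact: actV.
have back t : (t <= i)%N ->
    act g (r (i - t)%N) = r (j - t)%N /\ act g (r (i - t).+1) = r (j - t).+1.
  elim: t => [|t IH] ti; first by rewrite !subn0 e1 e2 !gE.
  have [IH1 IH2] := IH (ltnW ti).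
  have ei : (i - t)%N = (i - t.+1).+1 by lia.
  have ej : (j - t)%N = (j - t.+1).+1 by lia.
  rewrite -ei -ej; split=> //; move: IH1 IH2; rewrite ei ej => IH1 IH2.
  apply: (bivalent_third (x := r (j - t.+1).+1) (a := r (j - t.+1).+2)); first exact: rb.
  - split=> //; exact: rh.
  - split; first exact: (hull_act TA).
    by rewrite -IH1 adj_sym; apply: act_adj.
  - by split=> //; rewrite adj_sym.
  - by rewrite -IH2 => /(act_inj TA) e; apply: (@rnb (i - t.+1)%N); apply: e; apply: hV.
  - exact: rnb.
have [+ _] := back i (leqnn i).
rewrite subnn -[(j - i)%N]prednK ?subn_gt0// => gr0.
exfalso; apply: ny; apply: (bivalent_actE TA Gg (hV hy)); rewrite [act g y]gr0; exact: rb.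
Qed.

Lemma arc_hull s x : arc s -> x \in s -> hull x.
Proof. by move=> [? [? [? [_ _ h _ _]]]] xs; exact: h. Qed.

Lemma map_act1 s : arc s -> map (act 1%g) s = s.
Proof.
move=> As; rewrite -[RHS]map_id; apply/eq_in_map => x xs.
by rewrite act1//; apply: hV; exact: (arc_hull As).
Qed.

Lemma mem_orbit s : arc s -> orbit s s.
Proof. by move=> As; exists 1%g; [exact: (Gam1 TA)|exact: map_act1]. Qed.

Lemma orbit_act a s : arc s -> Gam a -> orbit (map (act a) s) = orbit s.
Proof.
move=> As Ga; have Vs x : x \in s -> V x by move=> xs; apply: hV; exact: (arc_hull As).
apply/seteqP; split=> _ [b Gb <-].
  exists (b * a)%g; first exact: (GamM TA).
  by rewrite -map_comp; apply/eq_in_map => x /Vs Vx /=; rewrite actM.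
exists (b * a^-1)%g; first by apply: (GamM TA) => //; exact: (GamV TA).
rewrite -map_comp; apply/eq_in_map => x /Vs Vx /=.
by rewrite actM ?(actK TA)//; exact: actV.
Qed.

Lemma reverse_orbit s : reverse (orbit s) = orbit (rev s).
Proof.
apply/seteqP; split=> [u [t [a Ga <-] <-]|u [a Ga <-]].
  by exists a => //; rewrite map_rev.
by exists (map (act a) s); [exists a|rewrite map_rev].
Qed.

Lemma source_orbit x s : source (orbit (x :: s)) = [set act a x | a in Gam].
Proof.
apply/seteqP; split=> [y [_ [a Ga <-] [<-]]|_ [a Ga <-]]; first by exists a.
by exists (map (act a) (x :: s)) => //; exists a.
Qed.

Lemma target_orbit s y : target (orbit (rcons s y)) = [set act a y | a in Gam].
Proof. by rewrite /target reverse_orbit rev_rcons source_orbit. Qed.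

Lemma edge_arc (w : edge) : exists2 s, arc s & val w = orbit s.
Proof. by have /set_mem [s As <-] := valP w; exists s. Qed.

Lemma arc_edge s : arc s -> exists w : edge, val w = orbit s.
Proof.
move=> As; have sE : orbit s \in quotient_edge V adj act Gam by apply/mem_set; exists s.
by exists (exist _ (orbit s) sE).
Qed.

(** Elements of the group that fix a vertex are trivial, so that the edges
    leaving the class of a vertex correspond to the arcs leaving it. *)
Lemma orbit_same_source x s s' : arc (x :: s) -> arc (x :: s') ->
  orbit (x :: s) = orbit (x :: s') -> s = s'.
Proof.
move=> As As' e; have := mem_orbit As; rewrite e => -[a Ga /=[ax <-]].
have a1 : a = 1%g.
  by apply: (fixed_trivial TA Ga _ ax); exact: hV (arc_hull As (mem_head _ _)).
by have := map_act1 As'; rewrite a1 => -[_ ->].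
Qed.

Lemma admissible_arcs (w w' : edge) s y s' : arc (rcons s y) -> arc (y :: s') ->
  val w = orbit (rcons s y) -> val w' = orbit (y :: s') -> s' <> rev s ->
  adm w w'.
Proof.
move=> As As' ew ew' ss'; apply/asboolP.
rewrite ew ew' target_orbit source_orbit; split=> //.
rewrite reverse_orbit rev_rcons => e; apply: ss'.
apply: (@orbit_same_source y) => //.
by rewrite -rev_rcons; exact: (arc_rev TA).
Qed.

Lemma third_arc y s s' : arc (y :: s) -> arc (y :: s') ->
  exists s'', [/\ arc (y :: s''), s'' <> s & s'' <> s'].
Proof.
move=> As As'; have hy := arc_hull As (mem_head y s).
have ny : ~ bival y.
  by move: As => [x [m [z [/= [-> _] _ _ [nx _] _]]]].
have hd t : arc (y :: t) -> exists u, ohead t = Some u.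
  by move=> [x [[|b m] [z [/= [_ ->] _ _ _ _]]]]; [exists z|exists b].
have [[u eu] [u' eu']] := (hd _ As, hd _ As').
have [c [[hc yc] cu cu']] := bivalentPn TA u u' hy ny.
have [m [z [At et]]] := arc_exists hy ny hc yc.
by exists (rcons m z); split=> // e; [apply: cu|apply: cu'];
  move: et; rewrite e ?eu ?eu' => -[].
Qed.

Lemma arc_last s : arc s -> exists t y, s = rcons t y.
Proof. by move=> [x [m [y [-> _ _ _ _]]]]; exists (x :: m), y; rewrite rcons_cons. Qed.

(** * The alphabet *)

(** At least three arcs leave the end of an arc, one of which goes back. *)
Lemma edge_two_successors (w : edge) :
  exists w1 w2, [/\ adm w w1, adm w w2 & w1 <> w2].
Proof.
have [s As ew] := edge_arc w; have [t [y est]] := arc_last As.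
have At : arc (y :: rev t) by rewrite -rev_rcons -est; exact: (arc_rev TA).
rewrite est in As ew.
have [s1 [A1 n1 _]] := third_arc At At.
have [s2 [A2 n2 n21]] := third_arc At A1.
have [[w1 e1] [w2 e2]] := (arc_edge A1, arc_edge A2).
exists w1, w2; split; [exact: (admissible_arcs As A1)|exact: (admissible_arcs As A2)|].
by move=> e; apply: n21; apply: (orbit_same_source A2 A1); rewrite -e1 -e2 e.
Qed.

Lemma edge_reverse (w : edge) : exists w' : edge, val w' = reverse (val w).
Proof.
have [s As ->] := edge_arc w; rewrite reverse_orbit.
exact: arc_edge (arc_rev TA As).
Qed.

Lemma reverseK : involutive (@reverse X).
Proof.
move=> w; apply/seteqP; split=> [_ [_ [s ws <-] <-]|s ws]; first by rewrite revK.
by exists (rev s); [exists s|exact: revK].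
Qed.

Lemma edge_predecessor (w : edge) : exists w', adm w' w.
Proof.
have [v ev] := edge_reverse w.
have [v1 [_ [/asboolP[nv tv] _ _]]] := edge_two_successors v.
have [w' ew'] := edge_reverse v1.
exists w'; apply/asboolP; rewrite ew' /target reverseK -tv /target ev reverseK.
by split=> // e; apply: nv; rewrite ev reverseK e.
Qed.

(** By [arc_unique] an edge is determined by the first step of an arc that
    represents it, for which there are finitely many possibilities modulo the
    group. *)
Lemma edges_finite : finite_set [set: edge].
Proof.
have [D hD] := hull_edges_finite TA.
have cl (w : edge) : exists d, d \in D /\ exists s x y,
    [/\ arc (x :: y :: s), val w = orbit (x :: y :: s) &
        exists2 a, Gam a & [/\ x = act a d.1, y = act a d.2, V d.1 & V d.2]].
  have [s As ew] := edge_arc w.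
  have [x [y [t est]]] : exists x y t, s = x :: y :: t.
    case: As => x [[|b m] [y [-> _ _ _ _]]]; first by exists x, y, [::].
    by exists x, b, (rcons m y).
  have [hx hy] : hull x /\ hull y.
    by split; apply: (arc_hull As); rewrite est !inE eqxx ?orbT.
  have xy : adj x y.
    by case: As => x' [m [y' [+ [+ _] _ _ _]]]; rewrite est => -[-> <-] /= /andP[].
  have [a Ga [d dD [V1 V2 e1 e2]]] := hD _ _ hx hy xy.
  by exists d; split=> //; exists t, x, y; rewrite -est; split=> //; exists a.
have [f fP] := choice cl.
have finj : injective f.
  move=> w w' e; have [_ [s [x [y [As ew [a Ga [ex ey V1 V2]]]]]]] := fP w.
  have [_ [s' [x' [y' [As' ew' [b Gb [ex' ey' _ _]]]]]]] := fP w'.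
  rewrite -e in ex' ey'.
  pose g := (a * b^-1)%g; have Gg : Gam g by apply: (GamM TA) => //; exact: (GamV TA).
  have gE u : V u -> act g (act b u) = act a u.
    by move=> Vu; rewrite /g actM ?(actK TA)//; exact: actV.
  apply/val_inj; rewrite ew ew' -(orbit_act As' Gg) /=.
  have := arc_act TA Gg As'; rewrite /= ex' ey' !gE// -ex -ey => As1.
  congr orbit; move: As As1.
  move=> [x1 [m1 [z1 [[<- e1] [p1 u1] h1 [_ nz1] b1]]]].
  move=> [x2 [m2 [z2 [[<- e2] [p2 u2] h2 [_ nz2] b2]]]].
  rewrite e1 e2 in u1 u2 h1 h2 *; congr cons.
  apply: (arc_unique TA p1 u1 p2 u2) => //.
  by rewrite -e1 -e2.
have -> : [set: edge] = f @^-1` [set` D].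
  by apply/seteqP; split=> // w _; case: (fP w).
by apply: finite_preimage (finite_seq D) => w w' _ _; exact: finj.
Qed.

(** * Connectedness *)

(** The colour is constant around each vertex: an edge entering it and an edge
    leaving it that is not the reversed one have the same colour, and for the
    reversed one a third edge serves as intermediate.  A path of the hull
    between two vertices that are not bivalent is cut by such vertices into
    arcs. *)
Lemma edge_connected (C : Type) (c : edge -> C) :
  (forall w w', adm w w' -> c w = c w') -> forall w w', c w = c w'.
Proof.
move=> cadm w0 w1.
have ex s : exists w : edge, arc s -> val w = orbit s.
  have [As|nAs] := pselect (arc s); last by exists w0.
  by have [w ew] := arc_edge As; exists w.
have [e eP] := choice ex.
pose col s := c (e s).
have through s y s' : arc (rcons s y) -> arc (y :: s') -> s' <> rev s ->
    col (rcons s y) = col (y :: s').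
  by move=> As As' ss'; apply/cadm/(admissible_arcs As As'); rewrite ?eP.
have out y s s' : arc (y :: s) -> arc (y :: s') -> col (y :: s) = col (y :: s').
  move=> As As'; have [t [At ts ts']] := third_arc As As'.
  have At' : arc (rcons (rev t) y) by rewrite -rev_cons; exact: (arc_rev TA).
  have n1 : s <> rev (rev t) by rewrite revK => /esym.
  have n2 : s' <> rev (rev t) by rewrite revK => /esym.
  by rewrite -(through _ _ _ At' As n1) (through _ _ _ At' As' n2).
have into s y s' : arc (rcons s y) -> arc (y :: s') -> col (rcons s y) = col (y :: s').
  move=> As As'.
  have Ar : arc (y :: rev s) by rewrite -rev_rcons; exact: (arc_rev TA).
  by have [t [At ts _]] := third_arc Ar Ar; rewrite (through _ _ _ As At ts); exact: out.
have walk n p x : (size p <= n)%N -> path adj x p -> uniq (x :: p) ->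
    [set` x :: p] `<=` hull -> ~ bival x -> ~ bival (last x p) ->
    forall s s', arc (x :: s) -> arc (last x p :: s') -> col (x :: s) = col (last x p :: s').
  elim: n p x => [|n IH] p x; first by case: p => // _ _ _ _ _ _ s s'; exact: out.
  move=> pn pp up ph nx nl s s' As As'.
  have [p0|pN] := eqVneq p [::]; first by rewrite p0 in As' *; exact: out.
  pose q := [pred z | ~~ `[< bival z >]].
  have hq : has q p.
    by apply/hasP; exists (last x p); [case: (p) pN => //= *; exact: mem_last|exact/asboolPn].
  move: pn pp up ph nl s' As'; case: (split_find hq) => z p1 p2 /asboolPn nz nq1.
  rewrite size_cat size_rcons addSn ltnS => pn.
  rewrite cat_path last_rcons last_cat last_rcons => /andP[pp1 pp2].
  rewrite -cat_cons cat_uniq => /and3P[u1 /hasPn u12 u2] ph nl s' As'.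
  have A1 : arc (x :: rcons p1 z).
    exists x, p1, z; split=> //.
      move=> y yp; apply: ph; rewrite /= in yp *.
      by rewrite -cat_cons mem_cat yp.
    by move=> y yp; apply: contrapT => ny; case/hasP: nq1; exists y => //; exact/asboolPn.
  have Ar : arc (z :: rev (x :: p1)) by rewrite -rev_rcons rcons_cons; exact: (arc_rev TA).
  rewrite (out _ _ _ As A1) -rcons_cons (into _ _ _ _ Ar)//.
  apply: (IH p2) => //; first exact: leq_trans (leq_addl _ _) pn.
    rewrite cons_uniq u2 andbT; apply/negP => /u12; case/negP.
    by rewrite inE mem_rcons mem_head orbT.
  move=> y yp; apply: ph; move: yp; rewrite /= -cat_cons mem_cat inE => /orP[/eqP->|->].
    by rewrite inE mem_rcons mem_head !orbT.
  by rewrite orbT.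
have start (w : edge) : exists x s, [/\ arc (x :: s), w = e (x :: s), hull x & ~ bival x].
  have [s As ew] := edge_arc w; have := As => -[x [m [y [es _ h [nx _] _]]]].
  rewrite es in As ew h; exists x, (rcons m y); split=> //.
    by apply: val_inj; rewrite eP.
  by apply: h; exact: mem_head.
have [x [s [As -> hx nx]]] := start w0.
have [x' [s' [As' -> hx' nx']]] := start w1.
have [p [pp up lp]] := connected_simple TA (hV hx) (hV hx').
rewrite -lp in As' nx' *; apply: (walk _ _ _ (leqnn _)) => //.
by apply: (subtree_simple TA (hull_subtree TA) pp up) => //; rewrite lp.
Qed.

(** Otherwise the hull would be an axis, on which two elements of the group
    commute, or one of them acts as a reflection and has order 2. *)
Lemma edge_exists : inhabited edge.
Proof.
apply: contrapT => noedge.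
have bh x : hull x -> bival x.
  move=> hx; apply: contrapT => nx; apply: noedge.
  have [z [hz xz _]] := hull_neighbour TA x hx.
  have [m [y [As _]]] := arc_exists hx nx hz xz.
  by have [w _] := arc_edge As; exists.
have line_det (u w : int -> X) :
    (forall k, hull (u k) /\ adj (u k) (u (k + 1))) -> (forall k, u (k + 2) <> u k) ->
    (forall k, hull (w k) /\ adj (w k) (w (k + 1))) -> (forall k, w (k + 2) <> w k) ->
    u 0 = w 0 -> u 1 = w 1 -> forall k, u k = w k.
  move=> uh unb wh wnb e0 e1.
  have e12 (k : int) : k + 2 = k + 1 + 1 by rewrite -addrA.
  have fwd k : u k = w k -> u (k + 1) = w (k + 1) -> u (k + 2) = w (k + 2).
    move=> ek ek1; apply: (bivalent_third (bh _ (uh (k + 1)).1) (a := u k)).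
    - by split; [exact: (uh k).1|rewrite adj_sym; exact: (uh k).2].
    - by split; [exact: (uh _).1|rewrite e12; exact: (uh _).2].
    - by split; [exact: (wh _).1|rewrite e12 ek1; exact: (wh _).2].
    - by move/esym; exact: unb.
    - by rewrite ek => /esym; exact: wnb.
  have bwd k : u (k + 1) = w (k + 1) -> u (k + 2) = w (k + 2) -> u k = w k.
    move=> ek1 ek2; apply: (bivalent_third (bh _ (uh (k + 1)).1) (a := u (k + 2))).
    - by split; [exact: (uh _).1|rewrite e12; exact: (uh _).2].
    - by split; [exact: (uh k).1|rewrite adj_sym; exact: (uh k).2].
    - by split; [exact: (wh k).1|rewrite adj_sym ek1; exact: (wh k).2].
    - exact: unb.
    - by rewrite ek2; exact: wnb.
  have pos (n : nat) : u n%:Z = w n%:Z /\ u (n%:Z + 1) = w (n%:Z + 1).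
    elim: n => [|n [IH1 IH2]]; first by rewrite add0r.
    have -> : n.+1%:Z = n%:Z + 1 by rewrite -addn1.
    by split=> //; rewrite -addrA; exact: fwd.
  have neg (n : nat) : u (- n%:Z) = w (- n%:Z) /\ u (- n%:Z + 1) = w (- n%:Z + 1).
    elim: n => [|n [IH1 IH2]]; first by rewrite oppr0 add0r.
    have e : - n%:Z = - n.+1%:Z + 1 by lia.
    have e' : - n%:Z + 1 = - n.+1%:Z + 2 by lia.
    rewrite -e; split=> //; apply: bwd; first by rewrite -e.
    by rewrite -e'.
  by case=> n; [exact: (pos n).1|rewrite NegzE; exact: (neg n.+1).1].
have [a [b [Ga Gb ab]]] := tree_noncommuting TA.
have a1 : a <> 1%g by move=> a1; apply: ab; rewrite a1 mul1g mulg1.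
have b1 : b <> 1%g by move=> b1; apply: ab; rewrite b1 mul1g mulg1.
have [A aA] := tree_axis TA Ga a1; have Ah := hull_axis Ga aA.
move: aA Ah => [v [l [l0 vV vnb va ->]]] Ah.
have vh k : hull (v k) by apply: Ah; exists k.
have v_nbr k y : hull y -> adj (v k) y -> y = v (k + 1) \/ y = v (k - 1).
  move=> hy ky; have [->|yk] := pselect (y = v (k + 1)); first by left.
  right; apply: (bivalent_third (bh _ (vh k)) (a := v (k + 1))) => //.
  - by split=> //; case: (vV k).
  - by split=> //; rewrite adj_sym -{2}[k](subrK 1); case: (vV (k - 1)).
  - by move/esym.
  - by move=> e; apply: (vnb (k - 1)); rewrite -e; congr v; lia.
have hull_range y : hull y -> exists k, y = v k.
  move=> hy; have [_ hc] := hull_subtree TA; have [p [pp lp ph]] := hc _ _ (vh 0) hy.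
  move: pp ph; rewrite -lp; elim: p (0 : int) {lp} => [|z p IH] k /=; first by exists k.
  move=> /andP[kz pp] ph.
  have hz : hull z by apply: ph; exact: mem_head.
  by case: (v_nbr k z hz kz) => ez; subst z; apply: (IH _ pp) => u up;
    apply: ph; rewrite /= inE up orbT.
have v_inj := line_inj adj_acyclic (fun k => (vV k).2) vnb.
have bvh k : hull (act b (v k)) by exact: (hull_act TA).
have vV1 k : V (v k) by case: (vV k).
have [c bv0] := hull_range _ (bvh 0).
have b_line k : hull (act b (v k)) /\ adj (act b (v k)) (act b (v (k + 1))).
  by split=> //; apply: act_adj; case: (vV k).
have b_nb k : act b (v (k + 2)) <> act b (v k).
  by move=> /(act_inj TA (hV (vh _)) (hV (vh _))); exact: vnb.
have hv1 : adj (v c) (act b (v 1)) by rewrite -bv0; case: (b_line 0); rewrite add0r.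
case: (v_nbr _ _ (bvh 1) hv1) => bv1.
(* b translates the line, as a does, and so commutes with a. *)
- have bv : forall k, act b (v k) = v (c + k).
    apply: line_det => //; rewrite ?addr0//.
    + by move=> k; split=> //; rewrite addrA; case: (vV (c + k)).
    + by move=> k; rewrite addrA; exact: vnb.
  apply: ab; pose g := ((b * a)^-1 * (a * b))%g.
  have Gg : Gam g.
    by apply: (GamM TA); [apply: (GamV TA)|]; exact: (GamM TA).
  have g1 : g = 1%g.
    apply: (fixed_trivial TA Gg (hV (vh 0))).
    have -> : act g (v 0) = act (b * a)^-1%g (act (a * b)%g (v 0)).
      exact: actM (vV1 0).
    have -> : act (a * b)%g (v 0) = act (b * a)%g (v 0).
      by rewrite !actM ?va ?bv ?va//; congr v; lia.
    by rewrite (actK TA)//; exact: hV.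
  by rewrite -[LHS]mul1g -(mulgV (b * a)%g) -mulgA -/g g1 mulg1.
(* b reflects the line, so that b * b is trivial although b has an axis. *)
- have bv : forall k, act b (v k) = v (c - k).
    apply: line_det => //; rewrite ?subr0//.
    + move=> k; split=> //; rewrite adj_sym.
      have e : c - k = c - (k + 1) + 1 by lia.
      by rewrite e; case: (vV (c - (k + 1))).
    + move=> k; have e : c - k = c - (k + 2) + 2 by lia.
      by rewrite e => /esym; exact: vnb.
  have bb : (b * b)%g = 1%g.
    apply: (fixed_trivial TA (GamM TA Gb Gb) (hV (vh 0))).
    by rewrite actM ?bv//; congr v; lia.
  have [B [u [m [m0 uV unb ub _]]]] := tree_axis TA Gb b1.
  have u_inj := line_inj adj_acyclic (fun k => (uV k).2) unb.
  have : act (b * b)%g (u 0) = u (0 + m + m) by rewrite actM ?ub//; case: (uV 0).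
  rewrite bb act1; last by case: (uV 0).
  by move=> /u_inj e; move: m0; apply/negP/negPn/eqP; lia.
Qed.

End Quotient.

(** * Discreteness of the valuation *)

Section Absolute.
Variables (R : realType) (F : fieldType) (nu : F -> R).
Hypothesis hnu : nonarch_abs nu.

Let nuM := nonarchM hnu.

Lemma abs_ge0 x : 0 <= nu x. Proof. exact: nonarch_ge0. Qed.
Lemma abs0 : nu 0 = 0. Proof. exact/(nonarch_eq0 hnu). Qed.
Lemma abs_eq0 x : (nu x == 0) = (x == 0).
Proof. by apply/eqP/eqP => /(nonarch_eq0 hnu). Qed.
Lemma abs_gt0 x : (0 < nu x) = (x != 0).
Proof. by rewrite lt0r abs_ge0 andbT abs_eq0. Qed.
Lemma abs1 : nu 1 = 1.
Proof.
have n1 : nu 1 != 0 by rewrite abs_eq0 oner_eq0.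
by apply: (mulfI n1); rewrite -nuM !mulr1.
Qed.
Lemma absX x n : nu (x ^+ n) = nu x ^+ n.
Proof. by elim: n => [|n IH]; rewrite ?expr0 ?abs1// !exprS nuM IH. Qed.
Lemma absN x : nu (- x) = nu x.
Proof.
suff n1 : nu (-1) = 1 by rewrite -mulN1r nuM n1 mul1r.
have /eqP : nu (-1) ^+ 2 = 1 by rewrite -absX sqrrN expr1n abs1.
rewrite sqrf_eq1 => /orP[/eqP//|/eqP n1].
by have := abs_ge0 (-1); rewrite n1 oppr_ge0 ler10.
Qed.
Lemma absV x : nu x^-1 = (nu x)^-1.
Proof.
have [->|x0] := eqVneq x 0; first by rewrite invr0 abs0 invr0.
have n0 : nu x != 0 by rewrite abs_eq0.
by apply: (mulfI n0); rewrite -nuM !mulfV// abs1.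
Qed.
Lemma absZ x (k : int) : nu (x ^ k) = nu x ^ k.
Proof. by case: k => n; rewrite /exprz ?absV absX. Qed.
Lemma absD_le x y e : nu x <= e -> nu y <= e -> nu (x + y) <= e.
Proof. by move=> xe ye; apply: le_trans (nonarchD hnu x y) _; rewrite ge_max xe. Qed.
Lemma absB_le x y e : nu x <= e -> nu y <= e -> nu (x - y) <= e.
Proof. by move=> xe ye; apply: absD_le; rewrite ?absN. Qed.
Lemma absD_lt x y e : nu x < e -> nu y < e -> nu (x + y) < e.
Proof. by move=> xe ye; apply: le_lt_trans (nonarchD hnu x y) _; rewrite gt_max xe. Qed.
Lemma absB_near x y : nu (x - y) < nu x -> nu y = nu x.
Proof.
move=> h; apply/eqP; rewrite eq_le.
have -> : nu y <= nu x.
  by rewrite -[y](subKr x); apply: absB_le => //; exact: ltW.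
rewrite leNgt; apply/negP => yx.
by have := absD_lt h yx; rewrite subrK ltxx.
Qed.
Lemma absM_le1 x y : nu x <= 1 -> nu y <= 1 -> nu (x * y) <= 1.
Proof. by move=> x1 y1; rewrite nuM mulr_ile1 ?abs_ge0. Qed.
Lemma absM_le x y e : nu x <= 1 -> nu y <= e -> nu (x * y) <= e.
Proof.
by move=> x1 ye; rewrite nuM (le_trans _ ye)// ler_piMl ?abs_ge0.
Qed.

Lemma abs_sum_lt (I : Type) (r : seq I) (P : pred I) (f : I -> F) e : 0 < e ->
  (forall i, P i -> nu (f i) < e) -> nu (\sum_(i <- r | P i) f i) < e.
Proof.
by move=> e0 fe; apply: (big_ind (fun x => nu x < e)) => //;
  [rewrite abs0|move=> x y; exact: absD_lt].
Qed.

(** If the largest absolute value were attained once, this term would be the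
    opposite of a sum of smaller ones. *)
Lemma abs_sum0 n (f : 'I_n -> F) i : \sum_j f j = 0 -> f i != 0 ->
  exists j k, [/\ j != k, f j != 0 & nu (f j) = nu (f k)].
Proof.
move=> s0 fi.
case: (@arg_maxP _ _ _ i xpredT (nu \o f) isT) => j _ /= jmax.
have fj : 0 < nu (f j) by apply: lt_le_trans (jmax i isT); rewrite abs_gt0.
have [k /andP[kj e]|no] := pickP (fun k => (k != j) && (nu (f k) == nu (f j))).
  by exists j, k; rewrite eq_sym kj -abs_gt0 fj (eqP e).
move: s0; rewrite (bigD1 j)//= => /eqP; rewrite addr_eq0 => /eqP e.
suff : nu (f j) < nu (f j) by rewrite ltxx.
rewrite {1}e absN; apply: abs_sum_lt => // k kj.
by rewrite lt_neqAle jmax// andbT; have := no k; rewrite kj /= => ->.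
Qed.

End Absolute.

Section Discreteness.
Variables (R : realType) (p : nat) (Qp : fieldType) (nuQ : Qp -> R).
Variables (K : fieldExtType Qp) (nu : K -> R).
Hypotheses (p_prime : prime p) (hQp : is_Qp p nuQ) (hnu : nonarch_abs nu).
Hypothesis nu_ext : forall a : Qp, nu a%:A = nuQ a.

Let hQ := Qp_nonarch hQp.
Let P : R := p%:R.
Let P_gt1 : 1 < P. Proof. by rewrite /P ltr1n prime_gt1. Qed.
Let P_gt0 : 0 < P. Proof. exact: lt_trans P_gt1. Qed.
Let P_neq0 : P != 0. Proof. by rewrite gt_eqF. Qed.

(** The rationals are dense, and the absolute value is locally constant away
    from 0. *)
Lemma Qp_abs_value x : x != 0 -> exists k : int, nuQ x = P ^ k.
Proof.
move=> x0; have [q xq] := Qp_dense hQp x (ltac:(by rewrite (abs_gt0 hQ)) : 0 < nuQ x).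
have {xq} e := absB_near hQ xq; rewrite -e in x0 *.
have hint (z : int) : z != 0 -> exists k : int, nuQ z%:~R = P ^ k.
  have hnat n : (0 < n)%N -> exists k : int, nuQ n%:R = P ^ k.
    move=> n0; exists (- (logn p n)%:Z); rewrite (Qp_padic hQp)//.
    by rewrite -exprnN.
  case: z => n z0; first by apply: hnat; rewrite lt0n.
  by rewrite NegzE mulrNz (absN hQ); exact: hnat.
have rq : ratr q != 0 :> Qp by rewrite -(abs_gt0 hQ) e abs_gt0.
have q0 : q != 0 by apply: contraNneq rq => ->; rewrite /ratr (_ : numq 0 = 0)// mul0r.
have [k1 e1] := hint (numq q) ltac:(by rewrite numq_eq0).
have [k2 e2] := hint (denq q) ltac:(exact: denq_neq0).
exists (k1 - k2); rewrite /ratr (nonarchM hQ) (absV hQ) e1 e2.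
by rewrite expfzDr// -invr_expz.
Qed.

(** By a vanishing combination of powers of [x] with coefficients in the base
    field, some power of [x] has the absolute value of a quotient of two
    coefficients. *)
Lemma abs_power_value : exists2 M : nat, (0 < M)%N &
  forall x : K, x != 0 -> exists k : int, nu x ^+ M = P ^ k.
Proof.
exists (\dim {:K})`!; first exact: fact_gt0.
move=> x x0; pose m := minPoly 1%AS x.
have mc i : exists a : Qp, m`_i = a%:A.
  have /polyOverP/(_ i) := minPolyOver 1%AS x.
  by move=> /vlineP[a ->]; exists a.
have m0 : \sum_(i < size m) m`_i * x ^+ i = 0.
  by rewrite -horner_coef; apply/eqP; exact: root_minPoly.
have sm : (size m <= (\dim {:K}).+1)%N.
  rewrite size_minPoly ltnS; have := dim_Fadjoin 1%AS x.
  by rewrite dimv1 muln1 => <-; apply: dimvS; exact: subvf.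
have sm0 : (0 < size m)%N by rewrite size_minPoly.
have lm : m`_(size m).-1 * x ^+ (size m).-1 != 0.
  have /monicP := monic_minPoly 1%AS x; rewrite /lead_coef -/m => ->.
  by rewrite mul1r expf_neq0.
have ltl : ((size m).-1 < size m)%N by rewrite prednK.
have [i0 [j0 [ij fi fij]]] := abs_sum0 hnu m0 (i := Ordinal ltl) lm.
have hval (i : 'I_(size m)) : m`_i * x ^+ i != 0 ->
    exists k : int, nu (m`_i) = P ^ k.
  rewrite mulf_eq0 negb_or => /andP[+ _]; have [a ->] := mc i.
  by move=> a0; rewrite nu_ext; apply: Qp_abs_value; apply: contraNneq a0 => ->; rewrite scale0r.
have fj : m`_j0 * x ^+ j0 != 0 by rewrite -(abs_gt0 hnu) -fij (abs_gt0 hnu).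
have main (i j : 'I_(size m)) : (i < j)%N -> m`_i * x ^+ i != 0 ->
    m`_j * x ^+ j != 0 -> nu (m`_i * x ^+ i) = nu (m`_j * x ^+ j) ->
    exists k : int, nu x ^+ (\dim {:K})`! = P ^ k.
  move=> lij hi hj; have [[ki ei] [kj ej]] := (hval _ hi, hval _ hj).
  have nx0 : nu x != 0 by rewrite abs_eq0.
  rewrite !(nonarchM hnu)// !(absX hnu)// ei ej -(subnKC (ltnW lij)) exprD mulrCA [LHS]mulrC.
  move=> /(mulfI (expf_neq0 _ nx0)) e.
  have {}e : nu x ^+ (j - i) = P ^ (ki - kj).
    by rewrite expfzDr// -invr_expz e mulrAC mulfV ?mul1r// expfz_neq0.
  have /dvdnP[q ->] : (j - i %| (\dim {:K})`!)%N.
    apply: dvdn_fact; rewrite subn_gt0 lij /=.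
    by apply: leq_trans (leq_subr _ _) _; rewrite -ltnS; exact: leq_trans (ltn_ord j) sm.
  by exists ((ki - kj) * q%:Z); rewrite mulnC exprM e -exprz_exp.
move: ij; rewrite neq_ltn => /orP[ij|ji].
  exact: (main i0 j0).
by apply: (main j0 i0).
Qed.

(** A uniformizer is an element for which the exponent given by
    [abs_power_value] is the smallest positive one. *)
Lemma uniformizer_exists : exists a : K, uniformizer nu a.
Proof.
have [M M0 hM] := abs_power_value.
pose q k := `[< exists2 x : K, x != 0 & (0 < k)%N /\ nu x ^+ M = P ^- k >].
have p0 : (p%:R : K) != 0 /\ nu p%:R = P^-1.
  have pp : nu p%:R = P^-1.
    have -> : p%:R = (p%:R : Qp)%:A :> K by rewrite scaler_nat.
    by rewrite nu_ext (Qp_padic hQp) ?prime_gt0// -[p in logn _ p]expn1 pfactorK// expr1.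
  by split=> //; rewrite -(abs_gt0 hnu) pp invr_gt0.
have exq : exists k, q k.
  exists M; apply/asboolP; exists p%:R; first by case: p0.
  by rewrite p0.2 exprVn.
case: (ex_minnP exq) => k /asboolP[a a0 [k0 ak]] kmin; exists a; split=> //.
  have : nu a ^+ M < 1 by rewrite ak invf_lt1 ?exprn_gt0// exprn_egt1// -?lt0n.
  by rewrite -[X in _ < X](expr1n _ M) ltr_pXn2r// nnegrE// abs_ge0.
move=> x x1; have [->|x0] := eqVneq x 0; first by rewrite abs0// abs_ge0.
rewrite -(ler_pXn2r M0) ?nnegrE ?abs_ge0//.
have [[n|n] e] := hM x x0.
  have : nu x ^+ M < 1 by rewrite -[X in _ < X](expr1n _ M) ltr_pXn2r// nnegrE// abs_ge0.
  by rewrite e ltNge exprn_ege1// ltW.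
have : q n.+1 by apply/asboolP; exists x.
move=> /kmin kn; rewrite e ak /exprz lef_pV2 ?posrE ?exprn_gt0//.
by rewrite ler_eXn2l.
Qed.

End Discreteness.

Section ValueGroup.
Variables (R : realType) (K : fieldType) (nu : K -> R) (pi : K).
Hypotheses (hnu : nonarch_abs nu) (hpi : uniformizer nu pi).

Lemma uniformizer_neq0 : pi != 0. Proof. by case: hpi. Qed.
Lemma abs_uniformizer_lt1 : nu pi < 1. Proof. by case: hpi. Qed.
Lemma abs_lt1 x : nu x < 1 -> nu x <= nu pi. Proof. by case: hpi => _ _; apply. Qed.

(** Divided by the largest power of [pi] that is not larger, an element gets the
    absolute value 1, as there are no absolute values between that of [pi]
    and 1. *)
Lemma abs_value x : x != 0 -> exists k : int, nu x = nu pi ^ k.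
Proof.
have pi0 := uniformizer_neq0; have npi0 : 0 < nu pi by rewrite abs_gt0.
have small y : y != 0 -> nu y <= 1 -> exists k : int, nu y = nu pi ^ k.
  move=> y0 y1.
  have ex : exists n, nu pi ^+ n.+1 < nu y.
    have y0' : 0 < nu y by rewrite abs_gt0.
    have pl : `|nu pi| < 1 by rewrite ger0_norm ?abs_ge0// abs_uniformizer_lt1.
    have /cvgrPdist_lt/(_ _ y0')[N _ hN] := cvg_expr pl.
    exists N; have := hN N.+1 (leqnSn N).
    by rewrite /= sub0r normrN ger0_norm// exprn_ge0// abs_ge0.
  case: (ex_minnP ex) => n hn nmin.
  have le : nu y <= nu pi ^+ n.
    case: n hn nmin => [|n] _ nmin; first by rewrite expr0.
    by rewrite leNgt; apply/negP => /nmin; rewrite ltnn.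
  have u : nu (y / pi ^+ n) = 1.
    rewrite (nonarchM hnu)// (absV hnu)// (absX hnu)//.
    have pn : 0 < nu pi ^+ n by rewrite exprn_gt0.
    apply/eqP; rewrite eq_le ler_pdivrMr// mul1r le /=.
    rewrite leNgt; apply/negP; rewrite -(absX hnu)// -(absV hnu)// -(nonarchM hnu)// => /abs_lt1.
    rewrite (nonarchM hnu)// (absV hnu)// (absX hnu)// ler_pdivrMr// -exprS leNgt.
    by rewrite hn.
  exists n%:Z; move: u; rewrite (nonarchM hnu)// (absV hnu)// (absX hnu)// => e.
  by rewrite -[RHS]mul1r -e mulfVK// expf_neq0 ?gt_eqF.
move=> x0; have [x1|x1] := lerP (nu x) 1; first exact: small.
have [||k e] := small x^-1; rewrite ?invr_eq0//.
  by rewrite (absV hnu)// invf_le1 ?abs_gt0// ltW.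
by exists (- k); rewrite -invr_expz -e (absV hnu)// invrK.
Qed.

End ValueGroup.

(** * Lattices *)

Section Lattices.
Variables (R : realType) (K : fieldType) (nu : K -> R) (pi : K).
Hypotheses (hnu : nonarch_abs nu) (hpi : uniformizer nu pi).

Let nuM := nonarchM hnu.
Let pi0 := uniformizer_neq0 hpi.
Let pi_lt1 := abs_uniformizer_lt1 hpi.

Implicit Types (c : K) (L : set 'cV[K]_2) (M : 'M[K]_2).

Local Notation integral M := (forall i j, nu (M i j) <= 1).
Local Notation lat := (lattice_of nu).

Lemma integral_mul m n q (A : 'M[K]_(m, n)) (B : 'M[K]_(n, q)) :
  integral A -> integral B -> integral (A *m B).
Proof.
move=> hA hB i j; rewrite mxE; apply: (big_ind (fun x => nu x <= 1)).
- by rewrite abs0// ler01.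
- by move=> x y; exact: absD_le.
- by move=> k _; exact: absM_le1.
Qed.

Lemma lattice_mul M (U : 'M[K]_2) : integral U -> lat (M *m U) `<=` lat M.
Proof.
move=> Ui _ [x xi <-]; exists (U *m x); last by rewrite mulmxA.
by move=> i; apply: integral_mul => // k l; rewrite [l]ord1; exact: xi.
Qed.

Lemma lattice_mul_eq M (U V : 'M[K]_2) : integral U -> integral V ->
  U *m V = 1%:M -> lat (M *m U) = lat M.
Proof.
move=> Ui Vi UV; apply/seteqP; split; first exact: lattice_mul.
by rewrite -{1}[M]mulmx1 -UV mulmxA; exact: lattice_mul.
Qed.

Lemma latticeD M x y : lat M x -> lat M y -> lat M (x + y).
Proof.
move=> [u ui <-] [v vi <-]; exists (u + v); last by rewrite mulmxDr.
by move=> i; rewrite mxE; exact: absD_le.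
Qed.

Lemma latticeZ M c x : nu c <= 1 -> lat M x -> lat M (c *: x).
Proof.
move=> c1 [u ui <-]; exists (c *: u); last by rewrite scalemxAr.
by move=> i; rewrite mxE; exact: absM_le1.
Qed.

Lemma scale_latticeE c M : scale_lattice c (lat M) = lat (c *: M).
Proof.
apply/seteqP; split=> [_ [_ [x xi <-] <-]|_ [x xi <-]].
  by exists x; rewrite // scalemxAl.
by exists (M *m x); [exists x|rewrite scalemxAl].
Qed.

Lemma scale_latticeA (a b : K) L : scale_lattice a (scale_lattice b L) = scale_lattice (a * b) L.
Proof.
apply/seteqP; split=> [_ [_ [x Lx <-] <-]|_ [x Lx <-]].
  by exists x; rewrite // scalerA.
by exists (b *: x); [exists x|rewrite scalerA].
Qed.

Lemma scale_lattice1 (L : set 'cV[K]_2) : scale_lattice 1 L = L.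
Proof.
apply/seteqP; split=> [_ [x Lx <-]|x Lx]; first by rewrite scale1r.
by exists x; rewrite ?scale1r.
Qed.

Lemma scale_latticeS c L L' : L `<=` L' -> scale_lattice c L `<=` scale_lattice c L'.
Proof. by move=> LL' _ [x /LL' Lx <-]; exists x. Qed.

Lemma scale_latticeK c L : c != 0 -> scale_lattice c^-1 (scale_lattice c L) = L.
Proof. by move=> c0; rewrite scale_latticeA mulVf// scale_lattice1. Qed.

Lemma scale_lattice_proper c L L' : c != 0 -> L `<` L' ->
  scale_lattice c L `<` scale_lattice c L'.
Proof.
move=> c0 [s n]; split; first exact: scale_latticeS.
by move=> /(scale_latticeS (c := c^-1)); rewrite !scale_latticeK.
Qed.

Lemma lattice_scaleS (a b : K) L : is_lattice nu L -> nu a <= nu b -> b != 0 ->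
  scale_lattice a L `<=` scale_lattice b L.
Proof.
move=> [M uM ->] ab b0 _ [x Lx <-]; exists ((a / b) *: x).
  by apply: latticeZ => //; rewrite nuM absV// ler_pdivrMr ?mul1r// abs_gt0.
by rewrite scalerA mulrC divfK.
Qed.

Lemma lattice_scale_eq (a b : K) L : is_lattice nu L -> nu a = nu b -> b != 0 ->
  scale_lattice a L = scale_lattice b L.
Proof.
move=> Ll ab b0; have a0 : a != 0 by rewrite -(abs_gt0 hnu) ab abs_gt0.
by apply/seteqP; split; apply: lattice_scaleS; rewrite // ab.
Qed.

Lemma is_lattice_scale c L : c != 0 -> is_lattice nu L -> is_lattice nu (scale_lattice c L).
Proof.
move=> c0 [M uM ->]; rewrite scale_latticeE; exists (c *: M) => //.
by rewrite unitmxZ// unitfE.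
Qed.

Lemma homothety_scale c L : c != 0 -> homothety_class (scale_lattice c L) = homothety_class L.
Proof.
move=> c0; apply/seteqP; split=> [_ [a a0 <-]|_ [a a0 <-]].
  by exists (a * c); rewrite /= ?mulf_neq0 ?scale_latticeA.
by exists (a / c); rewrite /= ?mulf_neq0 ?invr_eq0 ?scale_latticeA ?divfK.
Qed.

Lemma homothety_mem L : homothety_class L L.
Proof. by exists 1; [exact: oner_neq0|exact: scale_lattice1]. Qed.

Lemma vertexP v L : BT_vertex nu v -> v L -> is_lattice nu L /\ v = homothety_class L.
Proof.
move=> [M Ml <-] [c c0 <-]; split; first exact: is_lattice_scale.
by rewrite homothety_scale.
Qed.

Lemma homothety_eq L L' : homothety_class L = homothety_class L' ->
  exists2 c, c != 0 & L' = scale_lattice c L.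
Proof. by move=> e; have := homothety_mem L'; rewrite -e => -[c c0 <-]; exists c. Qed.

(** ** Neighbours *)

(** Adjacency read on representatives, for a fixed uniformizer: see [BT_adjP]. *)
Definition between (L L' : set 'cV[K]_2) := scale_lattice pi L `<` L' /\ L' `<` L.

Lemma between_scale c L L' : c != 0 -> between L L' ->
  between (scale_lattice c L) (scale_lattice c L').
Proof.
move=> c0 [h1 h2]; split; last exact: scale_lattice_proper.
by rewrite scale_latticeA mulrC -scale_latticeA; exact: scale_lattice_proper.
Qed.

Lemma between_swap L L' : between L L' -> between L' (scale_lattice pi L).
Proof. by move=> [h1 h2]; split=> //; exact: scale_lattice_proper. Qed.

Lemma BT_adjP v w L : BT_vertex nu v -> BT_vertex nu w -> v L ->
  BT_adj nu v w <-> exists2 L', w L' & between L L'.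
Proof.
move=> Vv Vw vL; have [Ll ve] := vertexP Vv vL; split.
  move=> /asboolP[_ _ [a [L1 [L2 [[a0 a1 amax] vL1 wL2 h1 h2]]]]].
  have [c c0 e] : homothety_class L1 L.
    by have [_ <-] := vertexP Vv vL1.
  exists (scale_lattice c L2).
    by have [L2l we] := vertexP Vw wL2; rewrite we; exists c.
  rewrite -e; apply: between_scale => //; split=> //.
  rewrite (@lattice_scale_eq _ a)//; first by case: (vertexP Vv vL1).
  by apply/eqP; rewrite eq_le amax//= (abs_lt1 hpi).
by move=> [L' wL' [h1 h2]]; apply/asboolP; split=> //; exists pi, L, L'.
Qed.

Lemma BT_adj_sym : symmetric (BT_adj nu).
Proof.
suff h v w : BT_adj nu v w -> BT_adj nu w v by move=> v w; apply/idP/idP; exact: h.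
move=> vw; have [Vv Vw [_ [L [_ [_ vL _ _ _]]]]] := asboolW vw.
have [L' wL' /between_swap LL'] := (BT_adjP Vv Vw vL).1 vw.
apply/(BT_adjP Vw Vv wL'); exists (scale_lattice pi L) => //.
by have [_ ->] := vertexP Vv vL; exists pi.
Qed.

Lemma colP2 (x y : 'cV[K]_2) : x 0 0 = y 0 0 -> x 1 0 = y 1 0 -> x = y.
Proof.
move=> e0 e1; apply/colP => -[[|[|//]] i].
  by have -> : Ordinal i = 0 by exact: val_inj.
by have -> : Ordinal i = 1 by exact: val_inj.
Qed.

(** Two distinct lattices between [pi L] and [L] are distinct lines of the
    plane [L / pi L], which is their sum. *)
Lemma between_sum L A B : is_lattice nu L -> is_lattice nu A -> is_lattice nu B ->
  between L A -> between L B -> A <> B ->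
  forall x, L x -> exists a b, [/\ A a, B b & x = a + b].
Proof.
move=> Ll; move: A B; have main A B : is_lattice nu A -> is_lattice nu B ->
    between L A -> between L B -> ~ B `<=` A ->
    forall x, L x -> exists a b, [/\ A a, B b & x = a + b].
  move=> [MA uA eA] [MB uB eB] [[LA nLA] [AL _]] [_ [BL _]] BnA x Lx.
  have [a Aa na] : exists2 a, A a & ~ scale_lattice pi L a.
    by apply: contrapT => no; apply: nLA => a Aa; apply: contrapT => na; apply: no; exists a.
  have [b Bb nb] : exists2 b, B b & ~ A b.
    by apply: contrapT => no; apply: BnA => b Bb; apply: contrapT => nb; apply: no; exists b.
  have La := AL _ Aa; have Lb := BL _ Bb.
  case: Ll LA nLA AL BL na Lx La Lb => M uM -> LA _ AL BL na [x' xi ex] [a' ai ea] [b' bi eb].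
  pose d := a' 0 0 * b' 1 0 - a' 1 0 * b' 0 0.
  have d1 : nu d <= 1 by apply: absB_le => //; exact: absM_le1.
  have [dlt|] := ltrP (nu d) 1; last first.
    move=> d1'; have nd : nu d = 1 by apply/eqP; rewrite eq_le d1.
    have d0 : d != 0 by rewrite -(abs_gt0 hnu) nd ltr01.
    have divd y : nu y <= 1 -> nu (y / d) <= 1 by rewrite nuM absV// nd invr1 mulr1.
    exists (((x' 0 0 * b' 1 0 - x' 1 0 * b' 0 0) / d) *: a).
    exists (((a' 0 0 * x' 1 0 - a' 1 0 * x' 0 0) / d) *: b).
    split.
    - by rewrite eA; apply: latticeZ; rewrite -?eA//; apply/divd/absB_le => //; exact: absM_le1.
    - by rewrite eB; apply: latticeZ; rewrite -?eB//; apply/divd/absB_le => //; exact: absM_le1.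
    rewrite -ex -ea -eb !scalemxAr -mulmxDr; congr (_ *m _).
    by apply: colP2; rewrite !mxE /d in d0 *; field.
  case: nb.
  (* As the determinant d is divisible by pi, b is a multiple of a modulo pi. *)
  have [t ti ht] : exists2 t, nu t <= 1 & forall i, nu ((b' - t *: a') i 0) <= nu pi.
    have dpi := abs_lt1 hpi dlt.
    have [u0|n0] := eqVneq (nu (a' 0 0)) 1.
      have a0 : a' 0 0 != 0 by rewrite -(abs_gt0 hnu) u0 ltr01.
      exists (b' 0 0 / a' 0 0); first by rewrite nuM absV// u0 invr1 mulr1.
      case=> -[|[|//]] i; rewrite !mxE.
        have -> : Ordinal i = 0 by exact: val_inj.
        by rewrite divfK// subrr abs0// abs_ge0.
      have -> : Ordinal i = 1 by exact: val_inj.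
      have -> : b' 1 0 - b' 0 0 / a' 0 0 * a' 1 0 = d / a' 0 0 by rewrite /d; field.
      by rewrite nuM absV// u0 invr1 mulr1.
    have [u1|n1] := eqVneq (nu (a' 1 0)) 1.
      have a0 : a' 1 0 != 0 by rewrite -(abs_gt0 hnu) u1 ltr01.
      exists (b' 1 0 / a' 1 0); first by rewrite nuM absV// u1 invr1 mulr1.
      case=> -[|[|//]] i; rewrite !mxE; last first.
        have -> : Ordinal i = 1 by exact: val_inj.
        by rewrite divfK// subrr abs0// abs_ge0.
      have -> : Ordinal i = 0 by exact: val_inj.
      have -> : b' 0 0 - b' 1 0 / a' 1 0 * a' 0 0 = - (d / a' 1 0) by rewrite /d; field.
      by rewrite absN// nuM absV// u1 invr1 mulr1.
    case: na; rewrite -ea scale_latticeE; exists (pi^-1 *: a'); last first.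
      by rewrite -scalemxAl -scalemxAr scalerA mulfV// scale1r.
    have ok y : nu y <= 1 -> nu y != 1 -> nu (pi^-1 * y) <= 1.
      move=> y1 yn1; rewrite nuM absV// ler_pdivrMl ?abs_gt0// mulr1.
      by apply: (abs_lt1 hpi); rewrite lt_neqAle yn1.
    case=> -[|[|//]] i; rewrite mxE.
      have -> : Ordinal i = 0 by exact: val_inj.
      exact: ok.
    have -> : Ordinal i = 1 by exact: val_inj.
    exact: ok.
  have -> : b = M *m (b' - t *: a') + t *: a.
    by rewrite -eb -ea mulmxBr -scalemxAr subrK.
  rewrite eA; apply: latticeD; last by apply: latticeZ => //; rewrite -eA.
  rewrite -eA; apply: LA; rewrite scale_latticeE.
  exists (pi^-1 *: (b' - t *: a')); last by rewrite -scalemxAl -scalemxAr scalerA mulfV// scale1r.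
  by move=> i; rewrite mxE nuM absV// ler_pdivrMl ?abs_gt0// mulr1.
move=> A B Al Bl LA LB AB; have [BA|BA] := pselect (B `<=` A); last exact: main.
move=> x Lx; have [|b [a [Bb Aa ->]]] := main B A Bl Al LB LA _ x Lx.
  by move=> AB'; apply: AB; apply/seteqP.
by exists a, b; rewrite addrC.
Qed.

(** ** The graph of lattice classes is a tree *)

(** A walk is represented by a decreasing sequence of lattices starting with
    [L0].  If [L], [L'], [L''] are consecutive and there is no backtracking,
    [pi L] and [L''] are distinct lattices between [pi L'] and [L'], so that [L']
    is their sum; hence, inductively, no lattice of the sequence is contained in
    [pi L0].  But a lattice homothetic to [L0] and strictly smaller is. *)
Lemma BT_acyclic : acyclic (BT_adj nu).
Proof.
move=> v0 [//|w s] /= /andP[v0w ws] nb _.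
have [V0 Vw [_ [L0 [_ [_ vL0 _ _ _]]]]] := asboolW v0w.
have [L0l e0] := vertexP V0 vL0.
have [L1 wL1 b01] := (BT_adjP V0 Vw vL0).1 v0w.
have key L' : v0 L' -> L' `<` L0 -> ~ L' `<=` scale_lattice pi L0 -> False.
  rewrite e0 => -[c c0 <-] [_ n1] n2.
  have [/(abs_lt1 hpi) cpi|c1] := ltrP (nu c) 1.
    by apply: n2; exact: lattice_scaleS.
  by apply: n1; rewrite -{1}[L0]scale_lattice1; apply: lattice_scaleS; rewrite ?abs1.
have main t v u L L' : BT_vertex nu v -> BT_vertex nu u -> v L -> u L' ->
    between L L' -> L `<=` L0 -> ~ L' `<=` scale_lattice pi L0 ->
    path (BT_adj nu) u t -> nonback [:: v, u & t] -> last u t != v0.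
  elim: t v u L L' => [|z t IH] v u L L' Vv Vu vL uL' bLL' sL nL' /=.
    move=> _ _; apply/eqP => uv0; apply: (key L') => //; first by rewrite -uv0.
    case: bLL' => _ [s1 n1]; split; first exact: subset_trans sL.
    by move=> L0L'; apply: n1; exact: subset_trans L0L'.
  move=> /andP[uz zt] nbz; have [_ Vz _] := asboolW uz.
  have [L'' zL'' bL''] := (BT_adjP Vu Vz uL').1 uz.
  have [[[Ll ve] [L'l ue]] [L''l ze]] := (vertexP Vv vL, vertexP Vu uL', vertexP Vz zL'').
  apply: (IH u z L' L'' Vu Vz uL' zL'' bL'' _ _ zt).
  - by case: bLL' => _ [s1 _]; exact: subset_trans sL.
  - move=> sL''; apply: nL' => x L'x.
    have [] := between_sum L'l L''l (is_lattice_scale pi0 Ll) bL'' (between_swap bLL') _ L'x.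
      move=> e; move: nbz => /andP[/eqP + _]; apply; congr Some.
      by rewrite ze ve e homothety_scale.
    move=> a [b [aL bL ->]].
    have {}aL := sL'' _ aL; have {}bL := scale_latticeS sL bL.
    have [M uM eM] := L0l; rewrite eM scale_latticeE in aL bL *.
    exact: latticeD.
  - by move: nbz; rewrite [nonback _]/= => /andP[].
apply: (main s v0 w L0 L1) => //.
by case: b01 => -[_].
Qed.

End Lattices.

Section Apartments.
Variables (R : realType) (K : fieldType) (nu : K -> R) (pi : K).
Hypotheses (hnu : nonarch_abs nu) (hpi : uniformizer nu pi).
Implicit Types (c : K) (L : set 'cV[K]_2) (M N P Q : 'M[K]_2).

Let nuM := nonarchM hnu.
Let pi0 := uniformizer_neq0 hpi.
Let pi_lt1 := abs_uniformizer_lt1 hpi.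

Local Notation integral M := (forall i j, nu (M i j) <= 1).
Local Notation lat := (lattice_of nu).
Local Notation class M := (homothety_class (lat M)).

Definition mat2 (a b c d : K) : 'M[K]_2 :=
  \matrix_(i, j) (if i == 0 then (if j == 0 then a else b)
                  else (if j == 0 then c else d)).

Lemma ord2P (i : 'I_2) : {i = 0} + {i = 1}.
Proof. by case: i => -[|[|//]] h; [left|right]; exact: val_inj. Qed.

Lemma mat2_eta M : M = mat2 (M 0 0) (M 0 1) (M 1 0) (M 1 1).
Proof.
by apply/matrixP => i j; rewrite mxE; case: (ord2P i) => ->; case: (ord2P j) => ->.
Qed.

Lemma mat2M a b c d a' b' c' d' : mat2 a b c d *m mat2 a' b' c' d' =
  mat2 (a * a' + b * c') (a * b' + b * d') (c * a' + d * c') (c * b' + d * d').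
Proof.
apply/matrixP => i j; rewrite !mxE big_ord_recl big_ord1 !mxE.
by case: (ord2P i) => ->; case: (ord2P j) => ->.
Qed.

Lemma mat2_1 : mat2 1 0 0 1 = 1%:M.
Proof. by rewrite [RHS]mat2_eta !mxE. Qed.

Lemma integral_mat2 a b c d : nu a <= 1 -> nu b <= 1 -> nu c <= 1 -> nu d <= 1 ->
  integral (mat2 a b c d).
Proof. by move=> *; rewrite mxE; do 2 case: ifP => _. Qed.

Lemma scale_mat2 e a b c d : e *: mat2 a b c d = mat2 (e * a) (e * b) (e * c) (e * d).
Proof. by rewrite [LHS]mat2_eta !mxE. Qed.

Definition diag2 (a b : K) := mat2 a 0 0 b.

Lemma diag2M a b a' b' : diag2 a b *m diag2 a' b' = diag2 (a * a') (b * b').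
Proof. by rewrite mat2M !mul0r !mulr0 !addr0 !add0r. Qed.

Lemma diag2_unit a b : a != 0 -> b != 0 -> diag2 a b \in unitmx.
Proof.
move=> a0 b0; have h : diag2 a b *m diag2 a^-1 b^-1 = 1%:M.
  by rewrite diag2M !mulfV// -mat2_1.
by case: (mulmx1_unit h).
Qed.

Lemma lattice_diag_unit M a b : nu a = 1 -> nu b = 1 -> lat (M *m diag2 a b) = lat M.
Proof.
move=> a1 b1; apply: (lattice_mul_eq hnu M (V := diag2 a^-1 b^-1)).
- by apply: integral_mat2; rewrite ?a1 ?b1 ?abs0.
- by apply: integral_mat2; rewrite ?absV ?a1 ?b1 ?invr1 ?abs0.
- rewrite diag2M !mulfV -?mat2_1//.
    by rewrite -(abs_gt0 hnu) b1.
  by rewrite -(abs_gt0 hnu) a1.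
Qed.

Lemma class_scale c M : c != 0 -> class (c *: M) = class M.
Proof. by move=> c0; rewrite -scale_latticeE homothety_scale. Qed.

(** ** Apartments *)

(** The apartment of the basis formed by the columns of [P]. *)
Definition apartment (P : 'M[K]_2) (k : int) := class (P *m diag2 (pi ^ k) 1).

Lemma apartment_vertex P k : P \in unitmx -> BT_vertex nu (apartment P k).
Proof.
move=> uP; exists (lat (P *m diag2 (pi ^ k) 1)) => //; exists (P *m diag2 (pi ^ k) 1) => //.
by rewrite unitmx_mul uP diag2_unit ?oner_eq0// expfz_neq0.
Qed.

Lemma lattice_mul_inj M A B : M \in unitmx -> lat (M *m A) `<=` lat (M *m B) ->
  lat A `<=` lat B.
Proof.
move=> uM h _ [x xi <-]; have [|y yi] := h (M *m A *m x); first by exists x.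
rewrite -!mulmxA => /(congr1 (mulmx (invmx M))); rewrite !mulKmx// => e.
by exists y.
Qed.

Lemma lat_e1 a b : lat (diag2 a b) (\col_i (if i == 0 then a else 0)).
Proof.
exists (\col_i (if i == 0 then 1 else 0)).
  by move=> i; rewrite mxE; case: ifP; rewrite ?abs1 ?abs0// ler01.
by apply/colP => i; rewrite !mxE big_ord_recl big_ord1 !mxE /=; case: (ord2P i) => ->; rewrite ?mulr1 ?mulr0 ?mul0r ?addr0.
Qed.

Lemma lat_e2 a b : lat (diag2 a b) (\col_i (if i == 0 then 0 else b)).
Proof.
exists (\col_i (if i == 0 then 0 else 1)).
  by move=> i; rewrite mxE; case: ifP; rewrite ?abs1 ?abs0// ler01.
by apply/colP => i; rewrite !mxE big_ord_recl big_ord1 !mxE /=; case: (ord2P i) => ->; rewrite ?mulr1 ?mulr0 ?mul0r ?addr0 ?add0r.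
Qed.

Lemma lat_diag2 a b x : lat (diag2 a b) x -> nu (x 0 0) <= nu a /\ nu (x 1 0) <= nu b.
Proof.
move=> [y yi <-]; rewrite !mxE !big_ord_recl !big_ord0 !mxE /= !mul0r !addr0 add0r.
have yi' i : nu (y i 0) <= 1 by exact: yi.
by rewrite ![_ * y _ _]mulrC; split; apply: (absM_le hnu).
Qed.

Lemma lat_diag2_sub a b a' b' : lat (diag2 a b) `<=` lat (diag2 a' b') ->
  nu a <= nu a' /\ nu b <= nu b'.
Proof.
move=> h; have [e1 _] := lat_diag2 (h _ (lat_e1 a b)).
by have [_ e2] := lat_diag2 (h _ (lat_e2 a b)); move: e1 e2; rewrite !mxE.
Qed.

Lemma apartment_adj P k : P \in unitmx ->
  BT_adj nu (apartment P k) (apartment P (k + 1)).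
Proof.
move=> uP; have pk0 : pi ^ k != 0 by rewrite expfz_neq0.
pose M := P *m diag2 (pi ^ k) 1.
have uM : M \in unitmx by rewrite unitmx_mul uP diag2_unit ?oner_eq0.
apply/(BT_adjP hnu hpi (apartment_vertex k uP) (apartment_vertex (k + 1) uP) (homothety_mem _)).
exists (lat (P *m diag2 (pi ^ (k + 1)) 1)); first exact: homothety_mem.
have -> : P *m diag2 (pi ^ (k + 1)) 1 = M *m diag2 pi 1.
  by rewrite -mulmxA diag2M mulr1 expfzDr// expr1z.
rewrite -/M; have pile : nu pi <= 1 by exact: ltW.
have e : pi *: M = M *m diag2 pi pi.
  by rewrite /diag2 -[X in mat2 X]mulr1 -[X in mat2 _ _ _ X]mulr1 -[X in mat2 _ X](mulr0 pi)
       -[X in mat2 _ _ X](mulr0 pi) -scale_mat2 mat2_1 -scalemxAr mulmx1.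
split; rewrite ?scale_latticeE ?e.
- split.
    have -> : diag2 pi pi = diag2 pi 1 *m diag2 1 pi by rewrite diag2M mulr1 mul1r.
    rewrite mulmxA; apply: (lattice_mul hnu).
    by apply: integral_mat2; rewrite ?abs0 ?abs1.
  move=> /(lattice_mul_inj uM)/lat_diag2_sub[_]; rewrite abs1// leNgt.
  by rewrite pi_lt1.
- split.
    by apply: (lattice_mul hnu); apply: integral_mat2; rewrite ?abs0 ?abs1.
  rewrite -{1}[M]mulmx1 -mat2_1 => /(lattice_mul_inj uM)/lat_diag2_sub[+ _].
  by rewrite abs1// leNgt pi_lt1.
Qed.

Lemma apartment_nonback P k : P \in unitmx -> apartment P (k + 2) <> apartment P k.
Proof.
move=> uP e; have [c c0] := homothety_eq (esym e).
have pk0 : pi ^ k != 0 by rewrite expfz_neq0.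
pose M := P *m diag2 (pi ^ k) 1.
have uM : M \in unitmx by rewrite unitmx_mul uP diag2_unit ?oner_eq0.
have -> : P *m diag2 (pi ^ (k + 2)) 1 = M *m diag2 (pi ^+ 2) 1.
  by rewrite -mulmxA diag2M mulr1 expfzDr.
have -> : scale_lattice c (lat M) = lat (M *m diag2 c c).
  rewrite scale_latticeE -[in LHS](mulmx1 M) -mat2_1 scalemxAr scale_mat2.
  by rewrite mulr1 mulr0.
move=> h; have h1 : lat (diag2 c c) `<=` lat (diag2 (pi ^+ 2) 1).
  by apply: (lattice_mul_inj uM); rewrite h.
have h2 : lat (diag2 (pi ^+ 2) 1) `<=` lat (diag2 c c).
  by apply: (lattice_mul_inj uM); rewrite h.
have [c2 _] := lat_diag2_sub h1; have [_] := lat_diag2_sub h2.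
rewrite abs1// leNgt (le_lt_trans c2)// absX// exprn_ilt1//.
exact: abs_ge0.
Qed.

Lemma apartment_connected P j k : P \in unitmx ->
  exists2 s, path (BT_adj nu) (apartment P j) s & last (apartment P j) s = apartment P k.
Proof.
move=> uP; wlog jk : j k / j <= k.
  move=> h; have [/h//|kj] := lerP j k; have [s ps <-] := h _ _ (ltW kj).
  exists (rev (belast (apartment P k) s)).
    by rewrite rev_path (eq_path (e' := BT_adj nu)) // => u w /=; exact: (BT_adj_sym hnu hpi).
  by case: (s) => //= w t; rewrite rev_cons last_rcons.
exists (segment (apartment P) j `|k - j|).
  by apply: segment_path => i; exact: apartment_adj.
by rewrite segment_last; congr apartment; lia.
Qed.

(** The entry of largest absolute value is moved to the corner; as it divides
    the other entries, row and column operations make the matrix diagonal. *)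
Lemma elementary_divisors Q : Q \in unitmx -> exists (U U' W W' : 'M[K]_2) (a b : K),
  [/\ integral U, integral U', integral W & integral W'] /\
  [/\ U *m U' = 1%:M, W *m W' = 1%:M, a != 0, b != 0 & Q = U *m diag2 a b *m W].
Proof.
pose pivot (Q : 'M[K]_2) := Q 0 0 != 0 /\ forall i j, nu (Q i j) <= nu (Q 0 0).
pose concl (Q : 'M[K]_2) := exists (U U' W W' : 'M[K]_2) (a b : K),
  [/\ integral U, integral U', integral W & integral W'] /\
  [/\ U *m U' = 1%:M, W *m W' = 1%:M, a != 0, b != 0 & Q = U *m diag2 a b *m W].
have le01 : nu 0 <= 1 by rewrite abs0.
have le11 : nu 1 <= 1 by rewrite abs1.
have main Q1 : Q1 \in unitmx -> pivot Q1 -> concl Q1.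
  move=> uQ [a0 amax]; set a := Q1 0 0 in a0 amax.
  pose x := Q1 1 0 / a; pose y := Q1 0 1 / a.
  have small i j : nu (Q1 i j / a) <= 1.
    by rewrite nuM absV// ler_pdivrMr ?mul1r// abs_gt0.
  pose b := Q1 1 1 - x * Q1 0 1.
  have e : Q1 = mat2 1 0 x 1 *m diag2 a b *m mat2 1 y 0 1.
    rewrite [LHS]mat2_eta !mat2M -/a; congr mat2; rewrite ?mulr0 ?mul0r ?mulr1 ?addr0 ?add0r ?mul1r//.
    - by rewrite /y mulrC divfK.
    - by rewrite /x divfK.
    - by rewrite /b /x /y; field.
  have mulD x1 x2 : mat2 1 0 x1 1 *m mat2 1 0 x2 1 = mat2 1 0 (x1 + x2) 1.
    by rewrite mat2M !mulr0 !mul0r !mulr1 !mul1r !addr0 !add0r.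
  have mulU x1 x2 : mat2 1 x1 0 1 *m mat2 1 x2 0 1 = mat2 1 (x1 + x2) 0 1.
    by rewrite mat2M !mulr0 !mul0r !mulr1 !mul1r !addr0 !add0r addrC.
  exists (mat2 1 0 x 1), (mat2 1 0 (- x) 1), (mat2 1 y 0 1), (mat2 1 (- y) 0 1), a, b.
  split; split=> //.
  - by apply: integral_mat2 => //; exact: small.
  - by apply: integral_mat2 => //; rewrite absN//; exact: small.
  - by apply: integral_mat2 => //; exact: small.
  - by apply: integral_mat2 => //; rewrite absN//; exact: small.
  - by rewrite mulD subrr mat2_1.
  - by rewrite mulU subrr mat2_1.
  - apply/eqP => b0; move: uQ; rewrite e b0 !unitmx_mul => /andP[/andP[_]].
    suff -> : diag2 a 0 = diag2 a 0 *m diag2 1 0.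
      rewrite unitmx_mul => /andP[_ u]; move: (mulmxV u) => /(congr1 (fun A : 'M[K]_2 => A (1 : 'I_2) (1 : 'I_2))).
      rewrite [invmx _]mat2_eta mat2M !mxE /= !mul0r addr0 => /eqP.
      by rewrite eq_sym oner_eq0.
    by rewrite diag2M mulr1 mulr0.
move=> uQ; pose s := mat2 0 1 1 0.
have ss : s *m s = 1%:M by rewrite mat2M !mul0r !mulr0 !mul1r !addr0 !add0r mat2_1.
have si : integral s by apply: integral_mat2.
have swapl Q1 : concl (s *m Q1) -> concl Q1.
  move=> [U [U' [W [W' [a [b [[h1 h2 h3 h4] [h5 h6 h7 h8 e]]]]]]]].
  exists (s *m U), (U' *m s), W, W', a, b; split; split=> //.
  - exact: (integral_mul hnu).
  - exact: (integral_mul hnu).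
  - by rewrite mulmxA -(mulmxA s) h5 mulmx1.
  - by rewrite -!mulmxA (mulmxA U) -e mulmxA ss mul1mx.
have swapr Q1 : concl (Q1 *m s) -> concl Q1.
  move=> [U [U' [W [W' [a [b [[h1 h2 h3 h4] [h5 h6 h7 h8 e]]]]]]]].
  exists U, U', (W *m s), (s *m W'), a, b; split; split=> //.
  - exact: (integral_mul hnu).
  - exact: (integral_mul hnu).
  - by rewrite mulmxA -(mulmxA W) ss mulmx1.
  - by rewrite mulmxA -e -mulmxA ss mulmx1.
have us : s \in unitmx by case: (mulmx1_unit ss).
case: (@arg_maxP _ _ _ (0, 0) xpredT (fun i : 'I_2 * 'I_2 => nu (Q i.1 i.2)) isT) => -[i j] _ /= qmax.
have {}qmax i' j' : nu (Q i' j') <= nu (Q i j) by exact: (qmax (i', j')).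
have q0 : Q i j != 0.
  apply/eqP => q0; move: uQ; suff -> : Q = 0 by rewrite unitmxE det0 unitr0.
  apply/matrixP => i' j'; rewrite mxE; apply/eqP.
  by rewrite -(abs_eq0 hnu) eq_le abs_ge0// andbT (le_trans (qmax _ _))// q0 abs0.
have sQ Q1 : s *m Q1 = mat2 (Q1 1 0) (Q1 1 1) (Q1 0 0) (Q1 0 1).
  by rewrite [in LHS](mat2_eta Q1) mat2M !mul0r !mul1r !addr0 !add0r.
have Qs Q1 : Q1 *m s = mat2 (Q1 0 1) (Q1 0 0) (Q1 1 1) (Q1 1 0).
  by rewrite [in LHS](mat2_eta Q1) mat2M !mulr0 !mulr1 !addr0 !add0r.
have pv (a b c d : K) : a != 0 -> nu b <= nu a -> nu c <= nu a -> nu d <= nu a -> pivot (mat2 a b c d).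
  by move=> *; split=> [|i' j']; rewrite !mxE//=; do 2 case: ifP => _.
case: (ord2P i) => ei; case: (ord2P j) => ej; subst i j.
- by apply: main.
- apply/swapr/main; first by rewrite unitmx_mul uQ.
  by rewrite Qs; exact: pv.
- apply/swapl/main; first by rewrite unitmx_mul uQ us.
  by rewrite sQ; exact: pv.
- apply/swapl/swapr/main; first by rewrite !unitmx_mul uQ us.
  by rewrite Qs sQ !mxE /=; exact: pv.
Qed.

Lemma class_diag P a b : a != 0 -> b != 0 -> exists2 k : int,
  nu (a / b) = nu pi ^ k & class (P *m diag2 a b) = apartment P k.
Proof.
move=> a0 b0; have ab0 : a / b != 0 by rewrite mulf_neq0// invr_eq0.
have [k ek] := abs_value hnu hpi ab0; exists k => //.
have pk0 : pi ^ k != 0 by rewrite expfz_neq0.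
have -> : diag2 a b = b *: (diag2 (pi ^ k) 1 *m diag2 (a / b / pi ^ k) 1).
  by rewrite diag2M /diag2 scale_mat2 !mulr0 !mulr1; congr mat2; field; rewrite pk0.
rewrite -scalemxAr class_scale// mulmxA /apartment.
rewrite (lattice_diag_unit (P *m _)) ?abs1//.
by rewrite nuM absV// absZ// ek mulfV// expfz_neq0// abs_eq0.
Qed.

(** Two lattices have bases that are proportional vector by vector, by
    [elementary_divisors]; so they lie in a common apartment. *)
Lemma BT_connected v w : BT_vertex nu v -> BT_vertex nu w ->
  exists2 s, path (BT_adj nu) v s & last v s = w.
Proof.
move=> [_ [M uM ->] <-] [_ [N uN ->] <-].
have uQ : invmx M *m N \in unitmx by rewrite unitmx_mul unitmx_inv uM.
have [U [U' [W [W' [a [b [[Ui U'i Wi W'i] [UU' WW' a0 b0 e]]]]]]]] := elementary_divisors uQ.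
have eN : N = M *m U *m diag2 a b *m W by rewrite -!mulmxA (mulmxA U) -e mulKVmx.
have uP : M *m U \in unitmx by rewrite unitmx_mul uM; case: (mulmx1_unit UU').
have -> : lat M = lat (M *m U) by rewrite (lattice_mul_eq hnu _ Ui U'i UU').
have -> : lat N = lat (M *m U *m diag2 a b).
  by rewrite {1}eN (lattice_mul_eq hnu _ Wi W'i WW').
have [k _ ->] := class_diag (M *m U) a0 b0.
have -> : class (M *m U) = apartment (M *m U) 0.
  by rewrite /apartment expr0z /diag2 mat2_1 mulmx1.
exact: apartment_connected.
Qed.

End Apartments.

(** * Schottky groups *)

Section Action.
Variables (R : realType) (K : fieldType) (nu : K -> R) (pi : K).
Hypotheses (hnu : nonarch_abs nu) (hpi : uniformizer nu pi).
Implicit Types (c : K) (L : set 'cV[K]_2) (M N P Q : 'M[K]_2) (x y : PGL2 K).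

Local Notation lat := (lattice_of nu).
Local Notation class M := (homothety_class (lat M)).

Lemma BT_act_class x N : BT_act x (class N) = class (val (repr x) *m N).
Proof.
have im c : [set val (repr x) *m u | u in scale_lattice c (lat N)] =
    scale_lattice c (lat (val (repr x) *m N)).
  apply/seteqP; split=> [_ [_ [_ [u ui <-] <-] <-]|_ [_ [u ui <-] <-]].
    by exists (val (repr x) *m N *m u); [exists u|rewrite -scalemxAr mulmxA].
  exists (c *: (N *m u)); last by rewrite -scalemxAr mulmxA.
  by exists (N *m u) => //; exists u.
apply/seteqP; split=> [_ [_ [c c0 <-] <-]|_ [c c0 <-]].
  by exists c => //; rewrite im.
by exists (scale_lattice c (lat N)); [exists c|rewrite im].
Qed.

Lemma repr_unit x : val (repr x) \in unitmx.
Proof. exact: (valP (repr x)). Qed.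

Lemma BT_act_vertex x v : BT_vertex nu v -> BT_vertex nu (BT_act x v).
Proof.
move=> [_ [N uN ->] <-]; rewrite BT_act_class.
exists (lat (val (repr x) *m N)) => //; exists (val (repr x) *m N) => //.
by rewrite unitmx_mul repr_unit.
Qed.

Lemma BT_act1 v : BT_vertex nu v -> BT_act 1%g v = v.
Proof.
move=> [_ [N uN ->] <-]; rewrite BT_act_class.
have [c c0 e] := PGL2_reprP (GL2_one K).
by rewrite [val _]e /= -scalemxAl mul1mx (class_scale nu).
Qed.

Lemma BT_actM x y v : BT_vertex nu v -> BT_act (x * y)%g v = BT_act x (BT_act y v).
Proof.
move=> [_ [N uN ->] <-]; rewrite !BT_act_class.
have [c c0 e] := PGL2_reprP (GL2_mul (repr x) (repr y)).
by rewrite [val (repr (x * y)%g)]e /= -!scalemxAl (class_scale nu)// mulmxA.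
Qed.

Lemma BT_act_adj x v w : BT_adj nu v w -> BT_adj nu (BT_act x v) (BT_act x w).
Proof.
move=> /asboolP[Vv Vw [a [L [L' [ua vL wL' [s1 n1] [s2 n2]]]]]]; apply/asboolP.
split; [exact: BT_act_vertex|exact: BT_act_vertex|].
set A := val (repr x); have uA : A \in unitmx by exact: repr_unit.
pose f (L : set 'cV[K]_2) := [set A *m u | u in L].
have fS (L1 L2 : set 'cV[K]_2) : L1 `<=` L2 -> f L1 `<=` f L2.
  by move=> s _ [u /s Lu <-]; exists u.
have fS' (L1 L2 : set 'cV[K]_2) : f L1 `<=` f L2 -> L1 `<=` L2.
  move=> s u Lu; have [|w' L2w e] := s (A *m u); first by exists u.
  by rewrite -[u](mulKmx uA) -e mulKmx.
have fZ c (L1 : set 'cV[K]_2) : scale_lattice c (f L1) = f (scale_lattice c L1).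
  apply/seteqP; split=> [_ [_ [u Lu <-] <-]|_ [_ [u Lu <-] <-]].
    by exists (c *: u); [exists u|rewrite scalemxAr].
  by exists (A *m u); [exists u|rewrite scalemxAr].
exists a, (f L), (f L'); split=> //; [by exists L|by exists L'|..].
- by rewrite fZ; split; [exact: fS|move=> /fS'].
- by split; [exact: fS|move=> /fS'].
Qed.

Lemma hyperbolic_diag x : hyperbolic nu x -> exists P a b,
  [/\ P \in unitmx, a != 0, b != 0, nu a != nu b &
      val (repr x) *m P = P *m diag2 a b].
Proof.
move=> [a [b [cp ab]]]; set M := val (repr x) in cp *.
have uM : M \in unitmx by exact: repr_unit.
have ev c : c = a \/ c = b -> exists2 u : 'rV_2, u *m M = c *: u & u != 0.
  move=> ce; apply/eigenvalueP; rewrite eigenvalue_root_char cp rootM !root_XsubC.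
  by case: ce => ->; rewrite eqxx ?orbT.
have [u1 e1 n1] := ev a (or_introl erefl); have [u2 e2 n2] := ev b (or_intror erefl).
have nz c (u : 'rV_2) : u *m M = c *: u -> u != 0 -> c != 0.
  move=> e; apply: contraNneq => c0; rewrite -[u](mulmxK uM) e c0 scale0r.
  by rewrite mul0mx.
pose U : 'M[K]_2 := \matrix_(i, j) (if i == 0 then u1 0 j else u2 0 j).
have UE (v : 'rV_2) : v *m U = v 0 0 *: u1 + v 0 1 *: u2.
  apply/rowP => j; rewrite !mxE big_ord_recl big_ord1 !mxE /=.
  by congr (_ + v _ _ * _); apply: val_inj.
have uU : U \in unitmx.
  rewrite -row_free_unit; apply: inj_row_free => v; rewrite UE => v0.
  have e12 : v 0 0 *: u1 = - (v 0 1 *: u2) by apply/eqP; rewrite -addr_eq0 v0.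
  have h : v 0 0 *: (a *: u1) + v 0 1 *: (b *: u2) = 0.
    by have := congr1 (mulmx^~ M) v0; rewrite mul0mx mulmxDl -!scalemxAl e1 e2.
  have /eqP : (v 0 1 * (b - a)) *: u2 = 0.
    rewrite -[RHS]h; have -> : v 0 0 *: (a *: u1) = a *: (v 0 0 *: u1) by rewrite !scalerA mulrC.
    by rewrite e12 scalerN !scalerA -scaleNr -scalerDl; congr (_ *: _); ring.
  have ba : b - a != 0 by rewrite subr_eq0; apply: contraNneq ab => ->.
  rewrite scaler_eq0 (negPf n2) orbF mulf_eq0 (negPf ba) orbF => /eqP v1.
  move: v0; rewrite v1 scale0r addr0 => /eqP; rewrite scaler_eq0 (negPf n1) orbF => /eqP v0.
  by apply/rowP => i; rewrite mxE; case: (ord2P i) => ->.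
have UM : U *m M = diag2 a b *m U.
  have rU i : row i U = if i == 0 then u1 else u2.
    by apply/rowP => j; rewrite !mxE; case: ifP.
  apply/row_matrixP => i; rewrite !row_mul rU UE !mxE.
  by case: (ord2P i) => -> /=; rewrite ?e1 ?e2 scale0r ?addr0 ?add0r.
exists (invmx U), a, b; split; rewrite ?unitmx_inv//.
- exact: nz e1 n1.
- exact: nz e2 n2.
- by rewrite -[in LHS](mulKmx uU M) UM mulmxA mulmxK.
Qed.

(** The apartment of a basis of eigenvectors is translated by the valuation of
    the ratio of the eigenvalues. *)
Lemma hyperbolic_axis x : hyperbolic nu x ->
  exists A, is_axis (BT_vertex nu) (BT_adj nu) (BT_act x) A.
Proof.
move=> /hyperbolic_diag[P [a [b [uP a0 b0 ab e]]]].
have [l el _] := class_diag hnu hpi P a0 b0.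
exists (range (apartment nu pi P)), (apartment nu pi P), l; split=> //.
- apply: contraNneq ab => l0; move: el; rewrite l0 expr0z nonarchM// absV//.
  by move=> h; rewrite -[nu b]mul1r -h divfK// abs_eq0.
- by move=> k; split; [exact: (apartment_vertex hpi)|exact: (apartment_adj hnu hpi)].
- by move=> k; exact: (apartment_nonback hnu hpi).
- move=> k; rewrite [LHS]BT_act_class mulmxA e -mulmxA diag2M mulr1.
  have pi0 := uniformizer_neq0 hpi.
  have apk : a * pi ^ k != 0 by rewrite mulf_neq0// expfz_neq0.
  have [m em ->] := class_diag hnu hpi P apk b0; congr apartment.
  have npi : 0 < nu pi by rewrite abs_gt0.
  apply: (@ieexprIz _ (nu pi)) => //; first by rewrite lt_eqF// (abs_uniformizer_lt1 hpi).
  by rewrite expfzDr ?gt_eqF// -el -em -(absZ hnu) -(nonarchM hnu);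
    rewrite [_ * (_ / _)]mulrA [pi ^ k * a]mulrC.
Qed.

End Action.

Section Schottky.
Variables (R : realType) (K : fieldType) (nu : K -> R) (pi : K).
Hypotheses (hnu : nonarch_abs nu) (hpi : uniformizer nu pi).

Lemma schottky_tree_action g (Gam : set (PGL2 K)) : (2 <= g)%N -> schottky nu g Gam ->
  tree_action (BT_vertex nu) (BT_adj nu) (@BT_act K) Gam.
Proof.
move=> g2 [grp disc hyp [a [aG ainj asurj]]].
have Ga i : Gam (a i).
  have := aG [:: (i, true)] isT; by rewrite /eval_word /= mulg1.
split=> //.
- exact: (BT_adj_sym hnu hpi).
- by move=> v w /asboolP[].
- exact: (BT_connected hnu hpi).
- exact: (BT_acyclic hnu hpi).
- exact: BT_act_vertex.
- exact: BT_act_adj.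
- exact: BT_act1.
- exact: BT_actM.
- by move=> x Gx /eqP x1; apply: (hyperbolic_axis hnu hpi); exact: hyp.
- exists [seq a i | i <- enum 'I_g]; first by move=> _ /mapP[i _ ->].
  move=> P P1 PM _ /asurj[s _ <-].
  have Ge t : Gam (eval_word a t).
    elim: t => [|[i b] t IH]; first by case: grp.
    have GV x : Gam x -> Gam (x^-1)%g.
      by move=> Gx; rewrite -[(x^-1)%g]mul1g; case: grp => G1 /(_ _ _ G1 Gx).
    have GM x y : Gam x -> Gam y -> Gam (x * y)%g.
      by move=> Gx Gy; rewrite -[y]invgK; case: grp => _; apply => //; exact: GV.
    by apply: GM => //=; case: b => //; exact: GV.
  elim: s => // -[i b] t IH.
  have [|h1 h2] := PM (a i) _ _ (Ge t) IH; first by apply: map_f; rewrite mem_enum.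
  by rewrite /eval_word /=; case: b.
- have g0 : (0 < g)%N by exact: ltnW.
  pose i0 := Ordinal g0; pose i1 := Ordinal g2.
  exists (a i0), (a i1); split=> // e.
  have : [:: (i0, true); (i1, true)] = [:: (i1, true); (i0, true)].
    apply: ainj; rewrite ?inE//.
    by rewrite /eval_word /= !mulg1.
  by move=> /(congr1 (fun s => nat_of_ord (head (i0, true) s).1)).
Qed.

End Schottky.

(** * Maps to the circle *)

Section CircleLifts.
Variable R : realType.
Local Notation S1 := (circle R).
Local Notation I := (unit_interval R).

Lemma circle_expN s : circle_exp (- s) = - circle_exp s :> S1.
Proof. by apply/eqP; rewrite -addr_eq0 -circle_expD addNr circle_exp0. Qed.

Lemma circle_expB s t : circle_exp (s - t) = circle_exp s - circle_exp t :> S1.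
Proof. by rewrite circle_expD circle_expN. Qed.

Lemma two_pi_neq0 : 2 * pi != 0 :> R.
Proof. by rewrite mulf_neq0// gt_eqF ?pi_gt0. Qed.

(** A logarithm on the right half of the circle. *)
Definition circle_log (z : S1) : R := atan ((val z).2 / (val z).1) / (2 * pi).

Lemma circle_logK (z : S1) : 0 < (val z).1 -> circle_exp (circle_log z) = z.
Proof.
move=> z1; have z0 : (val z).1 != 0 by rewrite gt_eqF.
set x := (val z).2 / (val z).1.
have e : 2 * pi * circle_log z = atan x by rewrite mulrC divfK// two_pi_neq0.
have c : cos (atan x) = (val z).1.
  rewrite cos_atan; have -> : 1 + x ^+ 2 = (val z).1 ^- 2.
    rewrite -[1](mulfV (expf_neq0 2 z0)) expr_div_n -mulrDl.
    by rewrite circleP mul1r.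
  by rewrite -exprVn sqrtr_sqr ger0_norm ?invrK// invr_ge0 ltW.
have s : sin (atan x) = (val z).2.
  have : tan (atan x) = x by rewrite atanK.
  rewrite /tan c /x => /(congr1 ( *%R^~ (val z).1)).
  by rewrite !divfK.
by apply: val_inj; rewrite /= e c s -surjective_pairing.
Qed.

Lemma circle_exp_surj (z : S1) : exists s, circle_exp s = z.
Proof.
have h := circleP z; set a := (val z).1 in h *; set b := (val z).2 in h *.
have ab : b ^+ 2 = 1 - a ^+ 2 by rewrite -h addrAC subrr add0r.
have a1 : -1 <= a <= 1.
  have a2 : a ^+ 2 <= 1 by rewrite -h lerDl sqr_ge0.
  by apply/andP; split; nra.
have e (r : R) : 2 * pi * (r / (2 * pi)) = r.
  by rewrite mulrCA mulfV ?mulr1//; exact: two_pi_neq0.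
have c : cos (acos a) = a by rewrite acosK// in_itv.
have s : sin (acos a) = `|b| by rewrite sin_acos// -ab sqrtr_sqr.
have [b0|b0] := lerP 0 b.
  exists (acos a / (2 * pi)); apply: val_inj; rewrite /= e c s ger0_norm//.
  by rewrite -surjective_pairing.
exists (- acos a / (2 * pi)); apply: val_inj.
by rewrite /= e cosN sinN c s ltr0_norm// opprK -surjective_pairing.
Qed.

Lemma circle_exp_eq0 (s : R) : circle_exp s = 0 -> exists m : int, s = m%:~R.
Proof.
move=> es; exists (Num.floor s); apply/eqP; rewrite -subr_eq0.
set t := s - _; have et : circle_exp t = 0 :> S1.
  by rewrite circle_expB es circle_exp_int subr0.
have [t0 t1] : 0 <= t /\ t < 1.
  rewrite subr_ge0 ltrBlDl floor_le; split=> //.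
  by have := floorD1_gt s; rewrite intrD.
move: t0; rewrite le0r => /orP[//|t0]; exfalso.
have : cos (2 * pi * t) = 1 by have := congr1 (fun z : S1 => (val z).1) et.
rewrite -mulrA mulr_natl mulr2n cosD => c2.
have s2 : sin (pi * t) = 0.
  have := cos2Dsin2 (pi * t); nra.
have : 0 < sin (pi * t).
  apply: sin_gt0_pi; rewrite mulr_gt0 ?pi_gt0//=.
  by rewrite gtr_pMr ?pi_gt0.
by rewrite s2 ltxx.
Qed.

Lemma circle_log_continuous (z : S1) : 0 < (val z).1 -> {for z, continuous circle_log}.
Proof.
move=> z1; rewrite /circle_log.
have c1 := @circle_fst_continuous R z; have c2 := @circle_snd_continuous R z.
have z10 : (val z).1 != 0 by rewrite gt_eqF.
have cq : ((val w).2 / (val w).1 : R) @[w --> z] --> ((val z).2 / (val z).1 : R).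
  exact: (cvgM c2 (cvgV z10 c1)).
have ca := cvg_comp _ _ cq (@continuous_atan R ((val z).2 / (val z).1)).
exact: (cvgM ca (cvg_cst _)).
Qed.

(** ** The unit interval *)

Lemma unit_intervalP (t : I) : 0 <= val t <= 1.
Proof. by have /set_mem := valP t; rewrite /= in_itv. Qed.

Lemma mem_unit_interval (t : R) : 0 <= t <= 1 -> t \in (`[0, 1]%classic : set R).
Proof. by move=> t01; apply/mem_set; rewrite /= in_itv. Qed.

Definition to_unit (t : R) (h : 0 <= t <= 1) : I :=
  exist (fun t => t \in (`[0, 1]%classic : set R)) t (mem_unit_interval h).

Lemma zero_in_unit : 0 <= (0 : R) <= 1. Proof. by rewrite lexx ler01. Qed.
Lemma one_in_unit : 0 <= (1 : R) <= 1. Proof. by rewrite lexx ler01. Qed.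
Definition I0 : I := to_unit zero_in_unit.
Definition I1 : I := to_unit one_in_unit.

Lemma unit_val_continuous : continuous (val : I -> R).
Proof. exact: (@initial_continuous _ _ set_val). Qed.

Lemma to_unit_continuous (Y : topologicalType) (f : Y -> R) (h : forall y, 0 <= f y <= 1) :
  continuous f -> continuous (fun y => to_unit (h y)).
Proof. by move=> cf; apply: continuous_comp_initial. Qed.

Lemma clamp_in_unit (t : R) : 0 <= Num.max 0 (Num.min 1 t) <= 1.
Proof. by rewrite le_max lexx /= ge_max ler01 ge_min lexx. Qed.

Let clamp (t : R) : I := to_unit (clamp_in_unit t).

Lemma clamp_continuous : continuous clamp.
Proof.
apply: to_unit_continuous => t.
by apply: continuous_max; [exact: cvg_cst|apply: continuous_min; [exact: cvg_cst|exact: cvg_id]].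
Qed.

Lemma unit_interval_image : [set: I] = clamp @` `[0, 1]%classic.
Proof.
apply/seteqP; split=> // t _; have /andP[t0 t1] := unit_intervalP t.
exists (val t); first by rewrite /= in_itv /= t0.
by apply: val_inj => /=; rewrite (min_idPr t1) (max_idPr t0).
Qed.

Lemma unit_connected : connected [set: I].
Proof.
rewrite unit_interval_image; apply: connected_continuous_connected.
  exact: segment_connected.
exact/continuous_subspaceT/clamp_continuous.
Qed.

Lemma unit_compact : compact [set: I].
Proof.
rewrite unit_interval_image; apply: continuous_compact; last exact: segment_compact.
exact/continuous_subspaceT/clamp_continuous.
Qed.

(** The interval is connected, and the equivalence classes are open. *)
Lemma unit_interval_ind (E : I -> I -> Prop) :
  (forall s t, E s t -> E t s) -> (forall r s t, E r s -> E s t -> E r t) ->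
  (forall s, \forall t \near s, E s t) -> forall s t, E s t.
Proof.
move=> sym trans loc s0.
have oE : open [set t | E s0 t].
  rewrite openE => s Es; rewrite /interior.
  by apply: filterS (loc s) => t; exact: trans Es.
have oN : open (~` [set t | E s0 t]).
  rewrite openE => s nEs; rewrite /interior.
  by apply: filterS (loc s) => t Est Et; apply: nEs; exact: trans Et (sym _ _ Est).
have := unit_connected => /(_ [set t | E s0 t]) h.
have e : [set t | E s0 t] = setT.
  apply: h; first by exists s0; apply: nbhs_singleton; exact: loc.
    by exists [set t | E s0 t]; rewrite ?setTI.
  by exists [set t | E s0 t]; rewrite ?setTI// -openC.
by move=> t; have : setT t by []; rewrite -e.
Qed.

Lemma int_valued_constant (F : I -> R) : continuous F ->
  (forall t, exists m : int, F t = m%:~R) -> forall s t, F s = F t.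
Proof.
move=> cF hF; apply: unit_interval_ind => [s t ->//|r s t -> //|s].
have /cvgrPdist_lt/(_ _ ltr01) := cF s.
apply: filterS => t; have [[m ->] [n ->]] := (hF s, hF t).
rewrite -intrB -intr_norm -[1]/(1%:~R) ltr_int => mn.
by congr _%:~R; lia.
Qed.

(** ** Homotopy and logarithms *)

Section Homotopy.
Variable Y : topologicalType.
Hypothesis cptY : compact [set: Y].

(** Being equal up to the exponential of a continuous real function is an
    equivalence relation, and it holds for nearby times of a homotopy, which
    are uniformly close by compactness. *)
Lemma homotopy_exp (H : continuousType (Y * I)%type S1) s t :
  exists2 th : Y -> R, continuous th & forall y, H (y, t) = H (y, s) + circle_exp (th y).
Proof.
move: s t; apply: unit_interval_ind.
- move=> s t [th cth e]; exists (fun y => - th y); first by move=> y; exact: cvgN (cth y).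
  by move=> y; rewrite e circle_expN addrK.
- move=> r s t [th cth e] [th' cth' e']; exists (fun y => th y + th' y).
    by move=> y; exact: cvgD (cth y) (cth' y).
  by move=> y; rewrite e' e circle_expD addrA.
move=> s.
have cs : continuous (fun z : Y * I => (z.1, s)).
  have c1 : continuous (@fst Y I) by move=> z; exact: cvg_fst.
  have c2 : continuous (fun _ : Y * I => s : I) by move=> z; exact: cvg_cst.
  by move=> z; exact: (cvg_pair (c1 z) (c2 z)).
pose Hs : continuousType (Y * I)%type (Y * I)%type := mkcts cs.
pose D : continuousType (Y * I)%type S1 := H - (H \o Hs : continuousType (Y * I)%type S1).
have DE y t : D (y, t) = H (y, t) - H (y, s) by [].
pose P (t : I) (y : Y) := 0 < (val (D (y, t))).1.
have loc y : [set: Y] y -> \forall y' \near y & t \near s, P t y'.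
  move=> _; rewrite /P.
  have cD : (val (D z)).1 @[z --> (y, s)] --> (val (D (y, s))).1.
    exact: (cvg_comp _ _ (@cts_fun _ _ D (y, s)) (@circle_fst_continuous R _)).
  have D0 : 0 < (val (D (y, s))).1 by rewrite DE subrr /= ltr01.
  by apply: filterS (cvgr_gt _ cD _ D0) => -[y' t].
have cov := (compact_near_coveringP _).1 cptY _ (nbhs s) P (nbhs_filter s) loc.
near=> t; have Pt : [set: Y] `<=` P t by near: t.
exists (fun y => circle_log (D (y, t))).
  move=> y; have cDt : D (y', t) @[y' --> y] --> D (y, t).
    apply: (cvg_comp (fun y' => (y', t)) D _ (@cts_fun _ _ D (y, t))).
    have c1 : continuous (@idfun Y) by move=> z; exact: cvg_id.
    have c2 : continuous (fun _ : Y => t : I) by move=> z; exact: cvg_cst.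
    exact: (cvg_pair (c1 y) (c2 y)).
  have D0 : 0 < (val (D (y, t))).1 by exact: Pt.
  exact: (cvg_comp _ _ cDt (circle_log_continuous D0)).
move=> y; have D0 : 0 < (val (D (y, t))).1 by exact: Pt.
by rewrite (circle_logK D0) DE [RHS]addrC subrK.
Unshelve. all: by end_near. Qed.

Lemma homotopic_exp (u v : continuousType Y S1) : homotopic u v ->
  exists2 th : Y -> R, continuous th & forall y, u y = v y + circle_exp (th y).
Proof.
move=> /asboolP[H hH]; have [th cth e] := homotopy_exp H I1 I0.
by exists th => // y; rewrite -(hH y I0).1// -(hH y I1).2.
Qed.

End Homotopy.

Lemma exp_homotopic (Y : topologicalType) (u v : continuousType Y S1) (th : Y -> R) :
  continuous th -> (forall y, u y = v y + circle_exp (th y)) -> homotopic u v.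
Proof.
move=> cth e; apply/asboolP.
have cH : continuous (fun z : Y * I => v z.1 + circle_exp ((1 - val z.2) * th z.1)).
  have c1 : continuous (fun z : Y * I => v z.1).
    by move=> z; apply: (@continuous_comp _ _ _ fst v); [exact: cvg_fst|exact: cts_fun].
  have cf : continuous (@fst Y I) by move=> z; exact: cvg_fst.
  have cs : continuous (@snd Y I) by move=> z; exact: cvg_snd.
  have c2 : continuous (fun z : Y * I => circle_exp ((1 - val z.2) * th z.1)).
    move=> z; have ct : th w.1 @[w --> z] --> th z.1 by exact: (cvg_comp fst th (cf z) (cth z.1)).
    have cv : (val w.2 : R) @[w --> z] --> (val z.2 : R).
      exact: (cvg_comp snd _ (cs z) (@unit_val_continuous z.2)).
    have cm : (1 - val w.2) * th w.1 @[w --> z] --> (1 - val z.2) * th z.1.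
      have co : (fun _ : Y * I => 1 : R) @ z --> (1 : R) by exact: cvg_cst.
      exact: (cvgM (cvgB co cv) ct).
    exact: (cvg_comp _ _ cm (@circle_exp_continuous R _)).
  exact: (@cts_fun _ _ ((mkcts c1 : continuousType _ S1) + (mkcts c2 : continuousType _ S1))).
exists (mkcts cH) => y t.
split=> t01; transitivity (v y + circle_exp ((1 - val t) * th y)) => //; rewrite t01.
  by rewrite subr0 mul1r e.
by rewrite subrr mul0r circle_exp0 addr0.
Qed.

Lemma int_valued_continuous (Y : topologicalType) (F : Y -> R) : continuous F ->
  (forall y, exists m : int, F y = m%:~R) ->
  exists n : continuousType Y intd, forall y, F y = (n y : int)%:~R.
Proof.
move=> cF hF; pose n y : intd := Num.floor (F y).
have nE y : F y = (n y : int)%:~R by rewrite /n; have [m ->] := hF y; rewrite intrKfloor.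
have cn : continuous n.
  move=> y A /nbhs_singleton Ay.
  have /cvgrPdist_lt/(_ _ ltr01) := cF y.
  apply: filterS => z; rewrite !nE -intrB -intr_norm -[1]/(1%:~R) ltr_int => yz.
  have e : n z = n y by rewrite /n in yz *; lia.
  by rewrite /= e.
by exists (mkcts cn).
Qed.

(** The homotopy [(x, t), s |-> v (x, s t)] contracts the cylinder to its
    base. *)
Lemma cylinder_exp_lift (X : topologicalType) (v : continuousType (X * I)%type S1) :
  compact [set: X] -> exists2 th : X * I -> R, continuous th &
    forall x t, v (x, t) = v (x, I0) + circle_exp (th (x, t)).
Proof.
move=> cX.
have cf1 : continuous (@fst (X * I) I) by move=> z; exact: cvg_fst.
have cf2 : continuous (@fst X I) by move=> z; exact: cvg_fst.
have cs1 : continuous (@snd (X * I) I) by move=> z; exact: cvg_snd.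
have cs2 : continuous (@snd X I) by move=> z; exact: cvg_snd.
have cXI : compact [set: X * I].
  by rewrite -setXTT; exact: compact_setX unit_compact.
have mI (s t : I) : 0 <= val s * val t <= 1.
  have /andP[s0 s1] := unit_intervalP s; have /andP[t0 t1] := unit_intervalP t.
  by rewrite mulr_ge0//= mulr_ile1.
pose m (z : (X * I) * I) : X * I := (z.1.1, to_unit (mI z.2 z.1.2)).
have cm : continuous m.
  have c12 : continuous (fun z : X * I * I => z.1.2).
    by move=> z; exact: (cvg_comp fst snd (cf1 z) (cs2 z.1)).
  have cu : continuous (fun z : X * I * I => to_unit (mI z.2 z.1.2)).
    apply: (@to_unit_continuous _ (fun z : X * I * I => val z.2 * val z.1.2)
      (fun z => mI z.2 z.1.2)) => z /=.
    have c2 : (val w.2 : R) @[w --> z] --> (val z.2 : R).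
      exact: (cvg_comp snd _ (cs1 z) (@unit_val_continuous z.2)).
    have c12v : (val w.1.2 : R) @[w --> z] --> (val z.1.2 : R).
      exact: (cvg_comp (fun w : X * I * I => w.1.2) _ (c12 z) (@unit_val_continuous z.1.2)).
    exact: (cvgM c2 c12v).
  have c11 : continuous (fun z : X * I * I => z.1.1).
    by move=> z; exact: (cvg_comp fst fst (cf1 z) (cf2 z.1)).
  move=> z; exact: (cvg_pair (c11 z) (cu z)).
pose H : continuousType ((X * I) * I)%type S1 := v \o (mkcts cm : continuousType _ _).
have [th cth e] := homotopy_exp cXI H I0 I1.
exists th => // x t; have := e (x, t).
have -> : H ((x, t), I1) = v (x, t).
  by congr (v (_, _)); apply: val_inj; rewrite /= mul1r.
by have -> : H ((x, t), I0) = v (x, I0) by congr (v (_, _)); apply: val_inj; rewrite /= mul0r.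
Qed.

End CircleLifts.

(** * The first cohomology of a mapping torus *)

Section TorusCohomology.
Variables (R : realType) (X : topologicalType) (T : continuousType X X).
Local Notation S1 := (circle R).
Local Notation I := (unit_interval R).
Local Notation torus := (mapping_torus R T).
Local Notation CZ := (continuousType X intd).
Hypothesis cptX : compact [set: X].
Hypothesis exp_lift : forall u : continuousType X S1,
  exists2 th : X -> R, continuous th & forall x, u x = circle_exp (th x).

Let proj : X * I -> torus := \pi_torus.

Lemma glue_ends x : proj (T x, I0 R) = proj (x, I1 R).
Proof.
apply/eqmodP; rewrite /= /torus_rel; apply/asboolP.
by apply: rst_step.
Qed.

Lemma glue_continuous : continuous proj.
Proof. exact: pi_continuous. Qed.

Lemma glue_surj (y : torus) : exists x t, y = proj (x, t).
Proof.
exists (repr y).1, (repr y).2; rewrite -surjective_pairing.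
by rewrite /proj reprK.
Qed.

Lemma torus_compact : compact [set: torus].
Proof.
have -> : [set: torus] = proj @` [set: X * I].
  apply/seteqP; split=> // y _; have [x [t ->]] := glue_surj y.
  by exists (x, t).
apply: continuous_compact; first exact/continuous_subspaceT/glue_continuous.
by rewrite -setXTT; apply: compact_setX => //; exact: unit_compact.
Qed.

Lemma torus_descend (Z : topologicalType) (f : X * I -> Z) : continuous f ->
  (forall x, f (T x, I0 R) = f (x, I1 R)) ->
  exists2 g : torus -> Z, continuous g & forall a, g (proj a) = f a.
Proof.
move=> cf glue.
have inv a b : torus_rel T a b -> f a = f b.
  move=> /asboolP; elim=> {a b} [[x s] [y t] [/= -> s0 t1]|//|a b _ -> //|a b c _ -> _ -> //].
  have -> : s = I0 R by apply: val_inj.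
  by have -> : t = I1 R by apply: val_inj.
exists (f \o repr).
  apply: repr_comp_continuous => // a b /eqP e; apply/eqP/inv.
  by have /eqmodP := e.
move=> a; apply: inv; have /eqmodP : repr (proj a) = a %[mod torus] by exact: reprK.
by [].
Qed.

Lemma torus_exp_proj (f : CZ) x t : torus_exp R T f (proj (x, t)) = circle_exp (val t * (f x : int)%:~R).
Proof. exact: torus_exp_pi. Qed.

Lemma torus_eq (Z : Type) (g h : torus -> Z) :
  (forall x t, g (proj (x, t)) = h (proj (x, t))) -> g =1 h.
Proof. by move=> e y; have [x [t ->]] := glue_surj y. Qed.

Lemma int_val_continuous (f : CZ) : continuous (fun x => (f x : int)%:~R : R).
Proof.
have cz : continuous (fun m : intd => (m : int)%:~R : R).
  move=> m A /nbhs_singleton Am.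
  have := @discrete_set1 (discrete_topology int) m.
  by apply: (@filterS intd (nbhs m)) => _ ->.
by move=> x; exact: (cvg_comp f _ (@cts_fun _ _ f x) (cz _)).
Qed.

Lemma cylinder_fst_continuous : continuous (@fst X I).
Proof. by move=> z; exact: cvg_fst. Qed.
Lemma cylinder_time_continuous : continuous (fun z : X * I => val z.2).
Proof.
move=> z; have cs : continuous (@snd X I) by move=> w; exact: cvg_snd.
exact: (cvg_comp snd _ (cs z) (@unit_val_continuous R z.2)).
Qed.

Lemma cylinder_scale_continuous (f : CZ) (a : R -> R) : continuous a ->
  continuous (fun z : X * I => a (val z.2) * (f z.1 : int)%:~R).
Proof.
move=> ca z.
have c1 : a (val w.2) @[w --> z] --> a (val z.2).
  exact: (cvg_comp _ _ (@cylinder_time_continuous z) (ca (val z.2))).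
have c2 : ((f w.1 : int)%:~R : R) @[w --> z] --> ((f z.1 : int)%:~R : R).
  exact: (cvg_comp _ _ (@cylinder_fst_continuous z) (@int_val_continuous f z.1)).
exact: (cvgM c1 c2).
Qed.

(** The exponent [t (h x - h (T x))] differs by the integer [h x] from
    [- (1 - t) h x - t h (T x)], which takes the same value at [(T x, 0)] and
    [(x, 1)] and thus is a function on the torus. *)
Lemma torus_exp_coboundary (h : CZ) : homotopic (torus_exp R T (delta T h)) 0.
Proof.
pose hT : CZ := h \o T.
pose th (z : X * I) : R := - ((1 - val z.2) * (h z.1 : int)%:~R) - val z.2 * (hT z.1 : int)%:~R.
have cth : continuous th.
  have ci : continuous (@idfun R) by move=> t; exact: cvg_id.
  have cm : continuous (fun t : R => 1 - t).
    by move=> t; apply: cvgB; [exact: cvg_cst|exact: cvg_id].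
  have h1 := cylinder_scale_continuous (f := h) cm; have h2 := cylinder_scale_continuous (f := hT) ci.
  move=> z; exact: (cvgB (cvgN (h1 z)) (h2 z)).
have [|g cg gE] := torus_descend cth.
  move=> x; rewrite -[LHS]/(- ((1 - 0) * (hT x : int)%:~R) - 0 * (hT (T x) : int)%:~R).
  rewrite -[RHS]/(- ((1 - 1) * (h x : int)%:~R) - 1 * (hT x : int)%:~R).
  by rewrite subr0 subrr !mul1r !mul0r subr0 oppr0 add0r.
apply: (exp_homotopic cg) => y; move: y; apply: torus_eq => x t.
rewrite torus_exp_proj gE /th /=.
have -> : (delta T h x : int) = (h x : int) - (hT x : int) by [].
rewrite add0r intrB.
rewrite -[LHS]subr0 -(circle_exp_int R (h x)) -circle_expB; congr circle_exp.
by ring.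
Qed.

(** If [exp (t f x)] is the exponential of a real function [th] on the torus,
    then [t f x - th (x, t)] is an integer that does not depend on [t].  With
    [h x = - th (x, 0)] one gets
    [f x = th (x, 1) - th (x, 0) = th (T x, 0) - th (x, 0) = h x - h (T x)]. *)
Lemma torus_exp_inj (f : CZ) : homotopic (torus_exp R T f) 0 -> exists h, f = delta T h.
Proof.
move=> /(homotopic_exp torus_compact)[th cth e].
have ek x t : circle_exp (val t * (f x : int)%:~R - th (proj (x, t))) = 0 :> S1.
  by rewrite circle_expB -torus_exp_proj e add0r subrr.
have cF x : continuous (fun t : I => val t * (f x : int)%:~R - th (proj (x, t))).
  have c1 : continuous (fun t : I => (x, t)).
    have cc : continuous (fun _ : I => x) by exact: cst_continuous.
    have ci : continuous (@idfun I) by move=> s; exact: cvg_id.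
    by move=> s; exact: (cvg_pair (cc s) (ci s)).
  have c2 : continuous (fun t : I => th (proj (x, t))).
    move=> t; exact: (cvg_comp _ th (cvg_comp _ proj (c1 t) (@glue_continuous _)) (cth _)).
  have cc : continuous (fun _ : I => (f x : int)%:~R : R) by exact: cst_continuous.
  move=> t; exact: (cvgB (cvgM (@unit_val_continuous R t) (cc t)) (c2 t)).
have cst x := int_valued_constant (cF x) (fun t => circle_exp_eq0 (ek x t)) (I0 R) (I1 R).
pose G x := - th (proj (x, I0 R)).
have cG : continuous G.
  have cc : continuous (fun _ : X => I0 R) by exact: cst_continuous.
  have ci : continuous (@idfun X) by move=> s; exact: cvg_id.
  have c1 : continuous (fun x : X => (x, I0 R)) by move=> x; exact: (cvg_pair (ci x) (cc x)).
  have c2 : continuous (fun x => th (proj (x, I0 R))).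
    move=> x; exact: (cvg_comp _ th (cvg_comp _ proj (c1 x) (@glue_continuous _)) (cth _)).
  move=> x; exact: (cvgN (c2 x)).
have [h hE] : exists h : CZ, forall x, G x = (h x : int)%:~R.
  apply: int_valued_continuous => // x; apply: circle_exp_eq0.
  by have := ek x (I0 R); rewrite /= mul0r sub0r.
exists h; apply/continuousEP => x.
have -> : delta T h x = (h x : int) - (h (T x) : int) :> int by [].
apply/eqP; rewrite -(eqr_int R) intrB -!hE /G glue_ends.
by have := cst x; rewrite /= mul0r mul1r sub0r => ->; rewrite opprK subrK.
Qed.

(** On the cylinder the map is the exponential of a real function [th]; then
    [f x = th (x, 1) - th (T x, 0)] is an integer, and [th (x, t) - t f x]
    is a function on the torus. *)
Lemma torus_exp_surj (u : continuousType torus S1) : exists f : CZ, homotopic u (torus_exp R T f).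
Proof.
pose v : continuousType (X * I)%type S1 := u \o (mkcts glue_continuous : continuousType _ torus).
have vE x t : v (x, t) = u (proj (x, t)) by [].
have [th1 cth1 e1] := cylinder_exp_lift v cptX.
have c0 : continuous (fun x : X => (x, I0 R)).
  have cc : continuous (fun _ : X => I0 R) by exact: cst_continuous.
  have ci : continuous (@idfun X) by move=> s; exact: cvg_id.
  by move=> x; exact: (cvg_pair (ci x) (cc x)).
have c1 : continuous (fun x : X => (x, I1 R)).
  have cc : continuous (fun _ : X => I1 R) by exact: cst_continuous.
  have ci : continuous (@idfun X) by move=> s; exact: cvg_id.
  by move=> x; exact: (cvg_pair (ci x) (cc x)).
have [th0 cth0 e0] := exp_lift (v \o (mkcts c0 : continuousType X (X * I)%type)).
pose th z := th0 z.1 + th1 z.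
have cth : continuous th.
  have h0 : continuous (fun z : X * I => th0 z.1).
    move=> z; exact: (cvg_comp _ th0 (@cylinder_fst_continuous z) (cth0 z.1)).
  move=> z; exact: (cvgD (h0 z) (cth1 z)).
have e z : v z = circle_exp (th z).
  case: z => x t; rewrite e1 circle_expD; congr (_ + _).
  by rewrite -e0.
have [f fE] : exists f : CZ, forall x, th (x, I1 R) - th (T x, I0 R) = (f x : int)%:~R.
  have h1 : continuous (fun x => th (x, I1 R)).
    move=> x; exact: (cvg_comp _ th (c1 x) (cth _)).
  have h0 : continuous (fun x => th (T x, I0 R)).
    move=> x; exact: (cvg_comp _ th (cvg_comp T _ (@cts_fun _ _ T x) (c0 (T x))) (cth _)).
  apply: int_valued_continuous => [x|x]; first exact: (cvgB (h1 x) (h0 x)).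
  by apply: circle_exp_eq0; rewrite circle_expB -!e !vE glue_ends subrr.
exists f; pose k (z : X * I) := th z - val z.2 * (f z.1 : int)%:~R.
have ck : continuous k.
  have ci : continuous (@idfun R) by move=> t; exact: cvg_id.
  have h2 := cylinder_scale_continuous (f := f) ci.
  move=> z; exact: (cvgB (cth z) (h2 z)).
have [|g cg gE] := torus_descend ck.
  move=> x; rewrite -[LHS]/(th (T x, I0 R) - 0 * (f (T x) : int)%:~R).
  by rewrite -[RHS]/(th (x, I1 R) - 1 * (f x : int)%:~R) mul0r mul1r subr0 -fE subKr.
apply: (exp_homotopic cg) => y; move: y; apply: torus_eq => x t.
by rewrite torus_exp_proj gE -circle_expD /k /= addrC subrK -e vE.
Qed.

(** ** The isomorphism *)

Definition torus_class (c : coinvariants T) : H1 R torus :=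
  \pi_(H1 R torus) (torus_exp R T (repr c)).

Lemma torus_expB (f g : CZ) : torus_exp R T (f - g) = torus_exp R T f - torus_exp R T g.
Proof.
apply/continuousEP; apply: torus_eq => x t.
have -> : (torus_exp R T f - torus_exp R T g) (proj (x, t)) =
  torus_exp R T f (proj (x, t)) - torus_exp R T g (proj (x, t)) by [].
rewrite !torus_exp_proj -circle_expB -mulrBr -intrB.
by [].
Qed.

Lemma H1_eq (u v : continuousType torus S1) :
  (\pi_(H1 R torus) u = \pi_(H1 R torus) v) <-> homotopic u v.
Proof. by split=> [/eqP|h]; [rewrite piE|apply/eqP; rewrite piE]. Qed.

Lemma coinvariants_eq (f g : CZ) :
  (\pi_(coinvariants T) f = \pi_(coinvariants T) g) <-> exists h, f - g = delta T h.
Proof.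
split=> [/eqP|[h e]].
  by rewrite -Quotient.idealrBE => /asboolP.
by apply/eqP; rewrite -Quotient.idealrBE; apply/asboolP; exists h.
Qed.

Lemma homotopicB (u v : continuousType torus S1) : homotopic u v <-> homotopic (u - v) 0.
Proof.
split=> h; first by have := homotopicD h (homotopicxx (- v)); rewrite subrr.
by have := homotopicD h (homotopicxx v); rewrite subrK add0r.
Qed.

Lemma torus_class_eq (f g : CZ) : \pi_(coinvariants T) f = \pi_(coinvariants T) g <->
  \pi_(H1 R torus) (torus_exp R T f) = \pi_(H1 R torus) (torus_exp R T g).
Proof.
rewrite coinvariants_eq H1_eq homotopicB -torus_expB; split=> [[h ->]|].
  exact: torus_exp_coboundary.
exact: torus_exp_inj.
Qed.

Lemma torus_class_pi (f : CZ) :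
  torus_class (\pi_(coinvariants T) f) = \pi_(H1 R torus) (torus_exp R T f).
Proof. by apply/torus_class_eq; rewrite reprK. Qed.

Lemma torus_class_additive : zmod_morphism torus_class.
Proof.
elim/quotW=> f; elim/quotW=> g.
have -> : \pi_(coinvariants T) f - \pi_(coinvariants T) g = \pi_(coinvariants T) (f - g).
  by rewrite raddfB.
rewrite !torus_class_pi torus_expB.
by rewrite -[RHS]/(H1_add _ (H1_opp _)) H1_opp_pi H1_add_pi.
Qed.

Lemma torus_class_bij : bijective torus_class.
Proof.
have inj : injective torus_class.
  elim/quotW=> f; elim/quotW=> g; rewrite !torus_class_pi.
  by move=> /torus_class_eq.
have surj : forall y, exists c, torus_class c = y.
  elim/quotW=> u; have [f uf] := torus_exp_surj u.
  by exists (\pi_(coinvariants T) f); rewrite torus_class_pi; apply/esym/H1_eq.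
have [s sE] := choice surj.
by exists s => // c; apply: inj; rewrite sE.
Qed.

Lemma torus_class_iso : exists phi : {additive coinvariants T -> H1 R torus},
  (forall f : CZ, phi (\pi_(coinvariants T) f) = \pi_(H1 R torus) (torus_exp R T f)) /\
  bijective phi.
Proof.
pose phi : {additive coinvariants T -> H1 R torus} :=
  HB.pack torus_class (GRing.isZmodMorphism.Build _ _ torus_class torus_class_additive).
by exists phi; split; [exact: torus_class_pi|exact: torus_class_bij].
Qed.

End TorusCohomology.

(** * The space of walks *)

Section WalkSpace.
Variables (E : choiceType) (adm : rel E).
Hypothesis finE : finite_set [set: E].
Local Notation full := {ptws int -> discrete_topology E}.
Local Notation W := (walks adm).

Lemma full_nbhs_coord (w : full) k : \forall w' \near w, w' k = w k.
Proof.
exact: (@proj_continuous int (fun=> discrete_topology E) k w _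
  (@discrete_set1 (discrete_topology E) (w k))).
Qed.

Lemma full_nbhs_window (w : full) (A : set full) : nbhs w A ->
  exists N : nat, forall w' : full, (forall k, (`|k| <= N)%N -> w' k = w k) -> A w'.
Proof.
move=> wA; pose F := filter_from [set: nat]
  (fun N => [set w' : full | forall k, (`|k| <= N)%N -> w' k = w k]).
have FF : Filter F.
  apply: filter_from_filter; first by exists 0%N.
  move=> i j _ _; exists (maxn i j) => // w' h; split=> k ki; apply: h.
    exact: leq_trans ki (leq_maxl _ _).
  exact: leq_trans ki (leq_maxr _ _).
suff : F --> w by move=> /(_ A wA)[N _ h]; exists N.
apply/cvg_sup => k B [C [[D oD <-] Dw] CB].
exists `|k|%N => // w' h; apply: CB.
by rewrite /= h.
Qed.

Lemma full_compact : compact [set: full].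
Proof.
have := @tychonoff int (fun=> discrete_topology E) (fun=> setT)
  (fun=> @finite_compact (discrete_topology E) setT finE).
by congr (compact _); apply/seteqP; split.
Qed.

Lemma walk_set_closed : closed (walk_set adm).
Proof.
move=> w cw k.
have nb : nbhs w [set w' : full | w' k = w k /\ w' (k + 1) = w (k + 1)].
  by apply: filterI; exact: full_nbhs_coord.
have [w' [aw' [e1 e2]]] := cw _ nb.
by rewrite -e1 -e2; exact: aw'.
Qed.

Lemma walks_compact : compact [set: W].
Proof.
move=> F FF _; have cw : compact (walk_set adm).
  by apply: (subclosed_compact walk_set_closed full_compact).
pose v : W -> full := val.
have vF : (v @ F) (walk_set adm).
  suff : F (v @^-1` walk_set adm) by [].
  have FT : F setT by exact: filterT.
  by apply: filterS FT => w _; have /set_mem := valP w.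
have [p [wp cl]] := cw (v @ F) _ vF.
pose q : W := exist (fun u => u \in walk_set adm) p (mem_set wp).
exists q; split=> // A B FA [C [[D oD <-] Dq] CB].
have vFA : (v @ F) (v @` A).
  suff : F (v @^-1` (v @` A)) by [].
  by apply: filterS FA => w Aw; exists w.
have [_ [[w Aw <-] Dw]] := cl _ _ vFA (open_nbhs_nbhs (conj oD Dq)).
by exists w; split=> //; exact: CB.
Qed.

(** ** Windows *)

Definition agree (a b : int) (x y : W) : Prop :=
  forall k, a <= k <= b -> val x k = val y k.

Lemma walk_near_window (x : W) (N : nat) : \forall y \near x, agree (- N%:Z) N%:Z y x.
Proof.
have cv : continuous (val : W -> full) by exact: (@initial_continuous _ _ set_val).
have co k : \forall y \near x, val y k = val x k by exact: cv (full_nbhs_coord (val x) k).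
elim: N => [|N IH].
  apply: filterS (co 0) => y e k /andP[k0 k1].
  by have -> : k = 0 by lia.
near=> y => k /andP[k0 k1].
have [->|kN] := eqVneq k N.+1%:Z; first by near: y; exact: co.
have [->|kN'] := eqVneq k (- N.+1%:Z); first by near: y; exact: co.
by apply: (near IH y) => //; lia.
Unshelve. all: by end_near. Qed.

Lemma walk_nbhs_window (x : W) (A : set W) : nbhs x A ->
  exists N : nat, forall y, agree (- N%:Z) N%:Z y x -> A y.
Proof.
move=> [C [[D oD <-] Dx] CA].
have [N h] := full_nbhs_window (open_nbhs_nbhs (conj oD Dx)).
by exists N => y e; apply: CA; apply: h => k kN; apply: e; lia.
Qed.

(** A continuous relation that holds near the diagonal holds as soon as two
    walks agree on a large enough window. *)
Lemma uniform_window (P : W -> W -> Prop) :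
  (forall x : W, exists2 A : set W, nbhs x A & forall y z, A y -> A z -> P y z) ->
  exists N : nat, forall x y, agree (- N%:Z) N%:Z x y -> P x y.
Proof.
move=> loc; pose Q (N : nat) (x : W) := forall y, agree (- N%:Z) N%:Z x y -> P x y.
have h x : [set: W] x -> \forall x' \near x & N \near \oo, Q N x'.
  move=> _; have [A xA hA] := loc x; have [N hN] := walk_nbhs_window xA.
  exists ([set y | agree (- N%:Z) N%:Z y x], [set M | (N <= M)%N]).
    by split; [exact: walk_near_window|exists N].
  move=> [y M] [/= yx NM] z yz; apply: hA; apply: hN => // k kN.
  by rewrite -yx//; apply/esym/yz; lia.
have [N _ hN] := (compact_near_coveringP _).1 walks_compact _ _ Q (eventually_filter) h.
by exists N => x y xy; apply: (hN N (leqnn N) x) => //.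
Qed.

Lemma window_continuous (Z : topologicalType) (f : W -> Z) (N : nat) :
  (forall x y, agree (- N%:Z) N%:Z x y -> f x = f y) -> continuous f.
Proof.
move=> h x A /nbhs_singleton Ax; apply: filterS (walk_near_window x N) => y yx.
by rewrite /= (h _ _ yx).
Qed.

Lemma locally_constant_window (f : continuousType W intd) :
  exists N : nat, forall x y, agree (- N%:Z) N%:Z x y -> f x = f y.
Proof.
apply: (uniform_window (P := fun x y => f x = f y)) => x.
exists (f @^-1` [set f x]); last by move=> y z -> ->.
apply: (@cts_fun _ _ f x); exact: (@discrete_set1 (discrete_topology int)).
Qed.

(** A map to the circle varies little on the walks with the same large
    window; on these the logarithm corrects the value at one of them. *)
Lemma walks_exp_lift (R : realType) (u : continuousType W (circle R)) :
  exists2 th : W -> R, continuous th & forall x, u x = circle_exp (th x).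
Proof.
have [[x0 _]|empty] := pselect ([set: W] !=set0); last first.
  by exists (fun=> 0) => [x|x]; case: empty; exists x.
have cd : continuous (fun z : W * W => u z.1 - u z.2).
  have cf : continuous (fun z : W * W => u z.1).
    move=> z; apply: (@continuous_comp _ _ _ fst u); [exact: cvg_fst|exact: cts_fun].
  have cs : continuous (fun z : W * W => u z.2).
    move=> z; apply: (@continuous_comp _ _ _ snd u); [exact: cvg_snd|exact: cts_fun].
  exact: (@cts_fun _ _ ((mkcts cf : continuousType _ (circle R)) - (mkcts cs : continuousType _ (circle R)))).
have [N hN] : exists N : nat, forall x y, agree (- N%:Z) N%:Z x y -> 0 < (val (u x - u y)).1.
  apply: (uniform_window (P := fun x y => 0 < (val (u x - u y)).1)) => x.
  have cD : (val (u z.1 - u z.2)).1 @[z --> (x, x)] --> (val (u x - u x)).1.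
    exact: (cvg_comp _ _ (cd (x, x)) (@circle_fst_continuous R _)).
  have D0 : 0 < (val (u x - u x)).1 by rewrite subrr /= ltr01.
  have [[A B] [xA xB] AB] := cvgr_gt _ cD _ D0.
  exists (A `&` B); first exact: filterI.
  by move=> y z [Ay By] [Az Bz]; apply: (AB (y, z)).
pose rho (x : W) : W := xget x0 [set y | agree (- N%:Z) N%:Z x y].
have rhoP x : agree (- N%:Z) N%:Z x (rho x).
  by apply: (@xgetPex _ x0 [set y | agree (- N%:Z) N%:Z x y]); exists x.
have rho_eq x y : agree (- N%:Z) N%:Z x y -> rho x = rho y.
  move=> xy; congr xget; apply/seteqP; split=> z xz k kN; first by rewrite -xy// xz.
  by rewrite xy// xz.
have [a aE] := choice (fun x => circle_exp_surj (u x)).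
exists (fun x => a (rho x) + circle_log (u x - u (rho x))); last first.
  by move=> x; rewrite circle_expD aE circle_logK ?(hN _ _ (rhoP x))// addrC subrK.
move=> x; set r := rho x.
pose g y := a r + circle_log (u y - u r).
have cg : g y @[y --> x] --> g x.
  have cu : continuous (fun y => u y - u r).
    have cr : continuous (cst (u r) : W -> circle R) by exact: cst_continuous.
    exact: (@cts_fun _ _ (u - (mkcts cr : continuousType W (circle R)))).
  have cl := circle_log_continuous (hN _ _ (rhoP x)).
  have h : circle_log (u y - u r) @[y --> x] --> circle_log (u x - u r).
    exact: (cvg_comp _ _ (cu x) cl).
  have hc : (fun _ : W => a r) y @[y --> x] --> a r by exact: (@cst_continuous W R (a r) x).
  exact: (cvgD hc h).
move=> A /cg gA; apply: filterS2 (walk_near_window x N) gA => y yx.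
by rewrite /= (rho_eq _ _ yx).
Qed.

End WalkSpace.

(** * Windows of letters and coboundaries *)

Section Windows.
Variables (E : choiceType) (adm : rel E).
Hypothesis has_succ : forall e, exists e', adm e e'.
Hypothesis has_pred : forall e, exists e', adm e' e.
Local Notation W := (walks adm).
Local Notation T := (walk_shift adm).

Lemma walkP (x : W) k : adm (val x k) (val x (k + 1)).
Proof. by have /set_mem := valP x; apply. Qed.

Definition walk_of (w : {ptws int -> discrete_topology E}) (h : walk_set adm w) : W :=
  exist (fun u => u \in walk_set adm) w (mem_set h).

Lemma walk_splice (x y : W) b : val x b = val y b ->
  exists z : W, (forall k, k <= b -> val z k = val x k) /\ (forall k, b <= k -> val z k = val y k).
Proof.
move=> e; pose z (k : int) := if k <= b then val x k else val y k.
have hz : walk_set adm z.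
  move=> k; rewrite /z; case: (ltgtP k b) => kb.
  - by have -> : k + 1 <= b by [lia]; exact: walkP.
  - by have -> : (k + 1 <= b) = false by [lia]; exact: walkP.
  - by have -> : (k + 1 <= b) = false by [lia]; rewrite kb e; exact: walkP.
exists (walk_of hz); split=> k kb; rewrite /= /z ?kb//.
by case: leP => // kb'; have -> : k = b by lia.
Qed.

Lemma walk_extend e0 (s : seq E) : (0 < size s)%N -> sorted adm s ->
  exists x : W, forall i, (i < size s)%N -> val x i%:Z = nth e0 s i.
Proof.
move=> s0 /(sortedP e0) ss.
have [sc scP] := choice has_succ; have [pr prP] := choice has_pred.
pose z (k : int) := match k with
  | Posz i => if (i < size s)%N then nth e0 s i else iter (i - (size s).-1) sc (last e0 s)
  | Negz i => iter i.+1 pr (nth e0 s 0) end.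
have hz : walk_set adm z.
  case=> [i|[|i]].
  - have -> : i%:Z + 1 = i.+1%:Z by lia.
    rewrite /z; case: (ltnP i.+1 (size s)) => is1.
      by rewrite (ltn_trans _ is1)//; exact: ss.
    have -> : (i.+1 - (size s).-1)%N = (i - (size s).-1).+1 by lia.
    rewrite iterS; case: ltnP => is2; last exact: scP.
    have ei : i = (size s).-1 by lia.
    by rewrite ei nth_last subnn; exact: scP.
  - have -> : Negz 0 + 1 = 0%:Z by [].
    by rewrite /z s0; exact: prP.
  - have -> : Negz i.+1 + 1 = Negz i by rewrite !NegzE; lia.
    by rewrite /z [iter i.+2 _ _]iterS; exact: prP.
by exists (walk_of hz) => i si; rewrite /= si.
Qed.

Lemma shiftE (x : W) k : val (T x) k = val x (k + 1). Proof. by []. Qed.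

Lemma unshift (x : W) : exists y, T y = x.
Proof.
have h : walk_set adm (fun k => val x (k - 1)).
  by move=> k; rewrite addrAC; exact: walkP.
by exists (walk_of h); apply: val_inj; apply/funext => k; rewrite shiftE /= addrK.
Qed.

(** As congruence modulo 0 is equality, [depends 0 a b h] says that [h] is a
    function of the letters at the places [a, ..., b].  The other moduli occur
    in the proof that the coinvariants are torsion free. *)
Definition depends (m : int) (a b : int) (h : W -> int) : Prop :=
  forall x y, agree a b x y -> (m %| h x - h y)%Z.

Lemma dependsW m a b a' b' h : a' <= a -> b <= b' -> depends m a b h -> depends m a' b' h.
Proof. by move=> aa bb hd x y xy; apply: hd => k kab; apply: xy; lia. Qed.

Lemma dvdz_trans_sub m (u v w : int) : (m %| u - v)%Z -> (m %| v - w)%Z -> (m %| u - w)%Z.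
Proof.
move=> uv vw; have -> : u - w = (u - v) + (v - w) by ring.
exact: rpredD.
Qed.

Lemma depends_shift m a b h : depends m a b h <-> depends m (a + 1) (b + 1) (h \o T).
Proof.
split=> hd x y xy.
  by apply: hd => k kab; rewrite !shiftE; apply: xy; lia.
have [[x' ex] [y' ey]] := (unshift x, unshift y); rewrite -ex -ey in xy *.
apply: (hd x' y') => k kab.
by have := xy (k - 1); rewrite !shiftE subrK; apply; lia.
Qed.

(** Two walks that agree on the common part of two windows are joined by a
    walk that agrees with the one on the first window and with the other on
    the second. *)
Lemma depends_inter m a b a' b' h : a <= a' -> a' <= b -> b <= b' ->
  depends m a b h -> depends m a' b' h -> depends m a' b h.
Proof.
move=> aa ab bb h1 h2 x y xy.
have [z [zx zy]] := walk_splice (xy b ltac:(lia)).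
apply: (@dvdz_trans_sub _ _ (h z)).
  by apply: h1 => k kab; rewrite zx//; lia.
apply: h2 => k kab; case: (leP b k) => kb; first by rewrite zy.
by rewrite zx ?xy//; lia.
Qed.

(** If [h - h \o T] depends on the letters from 0 to [n] only, then the window
    of [h] shrinks to [0, n - 1]: were its last place beyond, it would not be
    seen by [h \o T], and likewise for the first place. *)
Lemma depends_coboundary (m : int) (n : nat) (f h : W -> int) (a b : int) : (0 < n)%N ->
  depends m 0 n%:Z f -> (forall x, (m %| h x - h (T x) - f x)%Z) ->
  depends m a b h -> depends m 0 (n%:Z - 1) h.
Proof.
move=> n0 df hf dh.
have dT (a' b' : int) : a' <= 0 -> n%:Z <= b' -> depends m a' b' h -> depends m a' b' (h \o T).
  move=> a0 bn dh' x y xy /=.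
  have d1 := dh' _ _ xy; have d2 := dependsW a0 bn df xy.
  have -> : h (T x) - h (T y) = (h x - h y) - (h x - h (T x) - f x)
    + (h y - h (T y) - f y) - (f x - f y) by ring.
  exact: rpredB (rpredD (rpredB d1 (hf x)) (hf y)) d2.
have d0 (a' b' : int) : a' <= 0 -> n%:Z <= b' -> depends m a' b' (h \o T) -> depends m a' b' h.
  move=> a0 bn dh' x y xy /=.
  have d1 := dh' _ _ xy; have d2 := dependsW a0 bn df xy.
  have -> : h x - h y = (h (T x) - h (T y)) + (h x - h (T x) - f x)
    - (h y - h (T y) - f y) + (f x - f y) by ring.
  exact: rpredD (rpredB (rpredD d1 (hf x)) (hf y)) d2.
have right (j : nat) (a' : int) : a' <= 0 -> depends m a' (n%:Z - 1 + j%:Z) h ->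
    depends m a' (n%:Z - 1) h.
  move=> a0; elim: j => [|j IH]; first by rewrite addr0.
  move=> dj; apply: IH.
  have e : n%:Z - 1 + j%:Z + 1 = n%:Z - 1 + j.+1%:Z by lia.
  apply: (depends_shift _ _ _ _).2; rewrite e.
  apply: (@depends_inter _ a' _ _ (n%:Z - 1 + j.+1%:Z + 1)); [lia|lia|lia|..].
    by apply: dT => //; lia.
  exact: (depends_shift m a' (n%:Z - 1 + j.+1%:Z) h).1 dj.
have left (j : nat) : depends m (- j%:Z) (n%:Z - 1) h -> depends m 0 (n%:Z - 1) h.
  elim: j => [|j IH]; first by rewrite oppr0.
  move=> dj; apply: IH.
  apply: (@depends_inter _ (- j.+1%:Z) _ _ n%:Z); [lia|lia|lia|exact: dj|].
  apply: d0; [lia|lia|].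
  have -> : - j%:Z = - j.+1%:Z + 1 by lia.
  by rewrite -[n%:Z](subrK 1); exact: (depends_shift _ _ _ _).1 dj.
pose i := absz a; pose j := absz (b - (n%:Z - 1))%R.
apply: (left i); apply: (right j); first by rewrite /i; lia.
by apply: dependsW dh; lia.
Qed.

End Windows.

(** * Free quotients of free modules of finite rank *)

Lemma row_mulrz n (v : 'rV[int]_n) (z : int) : v *~ z = z *: v.
Proof. by rewrite -[z in RHS]intz scaler_int. Qed.

Section FreeCokernel.
Variables (V : zmodType) (k N : nat) (phi : {additive 'rV[int]_N -> V}).
Variable M : 'M[int]_(k.+1, N).
Hypothesis phi_ker : forall c, phi c = 0 <-> exists y, c = y *m M.
Hypothesis M_ker : forall y : 'rV_k.+1, y *m M = 0 <-> exists t, y = const_mx t.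
Hypothesis phi_torsion : forall c (m : int), m != 0 -> phi (c *~ m) = 0 -> phi c = 0.

(** In bases adapted to [M] (Smith normal form), the image of [M] is spanned by
    multiples [d_j e_j] of the first basis vectors.  The kernel of [M] being of
    rank 1, all the [d_j] but the last one are nonzero, and they are units as
    there is no torsion; the other basis vectors form a basis of the
    quotient. *)
Lemma free_cokernel : (k <= N)%N /\ free_submodule (N - k) (range phi).
Proof.
have [L uL [Q uQ [d sd MLDQ]]] := int_Smith_normal_form M.
set D := (X in L *m X *m Q) in MLDQ.
have eD (i : 'I_k.+1) : (delta_mx 0 i : 'rV_k.+1) *m D = 0 <-> forall j : 'I_N, i = j :> nat -> d`_i = 0.
  rewrite -rowE; split=> [/rowP h j ij|h].
    by have := h j; rewrite !mxE ij eqxx mulr1n.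
  by apply/rowP => j; rewrite !mxE; case: eqP => // ij; rewrite mulr1n (h j).
have kerD (y : 'rV_k.+1) : y *m D = 0 <-> exists t, y *m invmx L = const_mx t.
  rewrite -M_ker MLDQ !mulmxA mulmxKV//; split=> [->|h]; first by rewrite mul0mx.
  by rewrite -[y *m D](mulmxK uQ) h mul0mx.
have uniq_zero (i j : 'I_k.+1) : (delta_mx 0 i : 'rV_k.+1) *m D = 0 ->
    (delta_mx 0 j : 'rV_k.+1) *m D = 0 -> i = j.
  move=> /kerD[t et] /kerD[s es]; apply/eqP; apply: contraT => ij.
  have e : s *: (delta_mx 0 i : 'rV[int]_k.+1) = t *: delta_mx 0 j.
    rewrite -[LHS](mulmxKV uL) -[RHS](mulmxKV uL) -!scalemxAl et es !scalemxAl.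
    have -> : s *: const_mx t = t *: const_mx s :> 'rV[int]_k.+1.
      by apply/rowP => l; rewrite !mxE mulrC.
    by [].
  have /rowP/(_ j) := e; rewrite !mxE !eqxx /= eq_sym (negPf ij) mulr0 mulr1 => t0.
  have e0 : (delta_mx 0 i : 'rV[int]_k.+1) = 0.
    rewrite -[LHS](mulmxKV uL) et -t0.
    have -> : const_mx 0 = 0 :> 'rV[int]_k.+1 by apply/rowP => l; rewrite !mxE.
    by rewrite mul0mx.
  by have /rowP/(_ i) := e0; rewrite !mxE !eqxx.
have [i0 i0D] : exists i0 : 'I_k.+1, (delta_mx 0 i0 : 'rV_k.+1) *m D = 0.
  pose y : 'rV[int]_k.+1 := const_mx 1.
  have yM : y *m L *m D = 0.
    by apply/kerD; exists 1; rewrite mulmxK.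
  have /rV0Pn[i yi] : y *m L != 0.
    apply/eqP => yL; have := mulmxK uL y; rewrite yL mul0mx => /rowP/(_ 0).
    by rewrite !mxE.
  exists i; apply/eD => j ij; have /rowP/(_ j) := yM; rewrite mxE (bigD1 i)//=.
  rewrite big1 => [|l li]; last first.
    rewrite [D _ _]mxE; case: eqP => [lj|]; last by rewrite mulr0n mulr0.
    by case/eqP: li; apply: val_inj; rewrite /= lj ij.
  rewrite addr0 [D _ _]mxE ij eqxx mulr1n [RHS]mxE => /eqP.
  by rewrite mulf_eq0 (negPf yi) -ij => /eqP.
(* the zero comes last, as each entry divides the next one *)
have d_last (i j : nat) : (i <= j)%N -> d`_i = 0 -> d`_j = 0.
  move=> ij di; have [sj|js] := leqP (size d) j; first by rewrite nth_default.
  have := sorted_leq_nth dvdz_trans dvdzz 0 sd; move=> /(_ i j).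
  by rewrite !inE js (leq_ltn_trans ij js) => /(_ isT isT ij); rewrite di dvd0z => /eqP.
have i0k : i0 = ord_max.
  apply: uniq_zero => //; apply/eD => j kj.
  apply: (d_last i0 k); first by rewrite -ltnS.
  have i0N : (i0 < N)%N by apply: leq_ltn_trans (ltn_ord j); rewrite -kj -ltnS.
  by move/eD: i0D => /(_ (Ordinal i0N)); apply.
have small (i : nat) : (i < k)%N -> (i < N)%N /\ d`_i != 0.
  move=> ik; have ik' : (i < k.+1)%N by exact: ltnW.
  have nz : (delta_mx 0 (Ordinal ik') : 'rV_k.+1) *m D <> 0.
    by move=> h; have := uniq_zero _ _ h i0D; rewrite i0k => /(congr1 val) /= e; rewrite e ltnn in ik.
  split.
    rewrite ltnNge; apply/negP => Ni; apply: nz; apply/eD => j /= ij.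
    by have := ltn_ord j; rewrite -ij ltnNge Ni.
  by apply/eqP => di; apply: nz; apply/eD.
have large (j : nat) : (k <= j)%N -> (j < N)%N -> d`_j = 0.
  move=> kj jN; apply: (d_last _ _ kj).
  have kN : (k < N)%N by exact: leq_ltn_trans jN.
  by have := (eD i0).1 i0D (Ordinal kN); rewrite i0k; apply.
have kN : (k <= N)%N.
  by case: (k) small => // k' /(_ k' (ltnSn _))[].
split=> //.
have ltN (i : 'I_(N - k)) : (k + i < N)%N by rewrite -ltn_subRL.
pose e (j : 'I_N) : 'rV[int]_N := delta_mx 0 j *m Q.
exists (fun i => phi (e (Ordinal (ltN i)))).
have phi_small (j : 'I_N) : (j < k)%N -> phi (e j) = 0.
  move=> jk; have [_ dj] := small _ jk; apply: (phi_torsion dj).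
  apply/phi_ker.
  have jk' : (j < k.+1)%N by exact: ltnW.
  exists (delta_mx 0 (Ordinal jk') *m invmx L).
  rewrite MLDQ !mulmxA mulmxKV//.
  rewrite row_mulrz /e scalemxAl; congr (_ *m Q).
  apply/rowP => l; rewrite -rowE !mxE /=.
  have -> : (l == j) = (j == l :> nat) by rewrite eq_sym.
  by case: (_ == _ :> nat); rewrite ?mulr1 ?mulr0.
have phi_sum (c : 'rV[int]_N) : phi c = \sum_(i < N - k) phi (e (Ordinal (ltN i))) *~ (c *m invmx Q) 0 (Ordinal (ltN i)).
  have {1}-> : c = \sum_j e j *~ (c *m invmx Q) 0 j.
    rewrite -[LHS](mulmxKV uQ) {1}(row_sum_delta (c *m invmx Q)) mulmx_suml.
    by apply: eq_bigr => j _; rewrite row_mulrz scalemxAl.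
  rewrite raddf_sum (bigID (fun j : 'I_N => (j < k)%N))/= big1 ?add0r; last first.
    by move=> j jk; rewrite raddfMz phi_small ?mul0rz.
  pose h (i : 'I_(N - k)) : 'I_N := Ordinal (ltN i).
  rewrite (reindex_omap h (fun j : 'I_N => insub (j - k)%N)); last first.
    move=> j; rewrite -leqNgt => kj; have jk : (j - k < N - k)%N by rewrite ltn_sub2r// (leq_ltn_trans kj).
    by rewrite insubT /=; congr Some; apply: val_inj; rewrite /= subnKC.
  apply: eq_big => [i|i _]; last by rewrite raddfMz.
  rewrite /= -leqNgt leq_addr /= addKn; apply/eqP.
  by rewrite insubT //= => ?; congr Some; exact: val_inj.
split.
  move=> x; split=> [[c _ <-]|[c ->]].
    by exists (fun i => (c *m invmx Q) 0 (Ordinal (ltN i))); exact: phi_sum.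
  exists (\sum_i e (Ordinal (ltN i)) *~ c i) => //.
  by rewrite raddf_sum; apply: eq_bigr => i _; rewrite raddfMz.
move=> c c0 i.
have : phi (\sum_i e (Ordinal (ltN i)) *~ c i) = 0.
  by rewrite raddf_sum -[RHS]c0; apply: eq_bigr => l _; rewrite raddfMz.
move=> /phi_ker[y ey].
have : (\sum_i e (Ordinal (ltN i)) *~ c i) *m invmx Q = y *m L *m D.
  by rewrite ey MLDQ !mulmxA mulmxK.
move=> /rowP/(_ (Ordinal (ltN i))).
have -> : (y *m L *m D) 0 (Ordinal (ltN i)) = 0.
  rewrite mxE big1// => l _; rewrite [D _ _]mxE; case: eqP => [li|]; last by rewrite mulr0n mulr0.
  by rewrite /= in li; rewrite mulr1n li large ?leq_addr ?mulr0.
rewrite mulmx_suml summxE (bigD1 i)//= big1 => [|l li].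
  rewrite addr0 row_mulrz /e -scalemxAl mulmxK// !mxE !eqxx mulr1 => ->//.
rewrite row_mulrz /e -scalemxAl mulmxK// !mxE eqxx /= -val_eqE /= eqn_add2l val_eqE.
by rewrite eq_sym (negPf li) mulr0.
Qed.

End FreeCokernel.

Lemma free_cokernel_pos (V : zmodType) (k N : nat) (phi : {additive 'rV[int]_N -> V})
    (M : 'M[int]_(k, N)) : (0 < k)%N ->
  (forall c, phi c = 0 <-> exists y, c = y *m M) ->
  (forall y : 'rV_k, y *m M = 0 <-> exists t, y = const_mx t) ->
  (forall c (m : int), m != 0 -> phi (c *~ m) = 0 -> phi c = 0) ->
  exists2 r : nat, r%:Z = N%:Z - k%:Z + 1 & free_submodule r (range phi).
Proof.
case: k M => // k M _ h1 h2 h3; have [kN fr] := free_cokernel h1 h2 h3.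
by exists (N - k)%N => //; lia.
Qed.

Section SubBasis.
Variable V : zmodType.

Lemma free_submodule_sub (r s : nat) (F : set V) : (s <= r)%N -> free_submodule r F ->
  exists F' : set V, [/\ F' `<=` F, free_submodule s F' & torsion_free_quotient F F'].
Proof.
move=> sr [b [bF bfree]]; pose w := widen_ord sr.
pose ext (c : 'I_s -> int) (i : 'I_r) : int := if insub (i : nat) is Some j then c j else 0.
have ext_w c j : ext c (w j) = c j.
  by rewrite /ext insubT //= => ?; congr c; exact: val_inj.
have ext_sum c : \sum_j b (w j) *~ c j = \sum_i b i *~ ext c i.
  rewrite [RHS](bigID (fun i : 'I_r => (i < s)%N))/= [X in _ + X]big1 ?addr0; last first.
    by move=> i si; rewrite /ext insubN.
  rewrite [RHS](reindex_omap w (fun i : 'I_r => insub (i : nat))); last first.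
    by move=> i si; rewrite insubT /=; congr Some; exact: val_inj.
  apply: eq_big => [j|j _]; last by rewrite ext_w.
  by rewrite /= ltn_ord insubT //= => ?; apply/esym/eqP; congr Some; exact: val_inj.
exists [set x | exists c : 'I_s -> int, x = \sum_j b (w j) *~ c j]; split.
- by move=> x [c ->]; apply/bF; exists (ext c); exact: ext_sum.
- exists (b \o w); split=> // c; rewrite ext_sum => /bfree c0 j.
  by rewrite -ext_w c0.
- move=> x m /bF[c ->] m0 [c' e].
  have z i : c i * m - ext c' i = 0.
    apply: (bfree (fun i => c i * m - ext c' i)).
    transitivity ((\sum_i b i *~ c i) *~ m - \sum_i b i *~ ext c' i).
      rewrite mulrz_suml -sumrB; apply: eq_bigr => l _.
      by rewrite mulrzBr mulrzA.
    by rewrite e ext_sum subrr.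
  exists (fun j => c (w j)); rewrite ext_sum; apply: eq_bigr => i _; congr (_ *~ _).
  rewrite /ext; case: insubP => [j _ ji|si]; first by congr c; apply: val_inj.
  have := z i; rewrite /ext insubN// subr0 => /eqP.
  by rewrite mulf_eq0 (negPf m0) orbF => /eqP.
Qed.

End SubBasis.

(** * Direct limits *)

Section DirectLimit.
Variables (V L : zmodType) (F : nat -> set V) (j : {additive V -> L}).
Hypotheses (F_mono : forall n, F n `<=` F n.+1) (F_all : forall x, exists n, F n x).
Hypothesis j_bij : bijective j.

Lemma union_direct_limit : is_direct_limit F j.
Proof.
move=> A h hD hS; have [i ji ij] := j_bij.
have FS m n x : F n x -> F (n + m)%N x /\ h (n + m)%N x = h n x.
  move=> Fx; elim: m => [|m [IH1 IH2]]; first by rewrite addn0.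
  by rewrite addnS hS//; split=> //; exact: F_mono.
have Fle m n x : (n <= m)%N -> F n x -> F m x /\ h m x = h n x.
  by move=> nm Fx; rewrite -(subnKC nm); exact: FS.
have [N NP] := choice F_all.
pose u0 y := h (N (i y)) (i y).
have u0E n x : F n x -> u0 (j x) = h n x.
  rewrite /u0 ji => Fx; have [_ <-] := Fle _ _ _ (leq_maxl n (N x)) Fx.
  by have [_ <-] := Fle _ _ _ (leq_maxr n (N x)) (NP x).
have u0B : zmod_morphism u0.
  move=> y z; rewrite -[y]ij -[z]ij -raddfB; move: (i y) (i z) => {y z} x y.
  pose n := maxn (N (x - y)) (maxn (N x) (N y)).
  have [F1 _] := Fle n _ _ (leq_maxl _ _) (NP (x - y)).
  have F2 : F n x by apply: (Fle _ (N x) _ _ (NP x)).1; rewrite /n; lia.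
  have F3 : F n y by apply: (Fle _ (N y) _ _ (NP y)).1; rewrite /n; lia.
  rewrite (u0E _ _ F1) (u0E _ _ F2) (u0E _ _ F3); apply/eqP.
  by rewrite eq_sym subr_eq -hD// subrK.
pose u : {additive L -> A} := HB.pack u0 (GRing.isZmodMorphism.Build L A u0 u0B).
exists u; split=> [n x Fx|u' u'E y]; first exact: u0E.
by rewrite -[y]ij; rewrite (u'E _ _ (NP _)) [RHS](u0E _ _ (NP _)).
Qed.

End DirectLimit.

(** * The filtration of the coinvariants *)

Section Filtration.
Variables (E : choiceType) (adm : rel E).
Hypothesis finE : finite_set [set: E].
Hypothesis two_succ : forall e, exists e1 e2, [/\ adm e e1, adm e e2 & e1 <> e2].
Hypothesis has_pred : forall e, exists e', adm e' e.
Hypothesis conn : forall c : E -> int,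
  (forall e e', adm e e' -> c e = c e') -> forall e e', c e = c e'.
Variable e0 : E.
Local Notation W := (walks adm).
Local Notation T := (walk_shift adm).
Local Notation CZ := (continuousType W intd).
Local Notation C_T := (coinvariants T).

Lemma has_succ e : exists e', adm e e'.
Proof. by have [e1 [_ [h _ _]]] := two_succ e; exists e1. Qed.

(** ** Words *)

Lemma words_finite l : finite_set (words adm l).
Proof.
elim: l => [|l IH].
  apply: (@sub_finite_set _ _ [set [::]]); last exact: finite_set1.
  by move=> s [/size0nil -> _].
apply: (@sub_finite_set _ _ [set p.1 :: p.2 | p in [set: E] `*` words adm l]).
  move=> [|e s] [//= [sl] ps]; exists (e, s) => //=; split=> //; split=> //.
  exact: path_sorted ps.
by apply: finite_image; exact: finite_setX.
Qed.

Let ws l : seq (seq E) := enum_fset (fset_set (words adm l)).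

Lemma mem_ws l s : (s \in ws l) = `[< words adm l s >].
Proof.
rewrite in_fset_set; last exact: words_finite.
by apply/idP/asboolP; rewrite inE.
Qed.

Lemma size_ws l : size (ws l) = nwords adm l.
Proof. by []. Qed.

Lemma uniq_ws l : uniq (ws l).
Proof. exact: fset_uniq. Qed.

Lemma nwords0 : nwords adm 0 = 1%N.
Proof.
rewrite /nwords; have -> : words adm 0 = [set [::]].
  by apply/seteqP; split=> [s [/size0nil]|s ->].
by rewrite fset_set1 cardfs1.
Qed.

(** The rank of the term of index 1 is at least that of the term of index 0,
    which can thus be spanned by part of a basis. *)
Lemma nwords_double : (nwords adm 1 + nwords adm 1 <= nwords adm 2)%N.
Proof.
have [s1 s1P] := choice two_succ; have [s2 s2P] := choice s1P.
pose w1 (s : seq E) := [:: head e0 s; s1 (head e0 s)].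
pose w2 (s : seq E) := [:: head e0 s; s2 (head e0 s)].
have h1 s : s \in ws 1 -> exists e, s = [:: e].
  by rewrite mem_ws => /asboolP[+ _]; case: s => [|e [|]]//; exists e.
have -> : (nwords adm 1 + nwords adm 1)%N = size (map w1 (ws 1) ++ map w2 (ws 1)).
  by rewrite size_cat !size_map.
rewrite -[nwords adm 2]size_ws; apply: uniq_leq_size.
  have u1 : uniq (map w1 (ws 1)).
    by rewrite map_inj_in_uniq ?uniq_ws// => s t /h1[e ->] /h1[e' ->] /= [->].
  have u2 : uniq (map w2 (ws 1)).
    by rewrite map_inj_in_uniq ?uniq_ws// => s t /h1[e ->] /h1[e' ->] /= [->].
  rewrite cat_uniq u1 u2 /= andbT.
  apply/hasPn => _ /mapP[s _ ->]; apply/negP => /mapP[t _ [e]].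
  by rewrite e => e'; have [_ _] := s2P (head e0 t); rewrite e'.
move=> s; rewrite mem_cat mem_ws => /orP[]/mapP[t _ ->]; apply/asboolP; split=> //=.
  by have [-> _ _] := s2P (head e0 t).
by have [_ -> _] := s2P (head e0 t).
Qed.

Definition window_word l (x : W) : seq E := mkseq (fun i => val x i%:Z) l.

Lemma window_word_mem l x : window_word l x \in ws l.
Proof.
rewrite mem_ws; apply/asboolP; split; first by rewrite size_mkseq.
apply/(sortedP e0) => i; rewrite size_mkseq => il.
rewrite !nth_mkseq//; last exact: ltnW.
by have -> : i.+1%:Z = i%:Z + 1 :> int by [lia]; exact: walkP.
Qed.

Definition word_index l (x : W) : 'I_(nwords adm l) :=
  Ordinal (etrans (index_mem _ _) (window_word_mem l x)).

Lemma word_index_eq l x y :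
  word_index l x = word_index l y <-> agree 0 (l%:Z - 1) x y.
Proof.
split=> [/(congr1 val)/= e k kl|xy].
  have : window_word l x = window_word l y.
    by rewrite -(nth_index [::] (window_word_mem l x)) e nth_index ?window_word_mem.
  move=> /(congr1 (fun s => nth e0 s `|k|%N)); rewrite !nth_mkseq; try lia.
  by have -> : `|k|%N%:Z = k by lia.
apply: val_inj => /=; suff -> : window_word l x = window_word l y by [].
apply: (@eq_from_nth _ e0) => [|i].
  by rewrite !size_mkseq.
by rewrite size_mkseq => il; rewrite !nth_mkseq// xy//; lia.
Qed.

Lemma word_index_surj l i : (0 < l)%N -> exists x, word_index l x = i.
Proof.
move=> l0; pose s := nth [::] (ws l) i.
have sw : s \in ws l by apply: mem_nth; rewrite size_ws.
have := sw; rewrite mem_ws => /asboolP[sl ss].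
have [x xs] := walk_extend has_succ has_pred e0 (etrans (congr1 _ sl) l0) ss.
exists x; apply: val_inj => /=.
have -> : window_word l x = s.
  apply: (@eq_from_nth _ e0); rewrite size_mkseq// => k kl.
  by rewrite nth_mkseq// xs// sl.
by rewrite index_uniq ?uniq_ws ?size_ws.
Qed.

(** ** Functions of finitely many letters *)

Lemma of_word_subproof l (c : 'rV[int]_(nwords adm l)) :
  continuous (fun x : W => c 0 (word_index l x) : intd).
Proof.
apply: (@window_continuous _ _ _ _ l) => x y xy.
by congr (c 0 _); apply/word_index_eq => k kl; apply: xy; lia.
Qed.

Definition of_word l (c : 'rV[int]_(nwords adm l)) : CZ := mkcts (@of_word_subproof l c).

Lemma of_wordE l (c : 'rV[int]_(nwords adm l)) x : (of_word c x : int) = c ord0 (word_index l x).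
Proof. by []. Qed.

Lemma ctsBE (f g : CZ) x : (f - g) x = (f x : int) - (g x : int) :> int.
Proof. by []. Qed.

Lemma ctsMzE (f : CZ) (m : int) x : (f *~ m) x = (f x : int) * m :> int.
Proof.
have h n : (f *+ n) x = (f x : int) * n%:Z :> int.
  elim: n => [|n IH]; first by rewrite mulr0.
  rewrite mulrS -[LHS]/((f x : int) + ((f *+ n) x : int)) IH; lia.
case: m => n; first exact: h.
by rewrite NegzE mulrNz -[LHS]/(- ((f *+ n.+1) x : int)) h mulrN.
Qed.

Lemma deltaE (h : CZ) x : delta T h x = (h x : int) - (h (T x) : int) :> int.
Proof. by []. Qed.

Lemma of_word_is_zmod l : zmod_morphism (@of_word l).
Proof.
move=> c c'; apply/continuousEP => x; rewrite [RHS]ctsBE !of_wordE.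
by rewrite !mxE.
Qed.

Lemma of_word_inj l : (0 < l)%N -> injective (@of_word l).
Proof.
move=> l0 c c' e; apply/rowP => i; have [x <-] := word_index_surj i l0.
by rewrite -!of_wordE e.
Qed.

Lemma of_word_depends l (c : 'rV[int]_(nwords adm l)) : depends 0 0 (l%:Z - 1) (of_word c).
Proof.
by move=> x y /word_index_eq xy; rewrite !of_wordE xy subrr dvdz0.
Qed.

Lemma depends_of_word l (f : CZ) : (0 < l)%N -> depends 0 0 (l%:Z - 1) f ->
  exists c : 'rV[int]_(nwords adm l), f = of_word c.
Proof.
move=> l0 df; have [x xE] := choice (fun i => word_index_surj i l0).
exists (\row_i f (x i)); apply/continuousEP => y.
have : agree 0 (l%:Z - 1) y (x (word_index l y)) by apply/word_index_eq; rewrite xE.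
by move=> /df; rewrite dvd0z subr_eq0 => /eqP e; rewrite [RHS]of_wordE mxE.
Qed.

Lemma coboundary_matrix l : exists M : 'M[int]_(nwords adm l, nwords adm l.+1),
  forall y, delta T (of_word y) = of_word (y *m M).
Proof.
have [x xE] := choice (fun i => @word_index_surj l.+1 i isT).
exists (\matrix_(i, j) ((i == word_index l (x j))%:R - (i == word_index l (T (x j)))%:R)) => y.
apply/continuousEP => z; rewrite [LHS]deltaE [RHS]of_wordE !of_wordE mxE.
pose w := x (word_index l.+1 z); have zw : agree 0 l%:Z z w.
  have : agree 0 (l.+1%:Z - 1) z w by apply/word_index_eq; rewrite /w xE.
  by move=> h k kl; apply: h; lia.
have e1 : word_index l z = word_index l w.
  by apply/word_index_eq => k kl; apply: zw; lia.
have e2 : word_index l (T z) = word_index l (T w).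
  by apply/word_index_eq => k kl; rewrite !shiftE; apply: zw; lia.
have pick (i0 : 'I_(nwords adm l)) : \sum_i y 0 i * (i == i0)%:R = y 0 i0.
  rewrite (bigD1 i0)//= eqxx mulr1 big1 ?addr0// => i /negPf->.
  by rewrite mulr0.
rewrite e1 e2 -!pick -sumrB; apply: eq_bigr => i _.
by rewrite mxE -/w mulrBr.
Qed.

(** ** The filtration *)

Definition word_class l (c : 'rV[int]_(nwords adm l)) : C_T := \pi_C_T (of_word c).

Lemma word_class_is_zmod l : zmod_morphism (@word_class l).
Proof. by move=> c c'; rewrite /word_class of_word_is_zmod raddfB. Qed.

HB.instance Definition _ l := GRing.isZmodMorphism.Build
  'rV[int]_(nwords adm l) C_T (@word_class l) (@word_class_is_zmod l).

Lemma class_eq0 (f : CZ) : \pi_C_T f = 0 <-> exists h, f = delta T h.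
Proof.
have -> : 0 = \pi_C_T (0 : CZ) by rewrite raddf0.
by rewrite (coinvariants_eq T); rewrite subr0.
Qed.

(** By compactness [h] depends on some finite window. *)
Lemma coboundary_window m n (f h : CZ) : (0 < n)%N -> depends m 0 n%:Z f ->
  (forall x, (m %| (h x : int) - (h (T x) : int) - (f x : int))%Z) ->
  depends m 0 (n%:Z - 1) h.
Proof.
move=> n0 df hf; have [N hN] := locally_constant_window finE h.
apply: (depends_coboundary n0 df hf (a := - N%:Z) (b := N%:Z)).
by move=> x y /hN ->; rewrite subrr dvdz0.
Qed.

Lemma word_class_ker l (M : 'M[int]_(nwords adm l, nwords adm l.+1)) : (0 < l)%N ->
  (forall y, delta T (of_word y) = of_word (y *m M)) ->
  forall c, word_class c = 0 <-> exists y, c = y *m M.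
Proof.
move=> l0 hM c; rewrite class_eq0; split=> [[h e]|[y ->]]; last by exists (of_word y).
have [|y ey] := @depends_of_word l h l0.
  apply: (@coboundary_window _ _ (of_word c)) => //.
    by have := of_word_depends c; have -> : l.+1%:Z - 1 = l%:Z by lia.
  by move=> x; rewrite e deltaE subrr dvdz0.
by exists y; apply: (of_word_inj (ltn0Sn l)); rewrite -hM -ey.
Qed.

(** An invariant function depends on one letter only, and takes the same value
    on two letters that follow each other. *)
Lemma invariant_constant (h : CZ) : delta T h = 0 -> forall x y, h x = h y.
Proof.
move=> h0; have hT x : (h x : int) = (h (T x) : int).
  by apply/eqP; rewrite -subr_eq0 -deltaE h0.
have dh : depends 0 0 0 h.
  have -> : (0 : int) = 1%:Z - 1 by [].
  apply: (@coboundary_window _ _ 0) => // x.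
  by rewrite -hT subrr sub0r dvdz0.
have start s : (0 < size s)%N -> sorted adm s ->
    exists x : W, forall i, (i < size s)%N -> val x i%:Z = nth e0 s i.
  exact: (walk_extend has_succ has_pred).
have ex e : exists x : W, val x 0 = e.
  by have [x xs] := start [:: e] isT isT; exists x; exact: (xs 0%N).
have [w wE] := choice ex.
have dh' x y : val x 0 = val y 0 -> h x = h y.
  move=> e; have : agree 0 0 x y by move=> k k0; have -> : k = 0 by lia.
  by move=> /dh; rewrite dvd0z subr_eq0 => /eqP.
have c := @conn (fun e => h (w e)); move=> x y.
rewrite (dh' x (w (val x 0))) ?wE// (dh' y (w (val y 0))) ?wE//; apply: c => e e' ee'.
have [z zs] := start [:: e; e'] isT ltac:(by rewrite /= ee').
rewrite (dh' (w e) z) ?wE; last by rewrite (zs 0%N).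
rewrite hT; apply: dh'; rewrite wE shiftE add0r; exact: (zs 1%N).
Qed.

Lemma coboundary_matrix_ker l (M : 'M[int]_(nwords adm l, nwords adm l.+1)) : (0 < l)%N ->
  (forall y, delta T (of_word y) = of_word (y *m M)) ->
  forall y : 'rV_(nwords adm l), y *m M = 0 <-> exists t, y = const_mx t.
Proof.
move=> l0 hM y.
have z0 : of_word (0 : 'rV_(nwords adm l.+1)) = 0.
  by apply/continuousEP => x; rewrite [LHS]of_wordE mxE.
split=> [yM|[t ->]].
  have hy : delta T (of_word y) = 0 by rewrite hM yM.
  have cst := invariant_constant hy.
  have [x0 _] := walk_extend has_succ has_pred e0 (s := [:: e0]) isT isT.
  exists (of_word y x0); apply/rowP => i; rewrite mxE.
  by have [x <-] := word_index_surj i l0; rewrite -of_wordE; exact: cst.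
apply: (of_word_inj (ltn0Sn l)); rewrite -hM z0.
by apply/continuousEP => x; rewrite [LHS]deltaE !of_wordE !mxE subrr.
Qed.

(** Here [k] and [h0] are the quotient and the remainder of [h] by [m].  What
    holds for [h] modulo [m] holds for [h0] exactly: this turns a multiple of a
    class that satisfies a condition into the class itself. *)
Lemma coboundary_reduce (f g h : CZ) (m : int) : f *~ m - g = delta T h ->
  exists k h0 : CZ, [/\ \pi_C_T f = \pi_C_T (f - delta T k),
    (f - delta T k) *~ m = g + delta T h0 &
    forall x y, (m %| (h x : int) - (h y : int))%Z -> h0 x = h0 y].
Proof.
move=> e; have [N hN] := locally_constant_window finE h.
have ck : continuous (fun x : W => ((h x : int) %/ m)%Z : intd).
  by apply: (@window_continuous _ _ _ _ N) => x y /hN ->.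
have c0 : continuous (fun x : W => ((h x : int) %% m)%Z : intd).
  by apply: (@window_continuous _ _ _ _ N) => x y /hN ->.
pose k : CZ := mkcts ck; pose h0 : CZ := mkcts c0.
have hE x : (h x : int) = (k x : int) * m + (h0 x : int) by exact: divz_eq.
exists k, h0; split.
- apply/(coinvariants_eq T); exists k; by rewrite opprB addrC subrK.
- apply/continuousEP => x; have e' := congr1 (fun u : CZ => u x : int) e.
  rewrite /= ctsBE ctsMzE deltaE !hE in e'.
  rewrite [LHS]ctsMzE ctsBE deltaE.
  rewrite -[RHS]/((g x : int) + (delta T h0 x : int)) deltaE.
  by move: e' => /eqP; rewrite subr_eq => /eqP e'; rewrite mulrBl e'; ring.
- by move=> x y; rewrite -eqz_mod_dvd => /eqP.
Qed.

(** If [m f] is the coboundary of [h], then [h] is invariant modulo [m], so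
    that its remainder modulo [m] is invariant. *)
Lemma coinvariants_torsion_free (x : C_T) (m : int) : m != 0 -> x *~ m = 0 -> x = 0.
Proof.
elim/quotW: x => f m0; rewrite -raddfMz => /class_eq0[h e1].
have e : f *~ m - 0 = delta T h by rewrite subr0.
have [k [h0 [-> e' h0E]]] := coboundary_reduce e.
have inv x : h0 (T x) = h0 x.
  apply: h0E; have := congr1 (fun u : CZ => u x : int) e1.
  rewrite /= ctsMzE deltaE => e''.
  have -> : (h (T x) : int) - (h x : int) = - ((f x : int) * m) by rewrite e''; ring.
  by rewrite rpredN dvdz_mull.
suff -> : f - delta T k = 0 by rewrite raddf0.
rewrite add0r in e'; apply/continuousEP => x; have := congr1 (fun u : CZ => u x : int) e'.
rewrite /= deltaE inv subrr ctsMzE => /eqP.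
by rewrite mulf_eq0 (negPf m0) orbF => /eqP.
Qed.

Definition letters_class (n : nat) : set C_T :=
  [set \pi_C_T f | f in [set f : CZ | depends 0 0 n%:Z f]].

Lemma letters_class_range n : letters_class n = range (@word_class n.+1).
Proof.
have e : n.+1%:Z - 1 = n%:Z by lia.
apply/seteqP; split=> [_ [f df <-]|_ [c _ <-]].
  by rewrite -e in df; have [c ->] := depends_of_word (ltn0Sn n) df; exists c.
by exists (of_word c) => //; have := of_word_depends c; rewrite e.
Qed.

Lemma letters_class_mono n : letters_class n `<=` letters_class n.+1.
Proof. by move=> _ [f df <-]; exists f => //; apply: dependsW df => //; lia. Qed.

(** Composing with the shift moves a window to the right and does not change the
    class. *)
Lemma letters_class_all x : exists n, letters_class n x.
Proof.
elim/quotW: x => f; have [N hN] := locally_constant_window finE f.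
have df : depends 0 (- N%:Z) N%:Z f by move=> x y /hN ->; rewrite subrr dvdz0.
suff : forall (j : nat) (b : int) (g : CZ), depends 0 (- j%:Z) b g ->
    exists g' : CZ, \pi_C_T g = \pi_C_T g' /\ depends 0 0 (b + j%:Z) g'.
  by move=> /(_ _ _ _ df)[g [-> dg]]; exists (N + N)%N; exists g.
elim=> [|j IH] b g dg; first by exists g; rewrite addr0; move: dg; rewrite oppr0.
have dgT : depends 0 (- j%:Z) (b + 1) (g \o T : CZ).
  have -> : - j%:Z = - j.+1%:Z + 1 by lia.
  exact: (depends_shift _ _ _ _).1 dg.
have [g' [e dg']] := IH _ _ dgT; exists g'; split; last first.
  by have -> : b + j.+1%:Z = b + 1 + j%:Z by lia.
by rewrite -e; apply/(coinvariants_eq T); exists g.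
Qed.

(** If [m f - g] is the coboundary of [h], with [g] a function of the letters
    0, ..., n, then modulo [m] the function [h] depends on the letters
    0, ..., n - 1, by [coboundary_window]; so the coboundary of its remainder
    modulo [m] is a function of the letters 0, ..., n, and so is [m f] after a
    change of [f] by a coboundary. *)
Lemma letters_class_pure n (x : C_T) (m : int) : (0 < n)%N -> m != 0 ->
  letters_class n (x *~ m) -> letters_class n x.
Proof.
elim/quotW: x => f n0 m0 [g dg]; rewrite -raddfMz => /esym/(coinvariants_eq T)[h e].
have [k [h0 [-> e' h0E]]] := coboundary_reduce e.
have dh : depends m 0 (n%:Z - 1) h.
  apply: (@coboundary_window m n (- g)) => // [x y xy|x].
    have := dg x y xy; rewrite dvd0z subr_eq0 => /eqP gxy.
    by rewrite -[(- g) x]/(- (g x : int)) -[(- g) y]/(- (g y : int)) gxy subrr dvdz0.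
  rewrite -[(- g) x]/(- (g x : int)) -deltaE -e ctsBE ctsMzE opprK subrK.
  exact: dvdz_mull.
have dh0 x y : agree 0 (n%:Z - 1) x y -> h0 x = h0 y by move=> /dh; exact: h0E.
exists (f - delta T k) => // x y xy.
have fx z : ((f - delta T k) z : int) * m = (g z : int) + ((h0 z : int) - (h0 (T z) : int)).
  by rewrite -ctsMzE e'.
rewrite dvd0z subr_eq0; apply/eqP; apply: (mulIf m0); rewrite !fx.
have := dg x y xy; rewrite dvd0z subr_eq0 => /eqP ->.
rewrite (dh0 x y) => [|i i0]; last by apply: xy; lia.
rewrite (dh0 (T x) (T y)) => // i i0; rewrite !shiftE; apply: xy; lia.
Qed.

Lemma nwords_gt0 l : (0 < nwords adm l)%N.
Proof.
have [x _] := walk_extend has_succ has_pred e0 (s := [:: e0]) isT isT.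
exact: leq_ltn_trans (ltn_ord (word_index l x)).
Qed.

(** The coboundaries among the functions of n + 1 letters are those of the
    functions of n letters, and only constants have coboundary 0. *)
Lemma letters_class_free n : (0 < n)%N -> exists2 r : nat,
  r%:Z = (nwords adm n.+1)%:Z - (nwords adm n)%:Z + 1 & free_submodule r (letters_class n).
Proof.
move=> n0; have [M hM] := coboundary_matrix n; rewrite letters_class_range.
apply: (free_cokernel_pos (nwords_gt0 n) (word_class_ker n0 hM) (coboundary_matrix_ker n0 hM)).
by move=> c m m0; rewrite raddfMz; exact: coinvariants_torsion_free.
Qed.

(** The classes of the functions of one letter need not form a module of the
    rank required for n = 0: functions of the origin of an edge have coboundaries
    that are functions of one letter.  Part of a basis of the next term is taken
    instead. *)
Lemma filtration_exists : exists (F : nat -> set C_T) (r : nat -> nat),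
  [/\ forall n, F n `<=` F n.+1,
      forall n, free_submodule (r n) (F n),
      forall n, (r n)%:Z = (nwords adm n.+1)%:Z - (nwords adm n)%:Z + 1,
      forall x, exists n, F n x
    & forall n, torsion_free_quotient (F n.+1) (F n)].
Proof.
have [r rP] := choice (fun n => let: ex_intro2 r h1 h2 := @letters_class_free n.+1 (ltn0Sn n) in
  ex_intro (fun r : nat => r%:Z = (nwords adm n.+2)%:Z - (nwords adm n.+1)%:Z + 1 /\
    free_submodule r (letters_class n.+1)) r (conj h1 h2)).
have r0 : (nwords adm 1 <= r 0)%N.
  by have [e _] := rP 0%N; have := nwords_double; lia.
have [F0 [F01 F0free F0pure]] := free_submodule_sub r0 (rP 0%N).2.
exists (fun n => if n is n'.+1 then letters_class n else F0).
exists (fun n => if n is n'.+1 then r n' else nwords adm 1); split.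
- by case=> [|n] //; exact: letters_class_mono.
- by case=> [|n] //; case: (rP n).
- by case=> [|n]; [rewrite nwords0; lia|case: (rP n)].
- by move=> x; have [n xn] := letters_class_all x; exists n.+1; exact: letters_class_mono.
- case=> [|n] // x m _ m0; exact: letters_class_pure.
Qed.

End Filtration.

Unset Implicit Arguments.
Set Strict Implicit.
Set Printing Implicit Defensive.

Theorem proposition4p2 (R : realType)
    (p : nat) (p_prime : prime p)
    (Qp : fieldType) (nuQ : Qp -> R) (hQp : is_Qp p nuQ)
    (K : fieldExtType Qp) (nu : K -> R) (hnu : nonarch_abs nu)
    (nu_ext : forall a : Qp, nu a%:A = nuQ a)
    (g : nat) (g_ge2 : (2 <= g)%N)
    (Gam : set (PGL2 K)) (hGam : schottky nu g Gam) :
  let W := schottky_walks nu Gam in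
  let T := schottky_shift nu Gam in
  let adm := @schottky_adm R K nu Gam in
  exists phi : {additive coinvariants T -> H1 R (mapping_torus R T)},
    [/\ forall f : continuousType W intd,
          phi (\pi_(coinvariants T) f) = \pi_(H1 R _) (torus_exp R T f),
        bijective phi
      & (forall l, finite_set (words adm l)) /\
        exists (F : nat -> set (coinvariants T)) (r : nat -> nat),
          [/\ forall n, F n `<=` F n.+1,
              forall n, free_submodule (r n) (F n),
              forall n, (r n)%:Z = (nwords adm n.+1)%:Z - (nwords adm n)%:Z + 1,
              is_direct_limit F phi
            & forall n, torsion_free_quotient (F n.+1) (F n)]].
Proof.
move=> W T adm.
have [pi hpi] := uniformizer_exists p_prime hQp hnu nu_ext.
have TA := schottky_tree_action hnu hpi g_ge2 hGam.
have finE := edges_finite TA.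
have succ2 := edge_two_successors TA.
have pred1 := edge_predecessor TA.
have conn (c : schottky_edge nu Gam -> int) := edge_connected TA (c := c).
have [e0] := edge_exists TA.
have [phi [phi_pi phi_bij]] := torus_class_iso T (@walks_compact _ adm finE)
  (fun u => @walks_exp_lift _ adm finE R u).
have [F [r [F_mono F_free F_rank F_all F_pure]]] :=
  filtration_exists finE succ2 pred1 conn e0.
exists phi; split=> //; split; first exact: words_finite.
exists F, r; split=> //; exact: union_direct_limit.
Qed.
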